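(* Let $N\ge2$, let $X$ be a complex Fréchet space, and let $T_1,\dots,T_N\in\mathfrak L(X)$. Assume there exist a holomorphic map $E:O\to X$ defined on a connected open set $O\subset\mathbb C$, and non-constant holomorphic functions $\phi_1,\dots,\phi_N$ defined on a connected open set containing $O$, such that: the closed linear span of $E(O)$ is $X$; $T_iE(z)=\phi_i(z)E(z)$ for every $i=1,\dots,N$ and every $z\in O$; and $O\cap\phi_i^{-1}(\mathbb T)\cap\bigcap_{j\ne i}\phi_j^{-1}(\mathbb D)\ne\emptyset$ for every $i=1,\dots,N$. Then $(T_1,\dots,T_N)$ is densely $d$-frequently hypercyclic.
   Context: $\mathbb D$ is the open unit disk and $\mathbb T$ the unit circle. A vector $x$ is $d$-frequently hypercyclic for $(T_1,\dots,T_N)$ if for every non-empty open $W\subset X^N$ the set $\{n\in\mathbb N:(T_1^nx,\dots,T_N^nx)\in W\}$ has positive lower density; the tuple is densely $d$-frequently hypercyclic if the set of such vectors is dense in $X$. *)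

(* Defs.v *)
From HB Require Import structures.
From mathcomp Require Import all_boot all_order all_algebra.
From mathcomp Require Import all_classical all_reals all_analysis.
From mathcomp.real_closed Require Import complex.
Import Order.TTheory GRing.Theory Num.Theory.
Import numFieldTopology.Exports numFieldNormedType.Exports.

Set Implicit Arguments.
Unset Strict Implicit.
Unset Printing Implicit Defensive.

Local Open Scope classical_set_scope.
Local Open Scope ring_scope.

(* The complex field: R[i] for R : realType, viewed through the regular
   alias ^o so that it carries its canonical (norm) topology. *)
Definition Cplx (R : realType) : Type := (R[i])^o.

(** A (complex) Fréchet space: a locally convex tvs (tvsType) which is
    Hausdorff, metrizable (countable base of entourages of its uniformity)
    and complete (every proper Cauchy filter converges). *)
Definition frechet (K : numDomainType) (X : tvsType K) : Prop :=
  [/\ hausdorff_space X,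
      (exists B : nat -> set (X * X),
          (forall n, entourage (B n)) /\
          (forall U, entourage U -> exists n, B n `<=` U))
    & (forall F : set_system X, ProperFilter F -> cauchy F -> exists l : X, F --> l)].

Definition holomorphic_on (R : realType) (V : tvsType (Cplx R))
    (f : Cplx R -> V) (O : set (Cplx R)) : Prop :=
  forall z, O z -> exists l : V,
    h^-1 *: (f (z + h) - f z) @[h --> (0 : Cplx R)^'] --> l.

Definition lin_span (K : numDomainType) (X : tvsType K) (S : set X) : set X :=
  [set x | exists (n : nat) (c : 'I_n -> K) (v : 'I_n -> X),
      (forall k, S (v k)) /\ x = \sum_(k < n) c k *: v k].

Definition closed_lin_span (K : numDomainType) (X : tvsType K) (S : set X) :
  set X := closure (lin_span S).

Definition count_upto (A : set nat) (n : nat) : nat :=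
  #|[set k : 'I_n.+1 | `[< A (nat_of_ord k) >] ]|.

Definition lower_density (R : realType) (A : set nat) : \bar R :=
  limn_einf (fun n => ((count_upto A n)%:R / (n.+1)%:R : R)%:E).

Definition d_freq_hypercyclic_vector (R : realType) (K : numDomainType)
    (X : tvsType K) (N : nat) (T : 'I_N -> X -> X) (x : X) : Prop :=
  forall W : set {ptws 'I_N -> X}, open W -> W !=set0 ->
    (0 < lower_density R [set n | W (fun i => iter n (T i) x)])%E.

Definition densely_d_freq_hypercyclic (R : realType) (K : numDomainType)
    (X : tvsType K) (N : nat) (T : 'I_N -> X -> X) : Prop :=
  dense [set x : X | d_freq_hypercyclic_vector R T x].

(* Main.v *)
(* Write T_i E(z) = phi_i(z) E(z). Near a point z with |phi_i(z)| = 1 and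
   |phi_j(z)| < 1 for j <> i, the open mapping theorem provides eigenvectors of T_i for
   the eigenvalues exp(i pi k / n); averaging a fixed number K of consecutive ones gives
   T_i-periodic vectors (of period 2n) which are close to E(z) at time n, small at all
   times not close to n modulo 2n, and whose orbits under the other T_j are uniformly
   small and tend to 0. By linearity and by the identity theorem applied to E modulo a
   closed subspace, E(z) can be replaced by any vector of X.

   Summing such vectors u_(l,i) over stages l, with half-periods h_l each a
   multiple of the previous period 2 h_(l-1), the orbit of the sum x at the odd multiples
   of h_l sees the earlier stages through a constant vector, which is subtracted from
   the target y_(l,i) of stage l, and the later stages only inside windows whose total
   density is small compared with 1 / h_l. Hence (T_1^m x, ..., T_N^m x) is close to
   (y_(l,1), ..., y_(l,N)) for a set of m of positive lower density. *)

Require Import Defs.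
From HB Require Import structures.
From mathcomp Require Import all_boot all_order all_algebra.
From mathcomp Require Import all_classical all_reals all_analysis.
From mathcomp.real_closed Require Import complex.
From mathcomp Require Import lra ring zify.
Import Order.TTheory GRing.Theory Num.Theory.
Import numFieldTopology.Exports numFieldNormedType.Exports.
Local Open Scope classical_set_scope.
Local Open Scope ring_scope.

Set Implicit Arguments.
Unset Strict Implicit.
Unset Printing Implicit Defensive.

(** * Real modulus on the complex field *)

(** The vectors admitting building blocks for $T_i$ form a closed subspace, known at first to
    contain $E(z)$ only for unimodular $\phi_i(z)$ near one point. No linear functional is used to
    leave that curve: the identity theorem is proved modulo the subspace itself, from a Cauchy
    formula in which trapezoid sums stand for line integrals.

    The gluing dictates what a block must satisfy. Every large half-period has to be available, so
    that one $h_l$ serves all $i$ and can be a prescribed multiple. The window parameter $d$ is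
    fixed before $n$: with $d_k = 64\cdot 2^k M_k$, where $M_k$ is the period reached before stage
    $k$ (so $M_k \ge h_l$ for $l<k$), the later windows cannot exhaust the density $1/(2h_l)$ of the
    odd multiples of $h_l$. For $j\ne i$ two controls of the $T_j$-orbit are needed: uniform
    smallness for the stages after $l$, and convergence to $0$ for the earlier ones, which need not
    be small; $h_l$ is taken so late that their $T_j$-orbits have died out. *)

Definition cabs (R : realType) (z : Cplx R) : R := ComplexField.Normc.normc (z : R[i]).
Definition rc (R : realType) (x : R) : Cplx R := (x%:C)%C.

Section Modulus.
Context {R : realType}.
Implicit Types (z w : Cplx R) (x y : R).

(** The norm of a complex number is itself an element of the complex field, with its partial order;
    [cabs] is its real value, so that estimates take place in the totally ordered field [R]. *)
Lemma normCE z : `|z| = rc (cabs z).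
Proof. by rewrite /cabs /rc; case: z. Qed.

Lemma rc_le x y : (rc x <= rc y) = (x <= y). Proof. exact: lecR. Qed.
Lemma rc_lt x y : (rc x < rc y) = (x < y). Proof. exact: ltcR. Qed.
Lemma rcD x y : rc (x + y) = rc x + rc y. Proof. exact: (rmorphD (real_complex R)). Qed.
Lemma rcB x y : rc (x - y) = rc x - rc y. Proof. exact: (rmorphB (real_complex R)). Qed.
Lemma rcM x y : rc (x * y) = rc x * rc y. Proof. exact: (rmorphM (real_complex R)). Qed.
Lemma rcV x : rc x^-1 = (rc x)^-1. Proof. exact: (fmorphV (real_complex R)). Qed.
Lemma rc1 : rc 1 = 1 :> Cplx R. Proof. by []. Qed.
Lemma rc0 : rc 0 = 0 :> Cplx R. Proof. by []. Qed.
Lemma rc_inj : injective (@rc R). Proof. exact: complexI. Qed.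

Lemma natr_rc n : (n%:R : Cplx R) = rc n%:R.
Proof. by elim: n => [|n IH]; rewrite ?rc0 // -!natr1 rcD rc1 IH. Qed.

Lemma cabsM z w : cabs (z * w) = cabs z * cabs w.
Proof. exact: ComplexField.Normc.normcM. Qed.
Lemma cabsV z : cabs z^-1 = (cabs z)^-1.
Proof. exact: ComplexField.Normc.normcV. Qed.
Lemma cabsD z w : cabs (z + w) <= cabs z + cabs w.
Proof. by rewrite -rc_le rcD -!normCE; exact: ler_normD. Qed.
Lemma cabsN z : cabs (- z) = cabs z.
Proof. by apply: rc_inj; rewrite -!normCE normrN. Qed.
Lemma cabsBC z w : cabs (z - w) = cabs (w - z).
Proof. by rewrite -cabsN opprB. Qed.
Lemma cabs0 : cabs (0 : Cplx R) = 0. Proof. by apply: rc_inj; rewrite -normCE normr0. Qed.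
Lemma cabs1 : cabs (1 : Cplx R) = 1. Proof. by apply: rc_inj; rewrite -normCE normr1. Qed.
Lemma cabs_ge0 z : 0 <= cabs z.
Proof. by rewrite -rc_le -normCE rc0 normr_ge0. Qed.
Lemma cabs_eq0 z : (cabs z == 0) = (z == 0).
Proof. by rewrite -(inj_eq rc_inj) -normCE rc0 normr_eq0. Qed.
Lemma cabs_gt0 z : (0 < cabs z) = (z != 0).
Proof. by rewrite lt0r cabs_ge0 andbT cabs_eq0. Qed.
Lemma cabsX z n : cabs (z ^+ n) = cabs z ^+ n.
Proof. by elim: n => [|n IH]; rewrite ?expr0 ?cabs1 // !exprS cabsM IH. Qed.
Lemma cabs_rc x : cabs (rc x) = `|x|.
Proof. by rewrite /cabs /rc /= expr0n addr0 sqrtr_sqr. Qed.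
Lemma cabs_re z : `|complex.Re z| <= cabs z.
Proof. by rewrite -rc_le -normCE; exact: (normc_ge_Re z). Qed.
Lemma cabs_im z : `|complex.Im z| <= cabs z.
Proof.
case: z => a b /=; rewrite /cabs /= -sqrtr_sqr ler_wsqrtr //.
by rewrite lerDr sqr_ge0.
Qed.
Lemma cabs_re_im z : cabs z <= `|complex.Re z| + `|complex.Im z|.
Proof.
case: z => a b /=; rewrite /cabs /=.
rewrite -[leRHS]ger0_norm ?addr_ge0 // -sqrtr_sqr ler_wsqrtr //.
rewrite sqrrD !real_normK ?num_real // -addrA (addrC (_ *+ 2)) addrA lerDl.
by rewrite mulrn_wge0 // mulr_ge0.
Qed.
Lemma cabs_dist z w : cabs z - cabs w <= cabs (z - w).
Proof. by rewrite lerBlDr (le_trans _ (cabsD _ _)) // subrK. Qed.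
Lemma norm_lt_rc z x : (`|z| < rc x) = (cabs z < x). Proof. by rewrite normCE rc_lt. Qed.
Lemma norm_eq1 z : `|z| = 1 -> cabs z = 1.
Proof. by move=> h; apply: rc_inj; rewrite -normCE. Qed.
Lemma norm_lt1 z : `|z| < 1 -> cabs z < 1.
Proof. by rewrite -(rc1) norm_lt_rc. Qed.

Lemma nbhs_cabsP z (A : set (Cplx R)) :
  nbhs z A <-> exists2 e : R, 0 < e & forall w, cabs (w - z) < e -> A w.
Proof.
split=> [/nbhs_ballP[e /= e0 h]|[e e0 h]].
  have e_eq : e = rc (complex.Re e).
    by move: e0; rewrite ltcE /= => /andP[/eqP e0 _]; case: e e0 {h} => a b /= ->.
  exists (complex.Re e); first by rewrite -rc_lt -e_eq.
  move=> w wz; apply: h; rewrite -ball_normE /= e_eq norm_lt_rc.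
  by rewrite cabsBC.
apply/nbhs_ballP; exists (rc e); first by rewrite /= -rc0 rc_lt.
by move=> w; rewrite -ball_normE /= norm_lt_rc cabsBC; exact: h.
Qed.

Lemma near_cabs z (e : R) : 0 < e -> \forall w \near z, cabs (w - z) < e.
Proof. by move=> e0; apply/nbhs_cabsP; exists e. Qed.

Lemma open_cabsP (O : set (Cplx R)) : open O <->
  forall z, O z -> exists2 e : R, 0 < e & forall w, cabs (w - z) < e -> O w.
Proof.
rewrite openE; split=> h z Oz; first by apply/nbhs_cabsP; exact: h.
by apply/nbhs_cabsP; exact: h.
Qed.

End Modulus.

(** * Continuous seminorms *)

(** Continuity is asked at $0$ only; subadditivity carries it to every point ([sn_near]). *)
Definition seminorm (R : realType) (X : tvsType (Cplx R)) (p : X -> R) : Prop :=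
  [/\ forall x y, p (x + y) <= p x + p y,
      forall c x, p (c *: x) = cabs c * p x
    & forall e, 0 < e -> \forall x \near (0 : X), p x < e].

Section Seminorms.
Context {R : realType} {X : tvsType (Cplx R)}.
Implicit Types (p : X -> R) (x y : X) (V : set X).

Lemma snD p : seminorm p -> forall x y, p (x + y) <= p x + p y.
Proof. by case. Qed.
Lemma snZ p : seminorm p -> forall c x, p (c *: x) = cabs c * p x.
Proof. by case. Qed.
Lemma sn0 p : seminorm p -> p 0 = 0.
Proof. by move=> sp; rewrite -(scale0r (0 : X)) snZ // cabs0 mul0r. Qed.
Lemma snN p : seminorm p -> forall x, p (- x) = p x.
Proof. by move=> sp x; rewrite -scaleN1r snZ // cabsN cabs1 mul1r. Qed.
Lemma snBC p : seminorm p -> forall x y, p (x - y) = p (y - x).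
Proof. by move=> sp x y; rewrite -snN // opprB. Qed.
Lemma snB p : seminorm p -> forall x y, p (x - y) <= p x + p y.
Proof. by move=> sp x y; rewrite (le_trans (snD sp _ _)) // snN. Qed.
Lemma sn_ge0 p : seminorm p -> forall x, 0 <= p x.
Proof.
move=> sp x; have := snD sp x (- x); rewrite subrr sn0 // snN //; lra.
Qed.
Lemma sn_tri p : seminorm p -> forall y x z, p (x - z) <= p (x - y) + p (y - z).
Proof. by move=> sp y x z; rewrite (le_trans _ (snD sp _ _)) // addrA subrK. Qed.
Lemma sn_dist p : seminorm p -> forall x y, p x <= p y + p (x - y).
Proof. by move=> sp x y; rewrite (le_trans _ (snD sp _ _)) // addrC subrK. Qed.
Lemma sn_sum p : seminorm p -> forall (I : Type) (r : seq I) (P : pred I) (F : I -> X),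
  p (\sum_(i <- r | P i) F i) <= \sum_(i <- r | P i) p (F i).
Proof.
move=> sp I r P F; elim/big_rec2: _ => [|i y x _ h]; first by rewrite sn0.
by rewrite (le_trans (snD sp _ _)) // lerD2l.
Qed.

Lemma sn_near p : seminorm p -> forall x e, 0 < e -> \forall y \near x, p (y - x) < e.
Proof.
move=> sp x e e0; have [_ _ /(_ _ e0) /(nbhsT x)] := sp.
by apply: filterS => y /= [z pz <-]; rewrite addrC addKr.
Qed.

Lemma sn_cvg p (T : Type) (F : set_system T) (f : T -> X) l : Filter F ->
  seminorm p -> f @ F --> l -> forall e, 0 < e -> \forall t \near F, p (f t - l) < e.
Proof. by move=> FF sp fl e e0; exact: (fl _ (sn_near sp l e0)). Qed.

Lemma snDsn p q : seminorm p -> seminorm q -> seminorm (fun x => p x + q x).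
Proof.
move=> sp sq; split=> [x y|c x|e e0].
- by have := snD sp x y; have := snD sq x y; lra.
- by rewrite !snZ // mulrDr.
- have e2 : 0 < e / 2 by lra.
  have [_ _ /(_ _ e2) hp] := sp; have [_ _ /(_ _ e2) hq] := sq.
  by apply: filterS2 hp hq => x; lra.
Qed.

Lemma sn_cst0 : seminorm (fun _ : X => 0 : R).
Proof.
by split=> [x y|c x|e e0]; rewrite ?addr0 ?mulr0 //; exact: nearW.
Qed.

Lemma sn_bigsum (I : Type) (r : seq I) (p : I -> X -> R) :
  (forall i, seminorm (p i)) -> seminorm (fun x => \sum_(i <- r) p i x).
Proof.
move=> sp; elim: r => [|i r IH].
  suff -> : (fun x => \sum_(i <- [::]) p i x) = (fun _ => 0) by exact: sn_cst0.
  by apply/funext => x; rewrite big_nil.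
suff -> : (fun x => \sum_(i <- i :: r) p i x) =
   (fun x => p i x + \sum_(i <- r) p i x) by exact: snDsn.
by apply/funext => x; rewrite big_cons.
Qed.

Lemma sn_comp p (T : X -> X) : seminorm p -> (forall x y, T (x + y) = T x + T y) ->
  (forall c x, T (c *: x) = c *: T x) -> continuous T -> seminorm (p \o T).
Proof.
move=> sp TD TZ Tc; split=> [x y|c x|e e0] /=.
- by rewrite TD snD.
- by rewrite TZ snZ.
- have T0 : T 0 = 0 by rewrite -(scale0r (0 : X)) TZ !scale0r.
  have := sn_cvg (nbhs_filter _) sp (Tc 0) e0.
  by apply: filterS => x; rewrite T0 subr0.
Qed.

(** Local convexity gives a convex [C], not a balanced one. The points whose multiples by the closed
    unit disk stay in [C] form a balanced convex set, and joint continuity of scaling at $(0,0)$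
    makes it a neighbourhood. *)
Lemma balanced_core V : nbhs 0 V -> exists2 B : set X, nbhs 0 B &
  [/\ B `<=` V, (forall c x, cabs c <= 1 -> B x -> B (c *: x))
    & (forall x y (t : R), 0 <= t <= 1 -> B x -> B y -> B (rc t *: x + rc (1 - t) *: y))].
Proof.
move=> V0; have [BB Bconv [Bopen Bbas]] := @locally_convex _ X.
have [C [BC C0] CV] := Bbas 0 V V0.
have nC : nbhs 0 C by apply: open_nbhs_nbhs; split => //; exact: Bopen.
exists [set x | forall c, cabs c <= 1 -> C (c *: x)].
  have := @scale_continuous _ X (0, 0) C; rewrite /= scale0r => /(_ nC).
  move=> [[A W]] /= [/nbhs_cabsP [e e0 hA] nW] hAW.
  have e20 : rc (e / 2) != 0 :> Cplx R.
    by rewrite -cabs_gt0 cabs_rc normr_gt0; apply: lt0r_neq0; lra.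
  have := nbhs0Z e20 nW; apply: filterS => _ [x Wx <-] c c1.
  rewrite scalerA; apply: (hAW (_, x)); split => //=; apply: hA.
  rewrite subr0 cabsM cabs_rc gtr0_norm ?divr_gt0 //.
  have := cabs_ge0 c; nra.
split=> [x Bx|c x c1 Bx d d1|x y t /andP[t0 t1] Bx By d d1].
- by apply: CV; rewrite -[x]scale1r; apply: Bx; rewrite cabs1.
- rewrite scalerA; apply: Bx; rewrite cabsM.
  by have := cabs_ge0 c; have := cabs_ge0 d; nra.
- have h0 : 0 <= rc t :> Cplx R by rewrite -rc0 rc_le.
  have h1 : rc t <= 1 :> Cplx R by rewrite -rc1 rc_le.
  have cC : convex_set C by apply: Bconv; rewrite inE.
  have := cC (d *: x) (d *: y) (Itv01 h0 h1).
  rewrite !inE => /(_ (Bx _ d1) (By _ d1)).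
  rewrite /conv /= scalerDr !scalerA (mulrC d) (mulrC d).
  by rewrite rcB rc1.
Qed.

(** The seminorm is the Minkowski gauge of the balanced convex core. *)
Lemma nbhs_seminorm V : nbhs 0 V -> exists2 p, seminorm p & forall x, p x < 1 -> V x.
Proof.
move=> /balanced_core [B nB [BV Bbal Bconv]].
pose G x := [set t : R | 0 < t /\ B (rc t^-1 *: x)].
have G0 x : G x !=set0.
  have := @scale_continuous _ X (0, x) B; rewrite /= scale0r => /(_ nB).
  move=> [[A W]] /= [/nbhs_cabsP [e e0 hA] nW] hAW.
  exists (2 / e); split; first by rewrite divr_gt0.
  apply: (hAW (_, x)); split => /=; last exact: nbhs_singleton.
  apply: hA; rewrite subr0 cabs_rc invf_div gtr0_norm ?divr_gt0 //; lra.
have Glb x : has_lbound (G x) by exists 0 => t [] /ltW.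
have Ginf x : has_inf (G x) by split.
pose p x := inf (G x).
have p_ge0 x : 0 <= p x by apply: lb_le_inf => // t [] /ltW.
have p_le x t : 0 < t -> B (rc t^-1 *: x) -> p x <= t.
  by move=> t0 Bt; apply: ge_inf.
have p_lt x t : p x < t -> B (rc t^-1 *: x).
  move=> pt; have t0 : 0 < t by exact: le_lt_trans (p_ge0 x) pt.
  have [s [s0 Bs] st] : exists2 s, G x s & s < t.
    have := @inf_adherent _ (G x) (t - p x); rewrite subr_gt0 => /(_ pt (Ginf x)).
    by move=> [s Gs]; rewrite addrC subrK => ?; exists s.
  have -> : rc t^-1 *: x = rc (s / t) *: (rc s^-1 *: x).
    by rewrite scalerA -rcM mulrAC divff ?mul1r // gt_eqF.
  apply: Bbal => //; rewrite cabs_rc gtr0_norm ?divr_gt0 //.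
  by rewrite ler_pdivrMr // mul1r ltW.
have pZ_le c x : p (c *: x) <= cabs c * p x.
  apply/ler_addgt0Pr => e e0.
  have [->|c0] := eqVneq c 0.
    rewrite scale0r cabs0 mul0r add0r; apply: p_le => //; rewrite scaler0.
    exact: nbhs_singleton nB.
  have ca : 0 < cabs c by rewrite cabs_gt0.
  set s := p x + e / cabs c.
  have ps : p x < s by rewrite /s ltrDl divr_gt0.
  have s0 : 0 < s by exact: le_lt_trans (p_ge0 x) ps.
  have -> : cabs c * p x + e = cabs c * s.
    by rewrite /s mulrDr mulrCA divff ?mulr1 // gt_eqF.
  apply: p_le; first by rewrite mulr_gt0.
  have -> : rc (cabs c * s)^-1 *: (c *: x) = (c * rc (cabs c)^-1) *: (rc s^-1 *: x).
    by rewrite !scalerA invfM rcM; congr (_ *: _); ring.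
  apply: Bbal; last exact: p_lt.
  rewrite cabsM cabs_rc ger0_norm ?invr_ge0 ?cabs_ge0 // divff // gt_eqF //.
exists p; last first.
  by move=> x /p_lt; rewrite invr1 rc1 scale1r; exact: BV.
split=> [x y|c x|e e0].
- apply/ler_addgt0Pr => e e0.
  set s := p x + e / 2; set t := p y + e / 2.
  have ps : p x < s by rewrite /s; lra.
  have pt : p y < t by rewrite /t; lra.
  have s0 : 0 < s by exact: le_lt_trans (p_ge0 x) ps.
  have t0 : 0 < t by exact: le_lt_trans (p_ge0 y) pt.
  have -> : p x + p y + e = s + t by rewrite /s /t; lra.
  have st0 : 0 < s + t by rewrite addr_gt0.
  apply: p_le => //.
  have -> : rc (s + t)^-1 *: (x + y) =
     rc (s / (s + t)) *: (rc s^-1 *: x) + rc (1 - s / (s + t)) *: (rc t^-1 *: y).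
    rewrite !scalerA scalerDr -!rcM; congr (rc _ *: _ + rc _ *: _).
      by field; rewrite !gt_eqF.
    by field; rewrite !gt_eqF.
  apply: Bconv; [|exact: p_lt|exact: p_lt].
  rewrite divr_ge0 ?(ltW s0) ?(ltW st0) //= ler_pdivrMr // mul1r lerDl ltW //.
- have [->|c0] := eqVneq c 0.
    apply/eqP; rewrite eq_le pZ_le cabs0 mul0r p_ge0 //.
  apply/eqP; rewrite eq_le pZ_le /=.
  have := pZ_le c^-1 (c *: x); rewrite scalerA mulVf // scale1r cabsV.
  by rewrite -ler_pdivlMl ?invr_gt0 ?cabs_gt0 // invrK.
- have e20 : rc (e / 2) != 0 :> Cplx R.
    by rewrite -cabs_gt0 cabs_rc normr_gt0; apply: lt0r_neq0; lra.
  have := nbhs0Z e20 nB; apply: filterS => _ [x Bx <-].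
  apply: (@le_lt_trans _ _ (e / 2)); last lra.
  apply: p_le; first lra.
  rewrite scalerA -rcM mulVf ?scale1r //; apply: lt0r_neq0; lra.
Qed.

Lemma nbhs_seminormP x V : nbhs x V ->
  exists2 p, seminorm p & forall y, p (y - x) < 1 -> V y.
Proof.
move=> nV; have := nbhsT (- x) ; have := nbhsB (- x) nV; rewrite addNr => nV0 _.
have [p sp pV] := nbhs_seminorm nV0; exists p => // y /pV [z Vz].
by rewrite [in RHS]addrC => /addrI <-.
Qed.

End Seminorms.

(** * Trapezoid sums and Goursat's lemma *)

Definition mid (R : realType) (a b : Cplx R) : Cplx R := rc 2^-1 * (a + b).

(* Trapezoid sum with [2 ^ n] steps on the segment [a, b]. It is exactly additive
   under bisection, exactly antisymmetric in [a, b] and exact on affine functions;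
   these identities replace the corresponding ones for the line integral, so that
   neither a vector-valued integral nor completeness of [X] is needed. *)
Fixpoint trapz (R : realType) (X : tvsType (Cplx R)) (n : nat) (f : Cplx R -> X)
    (a b : Cplx R) : X :=
  if n is n'.+1 then trapz n' f a (mid a b) + trapz n' f (mid a b) b
  else (b - a) *: (rc 2^-1 *: (f a + f b)).

Definition seg (R : realType) (a b z : Cplx R) : Prop :=
  exists2 t : R, 0 <= t <= 1 & z = a + rc t * (b - a).

Definition tri_trapz (R : realType) (X : tvsType (Cplx R)) (n : nat) (f : Cplx R -> X)
    (a b c : Cplx R) : X := trapz n f a b + trapz n f b c + trapz n f c a.

Section Trapezoid.
Context {R : realType} {X : tvsType (Cplx R)}.
Implicit Types (f g : Cplx R -> X) (a b c z w : Cplx R).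

Lemma rc_half2 : rc 2^-1 + rc 2^-1 = 1 :> Cplx R.
Proof. by rewrite -rcD -rc1; congr rc; lra. Qed.

Lemma half_inv : (rc 2^-1 : Cplx R) = 2^-1.
Proof. by rewrite rcV; congr _^-1; rewrite (_ : 2 = 1 + 1) // rcD. Qed.

Lemma midC a b : mid a b = mid b a. Proof. by rewrite /mid addrC. Qed.
Lemma midBl a b : mid a b - a = rc 2^-1 * (b - a).
Proof. rewrite /mid half_inv; by field. Qed.
Lemma midBr a b : b - mid a b = rc 2^-1 * (b - a).
Proof. rewrite /mid half_inv; by field. Qed.

Lemma seg_l a b : seg a b a.
Proof. by exists 0; rewrite ?lexx ?ler01 // rc0 mul0r addr0. Qed.
Lemma seg_r a b : seg a b b.
Proof. by exists 1; rewrite ?lexx ?ler01 // rc1 mul1r addrC subrK. Qed.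

Lemma seg_midl a b z : seg a (mid a b) z -> seg a b z.
Proof.
move=> [t t01 ->]; exists (t / 2); first by lra.
by rewrite midBl mulrA -rcM.
Qed.

Lemma segC a b z : seg a b z -> seg b a z.
Proof.
move=> [t t01 ->]; exists (1 - t); first by lra.
by rewrite rcB rc1; ring.
Qed.

Lemma seg_midr a b z : seg (mid a b) b z -> seg a b z.
Proof. by move=> h; apply: segC; apply: seg_midl; rewrite midC; exact: segC. Qed.

Lemma trapz_ext n f g a b : (forall z, seg a b z -> f z = g z) -> trapz n f a b = trapz n g a b.
Proof.
elim: n a b => [|n IH] a b h /=; first by rewrite !h //; [exact: seg_r|exact: seg_l].
by rewrite !IH // => z hz; apply: h; [exact: seg_midr|exact: seg_midl].
Qed.

Lemma trapzD n f g a b : trapz n (fun z => f z + g z) a b = trapz n f a b + trapz n g a b.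
Proof.
elim: n a b => [|n IH] a b /=; last by rewrite !IH addrACA.
by rewrite -!scalerDr addrACA.
Qed.

Lemma trapzZ n f (k : Cplx R) a b : trapz n (fun z => k *: f z) a b = k *: trapz n f a b.
Proof.
elim: n a b => [|n IH] a b /=; last by rewrite !IH scalerDr.
by rewrite -scalerDr !scalerA; congr (_ *: _); ring.
Qed.

Lemma trapzN n f a b : trapz n (fun z => - f z) a b = - trapz n f a b.
Proof. by rewrite -scaleN1r -trapzZ; apply: trapz_ext => z _; rewrite scaleN1r. Qed.

Lemma trapzB n f g a b : trapz n (fun z => f z - g z) a b = trapz n f a b - trapz n g a b.
Proof. by rewrite trapzD trapzN. Qed.

Lemma trapz_rev n f a b : trapz n f b a = - trapz n f a b.
Proof.
elim: n a b => [|n IH] a b /=; last by rewrite [mid b a]midC (IH (mid a b) b) (IH a (mid a b)) opprD addrC.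
by rewrite -scaleNr opprB [f b + f a]addrC.
Qed.

Lemma trapz_le n f a b (p : X -> R) (M : R) : seminorm p ->
  (forall z, seg a b z -> p (f z) <= M) -> p (trapz n f a b) <= cabs (b - a) * M.
Proof.
move=> sp; elim: n a b => [|n IH] a b h /=.
  rewrite snZ // ler_wpM2l ?cabs_ge0 // snZ // cabs_rc ger0_norm //.
  have := snD sp (f a) (f b); have := h a (seg_l _ _); have := h b (seg_r _ _); lra.
rewrite (le_trans (snD sp _ _)) //.
have := IH a (mid a b) (fun z hz => h z (seg_midl hz)).
have := IH (mid a b) b (fun z hz => h z (seg_midr hz)).
rewrite midBl midBr !cabsM cabs_rc ger0_norm // -mulrA; lra.
Qed.

Lemma trapz_affine n (x y : X) a b :
  trapz n (fun z => x + z *: y) a b =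
  ((b *: x + (rc 2^-1 * b ^+ 2) *: y) - (a *: x + (rc 2^-1 * a ^+ 2) *: y)).
Proof.
elim: n a b => [|n IH] a b /=; last first.
  by rewrite !IH [LHS]addrC -[in LHS]addrA (addrA (- _)) addNr add0r.
rewrite !scalerA addrACA -scalerDl -[x in x + x + _]scale1r -scalerDl.
rewrite scalerDr !scalerA opprD addrACA -!scalerBl; congr (_ *: _ + _ *: _).
  by rewrite -mulrA (_ : _ * (1 + 1) = 1) ?mulr1 // mulrDr mulr1 rc_half2.
by ring.
Qed.

Lemma tri_trapz_affine n (x y : X) a b c : tri_trapz n (fun z => x + z *: y) a b c = 0.
Proof.
rewrite /tri_trapz !trapz_affine.
set A := (a *: _ + _); set B := (b *: _ + _); set C := (c *: _ + _).
by rewrite (addrC (B - A)) subrKA subrKA subrr.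
Qed.

Lemma tri_trapzB n f g a b c : tri_trapz n (fun z => f z - g z) a b c = tri_trapz n f a b c - tri_trapz n g a b c.
Proof. by rewrite /tri_trapz !trapzB !opprD [RHS](AC (3*3) ((1*4)*(2*5)*(3*6))). Qed.

Lemma tri_trapz_rot n f a b c : tri_trapz n f b c a = tri_trapz n f a b c.
Proof. by rewrite /tri_trapz [RHS](ACl (2*3*1)%AC). Qed.

(** Inner edges of the four midpoint triangles are run in both directions and cancel. The bisection
    uses up one level of refinement. *)
Lemma tri_trapz_sub n f a b c : tri_trapz n.+1 f a b c =
  tri_trapz n f a (mid a b) (mid c a) + tri_trapz n f (mid a b) b (mid b c) +
  tri_trapz n f (mid b c) c (mid c a) + tri_trapz n f (mid a b) (mid b c) (mid c a).
Proof.
rewrite /tri_trapz /=.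
set x := mid a b; set y := mid b c; set z := mid c a.
rewrite (trapz_rev n f y x) (trapz_rev n f z y) (trapz_rev n f x z).
move: (trapz n f a x) (trapz n f x b) (trapz n f b y) (trapz n f y c) (trapz n f c z) (trapz n f z a)
  (trapz n f y x) (trapz n f z y) (trapz n f x z) => A1 A2 A3 A4 A5 A6 B1 B2 B3.
rewrite [RHS](AC (3*3*3*3) (1*4*(5*7)*(8*3)*(6*10)*(9*11)*(2*12))) /=.
by rewrite !subrr !addr0.
Qed.

End Trapezoid.

(** A division-free derivative, tested on one seminorm at a time: precisely the affine approximation
    that Goursat's argument consumes. *)
Definition sderiv (R : realType) (X : tvsType (Cplx R)) (f : Cplx R -> X)
    (z : Cplx R) (l : X) : Prop :=
  forall p, seminorm p -> forall e : R, 0 < e -> exists2 d : R, 0 < d &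
    forall w, cabs (w - z) < d -> p (f w - f z - (w - z) *: l) <= e * cabs (w - z).

Definition vanishing (R : realType) (X : tvsType (Cplx R)) (u : nat -> X) : Prop :=
  forall p, seminorm p -> forall rho : R, 0 < rho ->
    exists n0, forall n, (n0 <= n)%N -> p (u n) <= rho.

Lemma dependent_choice_nat (A : Type) (P : nat -> A -> Prop) (Q : nat -> A -> A -> Prop)
    (a0 : A) : P 0%N a0 ->
  (forall k x, P k x -> exists y, P k.+1 y /\ Q k x y) ->
  exists F, F 0%N = a0 /\ forall k, P k (F k) /\ Q k (F k) (F k.+1).
Proof.
move=> P0 PS.
have /choice [h hP] : forall q : nat * A, exists y, P q.1 q.2 -> P q.1.+1 y /\ Q q.1 q.2 y.
  move=> [k x]; have [/PS [y Py]|nP] := pselect (P k x); first by exists y.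
  by exists x.
pose F := fix F k := if k is k'.+1 then h (k', F k') else a0.
have FP k : P k (F k) by elim: k => [//|k IH]; have [] := hP (k, F k) IH.
exists F; split=> // k; split; first exact: FP.
by have [] := hP (k, F k) (FP k).
Qed.

(** The intervals of radius $2\cdot 2^{-k}$ around [u k] are nested; the limit is the supremum of
    their left ends. *)
Lemma geometric_seq_limit (R : realType) (u : nat -> R) :
  (forall k, `|u k.+1 - u k| <= 2^-1 ^+ k) ->
  exists l, forall k, `|u k - l| <= 2 * 2^-1 ^+ k.
Proof.
move=> hu; pose v k := u k - 2 * 2^-1 ^+ k; pose w k := u k + 2 * 2^-1 ^+ k.
have vS k : v k <= v k.+1.
  by have := hu k; rewrite /v exprS ler_norml; lra.
have wS k : w k.+1 <= w k.
  by have := hu k; rewrite /w exprS ler_norml; lra.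
have vm : {homo v : m n / (m <= n)%N >-> m <= n} by apply: homo_leq => // x y z; exact: le_trans.
have wm : {homo w : m n / (m <= n)%N >-> n <= m}.
  by apply: homo_leq => // x y z h1 h2; exact: le_trans h2 h1.
have vw k : v k <= w k.
  have : 0 <= (2^-1 : R) ^+ k by rewrite exprn_ge0.
  by rewrite /v /w; lra.
have vw2 j k : v j <= w k.
  apply: le_trans (vm j (maxn j k) (leq_maxl _ _)) _.
  exact: le_trans (vw _) (wm k (maxn j k) (leq_maxr _ _)).
exists (sup (range v)) => k.
have h1 : v k <= sup (range v).
  by apply: ub_le_sup; [exists (w 0) => _ [j _ <-]|exists k].
have h2 : sup (range v) <= w k.
  by apply: ge_sup; [exists (v 0), 0|move=> _ [j _ <-]].
by rewrite ler_norml; move: h1 h2; rewrite /v /w; lra.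
Qed.

Lemma half_pow_small (R : realType) (C e : R) : 0 < e -> exists k, C * 2^-1 ^+ k < e.
Proof.
move=> e0; exists (Num.truncn (C / e)).+1; rewrite exprVn ltr_pdivrMr ?exprn_gt0 //.
rewrite mulrC -ltr_pdivrMr // (lt_trans (truncnS_gt _)) // -natrX ltr_nat.
exact: ltn_expl.
Qed.

Lemma seg_cabs (R : realType) (P Q w z : Cplx R) (r : R) :
  seg P Q w -> cabs (P - z) <= r -> cabs (Q - z) <= r -> cabs (w - z) <= r.
Proof.
move=> [t /andP[t0 t1] ->] hP hQ.
rewrite (_ : _ - z = rc (1 - t) * (P - z) + rc t * (Q - z)); last by rewrite rcB rc1; ring.
rewrite (le_trans (cabsD _ _)) // !cabsM !cabs_rc !ger0_norm ?subr_ge0 //.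
by have := cabs_ge0 (P - z); nra.
Qed.

Section Goursat.
Context {R : realType} {X : tvsType (Cplx R)}.
Implicit Types (f : Cplx R -> X) (a b c z w : Cplx R).

(** Triangles are encoded by real triples $(s,t,d)$: a vertex $a+se_1+te_2$ and a signed size,
    negative for the inverted middle triangle. Nested triangles thus reduce to two real sequences.
    At the limit point the affine approximation has zero triangle sum, and the error is of the order
    of the squared size, which beats $4^{-k}$. *)
Lemma goursat f a e1 e2 :
  (forall s t : R, 0 <= s -> 0 <= t -> s + t <= 1 ->
     exists l, sderiv f (a + rc s * e1 + rc t * e2) l) ->
  vanishing (fun n => tri_trapz n f a (a + e1) (a + e2)).
Proof.
move=> fd p sp rho rho0; apply: contrapT => nogood.
pose V (s t : R) := a + rc s * e1 + rc t * e2.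
pose T n (x : R * R * R) := let: (s, t, d) := x in
  tri_trapz n f (V s t) (V (s + d) t) (V s (t + d)).
(* The property bisected is a bound on all late sums of a triangle. If it holds for the four
   children with a quarter of the bound, it holds for the parent, so its failure passes to some
   child. *)
pose good (r : R) x := exists n0, forall n, (n0 <= n)%N -> p (T n x) <= r.
pose inv (x : R * R * R) := let: (s, t, d) := x in
  [/\ 0 <= s, 0 <= t & s + t <= 1] /\ [/\ 0 <= s + d, 0 <= t + d & s + t + d <= 1].
have midV s t s' t' : mid (V s t) (V s' t') = V ((s + s') / 2) ((t + t') / 2).
  by rewrite /mid /V !rcM !rcD half_inv; field.
have Tsub : forall n (s t d : R), T n.+1 (s, t, d) = T n (s, t, d / 2) + T n (s + d / 2, t, d / 2) +
    T n (s, t + d / 2, d / 2) + T n (s + d / 2, t + d / 2, - (d / 2)).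
  move=> n s t d; rewrite /T tri_trapz_sub !midV.
  rewrite (_ : (s + (s + d)) / 2 = s + d / 2); last lra.
  rewrite (_ : (s + d + s) / 2 = s + d / 2); last lra.
  rewrite (_ : (s + s) / 2 = s); last lra.
  rewrite (_ : (t + (t + d)) / 2 = t + d / 2); last lra.
  rewrite (_ : (t + d + t) / 2 = t + d / 2); last lra.
  rewrite (_ : (t + t) / 2 = t); last lra.
  rewrite (_ : s + d / 2 + d / 2 = s + d); last lra.
  rewrite (_ : t + d / 2 + d / 2 = t + d); last lra.
  rewrite !addrK; congr (_ + _ + _ + _); first by rewrite tri_trapz_rot.
  by rewrite [RHS]tri_trapz_rot.
have step (k : nat) x : inv x -> ~ good (rho / 4 ^+ k) x -> exists y,
    [/\ inv y, ~ good (rho / 4 ^+ k.+1) y, `|y.2| = `|x.2| / 2,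
        `|y.1.1 - x.1.1| <= `|x.2| & `|y.1.2 - x.1.2| <= `|x.2|].
  case: x => [[s t] d] [[s0 t0 st] [sd0 td0 std]] ngood; apply: contrapT => nex.
  have goodc y : inv y -> `|y.2| = `|d| / 2 -> `|y.1.1 - s| <= `|d| ->
     `|y.1.2 - t| <= `|d| -> good (rho / 4 ^+ k.+1) y.
    by move=> ? ? ? ?; apply: contrapT => ng; apply: nex; exists y.
  have hd : `|d / 2| = `|d| / 2 by rewrite normrM (@ger0_norm _ 2^-1).
  have nd := normr_ge0 d.
  have [n1 h1] : good (rho / 4 ^+ k.+1) (s, t, d / 2).
    by apply: goodc; rewrite //= ?subrr ?normr0 //; split; split; lra.
  have [n2 h2] : good (rho / 4 ^+ k.+1) (s + d / 2, t, d / 2).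
    apply: goodc; rewrite //= ?subrr ?normr0 // ?[s + _]addrC ?addrK ?hd //; try (clear -nd; lra).
    by clear -s0 t0 st sd0 td0 std; split; split; lra.
  have [n3 h3] : good (rho / 4 ^+ k.+1) (s, t + d / 2, d / 2).
    apply: goodc; rewrite //= ?subrr ?normr0 // ?[t + _]addrC ?addrK ?hd //; try (clear -nd; lra).
    by clear -s0 t0 st sd0 td0 std; split; split; lra.
  have [n4 h4] : good (rho / 4 ^+ k.+1) (s + d / 2, t + d / 2, - (d / 2)).
    apply: goodc; rewrite //= ?[s + _]addrC ?[t + _]addrC ?addrK ?normrN ?hd //; try (clear -nd; lra).
    by clear -s0 t0 st sd0 td0 std; split; split; lra.
  apply: ngood; exists (n1 + n2 + n3 + n4).+1 => -[//|n] hn.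
  have [m1 m2 m3 m4] : [/\ (n1 <= n)%N, (n2 <= n)%N, (n3 <= n)%N & (n4 <= n)%N].
    by clear -hn; split; lia.
  have -> : rho / 4 ^+ k = rho / 4 ^+ k.+1 + rho / 4 ^+ k.+1 + rho / 4 ^+ k.+1 + rho / 4 ^+ k.+1.
    by rewrite exprS invfM; clear; lra.
  rewrite Tsub (le_trans (snD sp _ _)) // lerD ?h4 //.
  rewrite (le_trans (snD sp _ _)) // lerD ?h3 //.
  by rewrite (le_trans (snD sp _ _)) // lerD ?h2 ?h1.
pose Pk k x := [/\ inv x, ~ good (rho / 4 ^+ k) x & `|x.2| = 2^-1 ^+ k].
pose Qk (k : nat) (x y : R * R * R) :=
  `|y.1.1 - x.1.1| <= `|x.2| /\ `|y.1.2 - x.1.2| <= `|x.2|.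
have [F [F0 FS]] : exists F : nat -> R * R * R, F 0%N = (0 : R, 0 : R, 1 : R) /\
   forall k, Pk k (F k) /\ Qk k (F k) (F k.+1).
  apply: dependent_choice_nat => [|k x [ix gx dx]].
    split; [by split; split; clear; lra| |by rewrite normr1 expr0].
    rewrite expr0 divr1 => -[n0 hn0]; apply: nogood; exists n0 => n /hn0.
    by rewrite /T /V !add0r rc0 rc1 !mul0r !mul1r !addr0.
  have [y [iy gy dy sy ty]] := step k x ix gx.
  by exists y; split; split => //; rewrite dy dx exprS mulrC.
have hs0 k : `|(F k.+1).1.1 - (F k).1.1| <= 2^-1 ^+ k by have [[_ _ <-] []] := FS k.
have ht0 k : `|(F k.+1).1.2 - (F k).1.2| <= 2^-1 ^+ k by have [[_ _ <-] []] := FS k.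
have [s0 hs] := geometric_seq_limit hs0.
have [t0 ht] := geometric_seq_limit ht0.
have small (x : R) (C : R) (u : nat -> R) : (forall k, 0 <= u k) ->
   (forall k, `|u k - x| <= C * 2^-1 ^+ k) -> 0 <= x.
  move=> u0 ux; rewrite leNgt; apply/negP => x0.
  have [k hk] := half_pow_small C (etrans (oppr_gt0 x) x0).
  by have := ux k; have := u0 k; rewrite ler_norml; move: hk; clear; lra.
have s0_ge0 : 0 <= s0.
  by apply: (small _ 2 (fun k => (F k).1.1)) => // k; have [[+ _ _] _] := FS k; case: (F k) => -[? ?] ? [[]].
have t0_ge0 : 0 <= t0.
  by apply: (small _ 2 (fun k => (F k).1.2)) => // k; have [[+ _ _] _] := FS k; case: (F k) => -[? ?] ? [[]].
have st0_le1 : s0 + t0 <= 1.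
  rewrite -subr_ge0; apply: (small _ 4 (fun k => 1 - ((F k).1.1 + (F k).1.2))) => k.
    by have [[+ _ _] _] := FS k; case: (F k) => -[? ?] ? [[]] /=; rewrite subr_ge0.
  have := hs k; have := ht k; rewrite !ler_norml; clear; lra.
have [l hl] := fd s0 t0 s0_ge0 t0_ge0 st0_le1.
set z0 := a + rc s0 * e1 + rc t0 * e2 in hl.
pose C0 := cabs e1 + cabs e2.
have C00 : 0 <= C0 by rewrite addr_ge0 ?cabs_ge0.
(* Each of the three edges contributes at most $2r\cdot er$, where $r=3C_0q$: in all
   $54\,eC_0^2q^2$. The $+1$ allows $C_0=0$. *)
have e0 : 0 < rho / (54 * (C0 + 1) ^+ 2) by rewrite divr_gt0 // mulr_gt0 // exprn_gt0 // ltr_wpDl.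
have [d d0 hd] := hl p sp _ e0.
have [k hk] := half_pow_small (4 * C0) d0.
have [[ik gk dk] _] := FS k.
have := hs k; have := ht k.
case: (F k) ik gk dk => -[s t] dl /= ik gk dk htk hsk.
apply: gk; exists 0%N => n _.
pose q : R := 2^-1 ^+ k; pose r := 3 * C0 * q.
have q0 : 0 <= q by rewrite exprn_ge0.
have r0 : 0 <= r by rewrite /r mulr_ge0 // mulr_ge0.
have rd : r < d by apply: le_lt_trans hk; rewrite /r -/q ler_wpM2r //; clear -C00; lra.
pose A w := (f z0 - z0 *: l) + w *: l.
have vert s' t' : `|s' - s0| <= 3 * q -> `|t' - t0| <= 3 * q -> cabs (V s' t' - z0) <= r.
  move=> h1 h2; rewrite /V /z0 [X in cabs X](_ : _ = rc (s' - s0) * e1 + rc (t' - t0) * e2).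
    rewrite (le_trans (cabsD _ _)) // !cabsM !cabs_rc /r /C0.
    rewrite (_ : 3 * (cabs e1 + cabs e2) * q = 3 * q * cabs e1 + 3 * q * cabs e2).
      by rewrite lerD // ler_wpM2r ?cabs_ge0.
    by clear; ring.
  by rewrite !rcB; ring.
set e := rho / _ in e0 hd.
have edge P Q : cabs (P - z0) <= r -> cabs (Q - z0) <= r ->
    p (trapz n (fun w => f w - A w) P Q) <= (2 * r) * (e * r).
  move=> hP hQ; apply: (@le_trans _ _ (cabs (Q - P) * (e * r))).
    apply: trapz_le => // w wPQ; have wr := seg_cabs wPQ hP hQ.
    have -> : f w - A w = f w - f z0 - (w - z0) *: l.
      by rewrite /A scalerBl !opprD !opprK !addrA addrAC.
    apply: le_trans (hd w (le_lt_trans wr rd)) _.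
    by rewrite ler_wpM2l // ltW.
  apply: ler_wpM2r; first by rewrite mulr_ge0 ?(ltW e0).
  have -> : cabs (Q - P) = cabs ((Q - z0) - (P - z0)) by congr cabs; ring.
  by rewrite (le_trans (cabsD _ _)) // cabsN (_ : 2 * r = r + r) ?lerD //; clear; ring.
have v1 : cabs (V s t - z0) <= r.
  by apply: vert; rewrite ?(le_trans hsk) ?(le_trans htk) // -/q; clear -q0; lra.
have dlq : `|dl| = q by [].
have v2 : cabs (V (s + dl) t - z0) <= r.
  apply: vert; last by rewrite (le_trans htk) // -/q; clear -q0; lra.
  rewrite addrAC (le_trans (ler_normD _ _)) // dlq -/q.
  by move: hsk; rewrite -/q; clear; lra.
have v3 : cabs (V s (t + dl) - z0) <= r.
  apply: vert; first by rewrite (le_trans hsk) // -/q; clear -q0; lra.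
  rewrite addrAC (le_trans (ler_normD _ _)) // dlq -/q.
  by move: htk; rewrite -/q; clear; lra.
rewrite /T -[tri_trapz _ _ _ _ _]subr0 -(tri_trapz_affine n (f z0 - z0 *: l) l (V s t) (V (s + dl) t) (V s (t + dl))).
rewrite -tri_trapzB /tri_trapz (le_trans (snD sp _ _)) //.
apply: (@le_trans _ _ (2 * r * (e * r) + 2 * r * (e * r) + 2 * r * (e * r))).
  rewrite lerD ?edge // (le_trans (snD sp _ _)) // lerD ?edge //.
have -> : 2 * r * (e * r) + 2 * r * (e * r) + 2 * r * (e * r) =
   rho * q ^+ 2 * (C0 ^+ 2 / (C0 + 1) ^+ 2).
  by rewrite /e /r; field; apply: lt0r_neq0; clear -C00; lra.
have -> : rho / 4 ^+ k = rho * q ^+ 2.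
  by rewrite /q -exprM mulnC exprM -exprVn; congr (_ * _ ^+ _); field.
rewrite ler_piMr ?mulr_ge0 ?exprn_ge0 ?(ltW rho0) //.
have C1 : 0 < C0 + 1 by clear -C00; lra.
rewrite ler_pdivrMr ?exprn_gt0 // mul1r lerXn2r ?nnegrE ?(ltW C1) //.
by clear -C00; lra.
Qed.
End Goursat.

(** * Complex derivatives and Cauchy's formula *)

(** Scalar counterpart of [sderiv], tested on the modulus alone; [sderiv_cderiv] and [cderiv_sderiv]
    pass between the two. *)
Definition cderiv (R : realType) (h : Cplx R -> Cplx R) (z k : Cplx R) : Prop :=
  forall e : R, 0 < e -> exists2 d : R, 0 < d &
    forall w, cabs (w - z) < d -> cabs (h w - h z - (w - z) * k) <= e * cabs (w - z).

Section Calculus.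
Context {R : realType} {X : tvsType (Cplx R)}.
Implicit Types (f g : Cplx R -> X) (a b c z w : Cplx R) (h : Cplx R -> Cplx R).

Lemma sderiv_cts f z l p : sderiv f z l -> seminorm p -> forall e, 0 < e ->
  exists2 d : R, 0 < d & forall w, cabs (w - z) < d -> p (f w - f z) <= e.
Proof.
move=> fl sp e e0; have [d d0 hd] := fl p sp 1 ltr01.
have pl : 0 < p l + 1 by rewrite ltr_wpDl // sn_ge0.
exists (Num.min d (e / (p l + 1))); first by rewrite lt_min d0 divr_gt0.
move=> w; rewrite lt_min => /andP[/hd h1 h2].
rewrite (le_trans (sn_dist sp _ ((w - z) *: l))) // snZ //.
rewrite ltr_pdivlMr // mulrDr mulr1 in h2; rewrite mul1r in h1.
by rewrite ltW // (le_lt_trans _ h2) // lerD2l.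
Qed.

Lemma cderiv_cts h z k : cderiv h z k -> forall e, 0 < e ->
  exists2 d : R, 0 < d & forall w, cabs (w - z) < d -> cabs (h w - h z) <= e.
Proof.
move=> fl e e0; have [d d0 hd] := fl 1 ltr01.
have pl : 0 < cabs k + 1 by rewrite ltr_wpDl // cabs_ge0.
exists (Num.min d (e / (cabs k + 1))); first by rewrite lt_min d0 divr_gt0.
move=> w; rewrite lt_min => /andP[/hd h1 h2].
rewrite (_ : h w - h z = (h w - h z - (w - z) * k) + (w - z) * k); last by rewrite subrK.
rewrite (le_trans (cabsD _ _)) // cabsM.
rewrite ltr_pdivlMr // mulrDr mulr1 in h2; rewrite mul1r in h1.
by rewrite ltW // (le_lt_trans _ h2) // addrC lerD2l.
Qed.

Lemma cderiv_translate w z : cderiv (fun y => y - w) z 1.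
Proof.
move=> e e0; exists 1 => // y _.
have -> : y - w - (z - w) - (y - z) * 1 = 0 by ring.
by rewrite cabs0 mulr_ge0 ?cabs_ge0 // ltW.
Qed.

Lemma cderiv_inv h z k : cderiv h z k -> h z != 0 ->
  cderiv (fun y => (h y)^-1) z (- (k / h z ^+ 2)).
Proof.
move=> hk hz0 e e0; set v := cabs (h z); have v0 : 0 < v by rewrite cabs_gt0.
have v20 : 0 < v / 2 by rewrite divr_gt0.
have [d1 d10 hd1] := cderiv_cts hk v20.
have e1 : 0 < e * v ^+ 2 / 4 by rewrite divr_gt0 // mulr_gt0 // exprn_gt0.
have [d2 d20 hd2] := hk _ e1.
have k1 : 0 < cabs k + 1 by rewrite ltr_wpDl // cabs_ge0.
have e2 : 0 < e * v ^+ 3 / (4 * (cabs k + 1)).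
  by rewrite !(divr_gt0, mulr_gt0) // exprn_gt0.
have [d3 d30 hd3] := cderiv_cts hk e2.
exists (Num.min d1 (Num.min d2 d3)); first by rewrite !lt_min d10 d20 d30.
move=> y; rewrite !lt_min => /and3P[/hd1 y1 /hd2 y2 /hd3 y3].
have hy : v / 2 <= cabs (h y).
  by have := cabs_dist (h z) (h y); rewrite cabsBC -/v; move: y1; clear; lra.
have hy0 : h y != 0 by rewrite -cabs_gt0 (lt_le_trans v20).
set D := h y - h z in y1 y3 *; set E := D - (y - z) * k in y2.
have -> : (h y)^-1 - (h z)^-1 - (y - z) * - (k / h z ^+ 2) =
  - (E / (h y * h z)) + (y - z) * k * D / (h y * h z ^+ 2).
  by rewrite /E /D; field; rewrite hy0 hz0.
rewrite (le_trans (cabsD _ _)) // cabsN !cabsM !cabsV !cabsM -/v -expr2.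
have iy : (cabs (h y))^-1 <= 2 / v.
  by rewrite -[2 / v]invf_div lef_pV2 // posrE ?cabs_gt0.
have iy0 : 0 <= (cabs (h y))^-1 by rewrite invr_ge0 cabs_ge0.
set u := cabs (y - z) in y2 *; have u0 : 0 <= u := cabs_ge0 _.
have t1 : cabs E * (cabs (h y) * v)^-1 <= e / 2 * u.
  rewrite invfM.
  have -> : e / 2 * u = (e * v ^+ 2 / 4 * u) * (2 / v * v^-1).
    by field; rewrite gt_eqF.
  apply: ler_pM => //; rewrite ?cabs_ge0 ?mulr_ge0 // ?invr_ge0 ?(ltW v0) //.
  by rewrite ler_wpM2r // invr_ge0 ltW.
have t2 : u * cabs k * cabs D * (cabs (h y) * v ^+ 2)^-1 <= e / 2 * u.
  rewrite invfM [e / 2 * u]mulrC -!mulrA ler_wpM2l //.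
  have k0 := cabs_ge0 k.
  apply: (@le_trans _ _ ((cabs k + 1) * ((e * v ^+ 3 / (4 * (cabs k + 1))) * (2 / v * (v ^+ 2)^-1)))).
    apply: ler_pM => //; rewrite ?cabs_ge0 ?mulr_ge0 // ?invr_ge0 ?exprn_ge0 ?cabs_ge0 ?(ltW v0) ?lerDl //.
    apply: ler_pM => //; rewrite ?cabs_ge0 ?mulr_ge0 // ?invr_ge0 ?exprn_ge0 ?cabs_ge0 ?(ltW v0) //.
    by rewrite ler_wpM2r // invr_ge0 exprn_ge0 // ltW.
  rewrite le_eqVlt; apply/orP; left; apply/eqP.
  by field; rewrite !gt_eqF.
rewrite (_ : e * u = e / 2 * u + e / 2 * u); last by clear; lra.
by rewrite lerD.
Qed.

Lemma sderiv_scale h f z k l : cderiv h z k -> sderiv f z l ->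
  sderiv (fun y => h y *: f y) z (k *: f z + h z *: l).
Proof.
move=> hk fl p sp e e0.
have pl0 := sn_ge0 sp l; have pf0 := sn_ge0 sp (f z).
have ch0 := cabs_ge0 (h z).
have a1 : 0 < e / 4 / (cabs (h z) + 1) by rewrite !divr_gt0 // ltr_wpDl.
have a2 : 0 < e / 4 / (p l + 1) by rewrite !divr_gt0 // ltr_wpDl.
have a3 : 0 < e / 4 / (p (f z) + 1) by rewrite !divr_gt0 // ltr_wpDl.
have [d1 d10 hd1] := cderiv_cts hk (ltr01).
have [d2 d20 hd2] := fl p sp _ a1.
have [d3 d30 hd3] := hk _ a3.
have [d4 d40 hd4] := cderiv_cts hk a2.
exists (Num.min (Num.min d1 d4) (Num.min d2 d3)).
  by rewrite !lt_min d10 d20 d30 d40.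
move=> y; rewrite !lt_min => /andP[/andP[/hd1 y1 /hd4 y4] /andP[/hd2 y2 /hd3 y3]].
set u := cabs (y - z) in y2 y3 *; have u0 : 0 <= u := cabs_ge0 _.
have -> : h y *: f y - h z *: f z - (y - z) *: (k *: f z + h z *: l) =
   h y *: (f y - f z - (y - z) *: l) + ((h y - h z) * (y - z)) *: l +
   (h y - h z - (y - z) * k) *: f z.
  set D := f y - f z - (y - z) *: l.
  have -> : f y = D + f z + (y - z) *: l by rewrite /D addrAC !subrK.
  rewrite !scalerDr !scalerA !opprD -!scaleNr.
  rewrite [LHS](AC (3*1*2) (1*(3*6)*(2*4*5))) /= -!scalerDl.
  congr (_ + _ *: _ + _ *: _); rewrite -[_ *: h z]/(- (y - z) * h z); ring.
rewrite (le_trans (snD sp _ _)) // (le_trans (lerD (snD sp _ _) (lexx _))) //.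
rewrite !(snZ sp) cabsM -/u.
have hy : cabs (h y) <= cabs (h z) + 1.
  by rewrite -lerBlDl (le_trans (cabs_dist _ _)).
have c1 : 0 < cabs (h z) + 1 by rewrite ltr_wpDl.
have c2 : 0 < p l + 1 by rewrite ltr_wpDl.
have c3 : 0 < p (f z) + 1 by rewrite ltr_wpDl.
have t1 : cabs (h y) * p (f y - f z - (y - z) *: l) <= e / 4 * u.
  have -> : e / 4 * u = (cabs (h z) + 1) * (e / 4 / (cabs (h z) + 1) * u).
    by field; rewrite gt_eqF.
  by apply: ler_pM; rewrite ?cabs_ge0 ?sn_ge0.
have t2 : cabs (h y - h z) * u * p l <= e / 4 * u.
  have -> : e / 4 * u = e / 4 / (p l + 1) * u * (p l + 1).
    by field; rewrite gt_eqF.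
  apply: ler_pM; rewrite ?mulr_ge0 ?cabs_ge0 ?lerDl //.
  by rewrite ler_wpM2r.
have t3 : cabs (h y - h z - (y - z) * k) * p (f z) <= e / 4 * u.
  have -> : e / 4 * u = e / 4 / (p (f z) + 1) * u * (p (f z) + 1).
    by field; rewrite gt_eqF.
  by apply: ler_pM; rewrite ?cabs_ge0 ?lerDl.
have eu : 0 <= e * u by rewrite mulr_ge0 // ltW.
by move: t1 t2 t3 eu; clear; lra.
Qed.

End Calculus.

Section Vanishing.
Context {R : realType} {X : tvsType (Cplx R)}.
Implicit Types (u v : nat -> X).

Lemma vanishingD u v : vanishing u -> vanishing v -> vanishing (fun n => u n + v n).
Proof.
move=> hu hv p sp rho rho0; have r2 : 0 < rho / 2 by rewrite divr_gt0.
have [n1 h1] := hu p sp _ r2; have [n2 h2] := hv p sp _ r2.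
exists (maxn n1 n2) => n; rewrite geq_max => /andP[/h1 a /h2 b].
by rewrite (le_trans (snD sp _ _)) // (splitr rho) lerD.
Qed.

Lemma vanishing_sum (I : Type) (r : seq I) (u : I -> nat -> X) :
  (forall i, vanishing (u i)) -> vanishing (fun n => \sum_(i <- r) u i n).
Proof.
move=> hu; elim: r => [|i r IH].
  by move=> p sp rho rho0; exists 0%N => n _; rewrite big_nil sn0 // ltW.
move=> p sp rho rho0; have [n0 h0] := vanishingD (hu i) IH sp rho0.
by exists n0 => n /h0; rewrite big_cons.
Qed.

Lemma vanishing_ext u v : (forall n, u n = v n) -> vanishing u -> vanishing v.
Proof. by move=> e; rewrite (_ : v = u) //; apply/funext. Qed.

End Vanishing.

Section Cauchy.
Context {R : realType} {X : tvsType (Cplx R)}.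
Implicit Types (f g : Cplx R -> X) (a b c z w : Cplx R) (h : Cplx R -> Cplx R).

Lemma goursat3 f P Q S :
  (forall s t u : R, 0 <= s -> 0 <= t -> 0 <= u -> s + t + u = 1 ->
     exists l, sderiv f (rc s * P + rc t * Q + rc u * S) l) ->
  vanishing (fun n => tri_trapz n f P Q S).
Proof.
move=> h; have := @goursat _ _ f P (Q - P) (S - P); rewrite !(addrC P) !subrK; apply.
move=> s t s0 t0 st; have u0 : 0 <= 1 - s - t by lra.
have [l hl] := h (1 - s - t) s t u0 s0 t0 ltac:(lra).
exists l; move: hl; congr (sderiv f _ l).
by rewrite !rcB rc1; ring.
Qed.

(** Goursat's lemma with an exceptional vertex, where [g] is merely bounded. Halving towards $w$
    splits off triangles that avoid $w$; the remaining corner has perimeter of order $2^{-k}$, hence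
    a small sum. *)
Lemma tri_vertex g w a b :
  (forall be ga : R, 0 <= be -> 0 <= ga -> 0 < be + ga <= 1 ->
     exists l, sderiv g (w + rc be * (a - w) + rc ga * (b - w)) l) ->
  (forall p, seminorm p -> exists2 d : R, 0 < d & exists M : R,
     forall z, cabs (z - w) < d -> p (g z) <= M) ->
  vanishing (fun n => tri_trapz n g w a b).
Proof.
move=> H B p sp rho rho0; have [d d0 [M hM]] := B p sp.
pose sc k x := w + rc (2^-1 ^+ k) * (x - w).
have scS k x : sc k.+1 x = sc k (mid w x).
  by rewrite /sc exprSr rcM /mid half_inv; field.
have main k : forall a b (r eta : R), 0 < eta ->
  (forall be ga : R, 0 <= be -> 0 <= ga -> 0 < be + ga <= 1 ->
     exists l, sderiv g (w + rc be * (a - w) + rc ga * (b - w)) l) ->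
  (exists n0, forall n, (n0 <= n)%N -> p (tri_trapz n g w (sc k a) (sc k b)) <= r) ->
  exists n0, forall n, (n0 <= n)%N -> p (tri_trapz n g w a b) <= r + eta.
  elim: k => [|k IH] {H} {}a {}b r eta eta0 H.
    move=> [n0 hn0]; exists n0 => n /hn0; rewrite /sc expr0 rc1 !mul1r !(addrC w) !subrK.
    by move=> h; rewrite ler_wpDr // ltW.
  rewrite !scS => hk.
  have e2 : 0 < eta / 2 by rewrite divr_gt0.
  (* Points whose barycentric weight at $w$ is at most $1/2$: all three triangles split off consist
     of such points. *)
  have Hm (al be ga : R) : 0 <= al -> 0 <= be -> 0 <= ga -> al + be + ga = 1 -> al <= 2^-1 ->
      exists l, sderiv g (rc al * w + rc be * a + rc ga * b) l.
    move=> al0 be0 ga0 hs al2; have [l hl] := H be ga be0 ga0 ltac:(lra).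
    exists l; move: hl; congr (sderiv g _ l).
    by rewrite (_ : al = 1 - be - ga); [rewrite !rcB rc1; ring|lra].
  have [n1 h1] := IH (mid w a) (mid w b) r (eta / 2) e2 ltac:(
     move=> be ga be0 ga0 bg; have [l hl] := H (be / 2) (ga / 2) ltac:(lra) ltac:(lra) ltac:(lra);
     exists l; move: hl; rewrite !midBl !rcM !mulrA //) hk.
  have v : vanishing (fun n => tri_trapz n g (mid w a) a (mid a b) + tri_trapz n g (mid a b) b (mid b w) +
      tri_trapz n g (mid w a) (mid a b) (mid b w)).
    apply: vanishingD; first apply: vanishingD.
    - apply: goursat3 => s t u s0 t0 u0 stu.
      have [l hl] := Hm (s / 2) (s / 2 + t + u / 2) (u / 2) ltac:(lra) ltac:(lra) ltac:(lra) ltac:(lra) ltac:(lra).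
      exists l; move: hl; congr (sderiv g _ l).
      by rewrite /mid !rcD !rcM half_inv; field.
    - apply: goursat3 => s t u s0 t0 u0 stu.
      have [l hl] := Hm (u / 2) (s / 2) (s / 2 + t + u / 2) ltac:(lra) ltac:(lra) ltac:(lra) ltac:(lra) ltac:(lra).
      exists l; move: hl; congr (sderiv g _ l).
      by rewrite /mid !rcD !rcM half_inv; field.
    - apply: goursat3 => s t u s0 t0 u0 stu.
      have [l hl] := Hm (s / 2 + u / 2) (s / 2 + t / 2) (t / 2 + u / 2) ltac:(lra) ltac:(lra) ltac:(lra) ltac:(lra) ltac:(lra).
      exists l; move: hl; congr (sderiv g _ l).
      by rewrite /mid !rcD !rcM half_inv; field.
  have [n2 h2] := v p sp _ e2.
  exists (n1 + n2).+1 => -[//|n] hn; rewrite tri_trapz_sub.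
  have [m1 m2] : (n1 <= n)%N /\ (n2 <= n)%N by clear -hn; lia.
  have := h2 n m2; have := h1 n m1; rewrite [mid w b]midC.
  move: (tri_trapz n g w _ _) (tri_trapz n g (mid w a) a _) (tri_trapz n g (mid a b) b _)
    (tri_trapz n g (mid w a) (mid a b) _) => A1 A2 A3 A4 hA1 hA.
  rewrite -!addrA [A2 + _]addrA; apply: (le_trans (snD sp _ _)).
  by rewrite (splitr eta) [r + _]addrA lerD.
pose C := cabs (a - w) + cabs (b - w).
have C0 : 0 <= C by rewrite addr_ge0 ?cabs_ge0.
have M0 : 0 <= M.
  by rewrite (le_trans _ (hM w _)) ?sn_ge0 // subrr cabs0.
have [k1 hk1] := half_pow_small C d0.
have r4 : 0 < rho / 2 by rewrite divr_gt0.
(* The corner sums to at most $6CMq<3\rho/4$, which leaves $\rho/4$ for the triangles split off. *)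
have [k2 hk2] := half_pow_small (4 * C * M) r4.
pose k := maxn k1 k2; pose q : R := 2^-1 ^+ k.
have qle j : (j <= k)%N -> q <= 2^-1 ^+ j.
  by move=> jk; apply: ler_wiXn2l => //; clear; lra.
have q0 : 0 <= q by rewrite exprn_ge0.
have qd : C * q < d by apply: le_lt_trans hk1; rewrite ler_wpM2l // qle // leq_maxl.
have qr : 4 * C * M * q < rho / 2.
  by apply: le_lt_trans hk2; rewrite ler_wpM2l ?qle ?leq_maxr // !mulr_ge0.
have sca x : cabs (x - w) <= C -> cabs (sc k x - w) <= C * q.
  move=> hx; rewrite /sc addrC addKr cabsM cabs_rc ger0_norm // -/q mulrC.
  by rewrite ler_wpM2r.
have ha : cabs (sc k a - w) <= C * q by apply: sca; rewrite lerDl cabs_ge0.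
have hb : cabs (sc k b - w) <= C * q by apply: sca; rewrite lerDr cabs_ge0.
have hw : cabs (w - w) <= C * q by rewrite subrr cabs0 mulr_ge0.
have edge n P Q : cabs (P - w) <= C * q -> cabs (Q - w) <= C * q ->
    p (trapz n g P Q) <= 2 * (C * q) * M.
  move=> hP hQ; apply: (@le_trans _ _ (cabs (Q - P) * M)).
    apply: trapz_le => // z zPQ; apply: hM.
    exact: le_lt_trans (seg_cabs zPQ hP hQ) qd.
  apply: ler_wpM2r => //.
  have -> : cabs (Q - P) = cabs ((Q - w) - (P - w)) by congr cabs; ring.
  by rewrite (le_trans (cabsD _ _)) // cabsN (_ : 2 * _ = C * q + C * q) ?lerD //; clear; ring.
have r8 : 0 < rho / 2 / 2 by rewrite !divr_gt0.
have [n0 hn0] : exists n0, forall n, (n0 <= n)%N ->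
   p (tri_trapz n g w a b) <= (6 * (C * q) * M) + rho / 4.
  apply: (main k) => //; first by rewrite divr_gt0.
  exists 0%N => n _; rewrite /tri_trapz.
  have e1 := edge n _ _ hw ha; have e2 := edge n _ _ ha hb; have e3 := edge n _ _ hb hw.
  have d1 := snD sp (trapz n g w (sc k a) + trapz n g (sc k a) (sc k b)) (trapz n g (sc k b) w).
  have d2 := snD sp (trapz n g w (sc k a)) (trapz n g (sc k a) (sc k b)).
  by move: e1 e2 e3 d1 d2; clear; nra.
exists n0 => n /hn0 h; apply: (le_trans h).
have : 0 <= C * M * q by rewrite !mulr_ge0.
by move: qr rho0; clear; nra.
Qed.


End Cauchy.

(** * Cauchy sums over a square contour *)

Definition iunit (R : realType) : Cplx R := Complex 0 1.

(** The corners are rotated by powers of $i$, so the four edges are copies of one segment and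
    distances to the centre are estimated only once. *)
Definition corner (R : realType) (z0 : Cplx R) (r : R) (k : nat) : Cplx R :=
  z0 + rc r * iunit R ^+ k.

Definition sq_trapz (R : realType) (X : tvsType (Cplx R)) (n : nat) (f : Cplx R -> X)
    (z0 : Cplx R) (r : R) : X :=
  \sum_(0 <= k < 4) trapz n f (corner z0 r k) (corner z0 r k.+1).

(** Discrete counterpart of $\oint dz/(z-w)=2\pi i$. Its value is never computed: a lower bound on
    its modulus, uniform in [n], is enough ([sq_winding_ge]). *)
Definition sq_winding (R : realType) (n : nat) (z0 : Cplx R) (r : R) (w : Cplx R) : Cplx R :=
  sq_trapz (X := (Cplx R)^o) n (fun z => (z - w)^-1) z0 r.

Section Square.
Context {R : realType} {X : tvsType (Cplx R)}.
Implicit Types (f g : Cplx R -> X) (a b c z w : Cplx R) (h : Cplx R -> Cplx R).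

Lemma cabs_iunit : cabs (iunit R) = 1.
Proof. by rewrite /cabs /= expr0n expr1n add0r sqrtr1. Qed.

Lemma iunit2 : iunit R ^+ 2 = -1. Proof. exact: sqr_i. Qed.
Lemma iunit4 : iunit R ^+ 4 = 1.
Proof. by rewrite (exprM _ 2 2) iunit2 sqrrN expr1n. Qed.

Lemma cabs_iunitX k : cabs (iunit R ^+ k) = 1.
Proof. by rewrite cabsX cabs_iunit expr1n. Qed.

Lemma edgeE (t : R) : 1 + rc t * (iunit R - 1) = Complex (1 - t) t.
Proof.
apply/eqP; rewrite eq_complex /=; apply/andP; split; apply/eqP; ring.
Qed.

Lemma cabs_edge_ge (t : R) : 2^-1 <= cabs (1 + rc t * (iunit R - 1)).
Proof.
rewrite edgeE /cabs /= -[2^-1]ger0_norm // -sqrtr_sqr ler_wsqrtr //.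
by have := sqr_ge0 (t - 2^-1); nra.
Qed.

Lemma cabs_edge_le (t : R) : 0 <= t <= 1 -> cabs (1 + rc t * (iunit R - 1)) <= 1.
Proof.
move=> t01; rewrite edgeE /cabs /= -[leRHS]sqrtr1 ler_wsqrtr //; nra.
Qed.

Lemma seg_corner z0 r k z : seg (corner z0 r k) (corner z0 r k.+1) z ->
  exists2 t : R, 0 <= t <= 1 & z - z0 = rc r * iunit R ^+ k * (1 + rc t * (iunit R - 1)).
Proof.
by move=> [t t01 ->]; exists t => //; rewrite /corner exprSr; ring.
Qed.

Lemma seg_corner_ge z0 r k z : 0 < r -> seg (corner z0 r k) (corner z0 r k.+1) z ->
  r / 2 <= cabs (z - z0).
Proof.
move=> r0 /seg_corner[t t01 ->]; rewrite !cabsM cabs_rc cabs_iunitX mulr1 gtr0_norm //.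
by rewrite ler_pM2l // cabs_edge_ge.
Qed.

Lemma seg_corner_le z0 r k z : 0 < r -> seg (corner z0 r k) (corner z0 r k.+1) z ->
  cabs (z - z0) <= r.
Proof.
move=> r0 /seg_corner[t t01 ->]; rewrite !cabsM cabs_rc cabs_iunitX mulr1 gtr0_norm //.
by rewrite ger_pMr // cabs_edge_le.
Qed.

Lemma corner4 z0 (r : R) : corner z0 r 4 = corner z0 r 0.
Proof. by rewrite /corner iunit4 expr0. Qed.

Lemma cabs_corner z0 (r : R) k : 0 < r -> cabs (corner z0 r k - z0) = r.
Proof.
by move=> r0; rewrite /corner addrC addKr cabsM cabs_iunitX mulr1 cabs_rc gtr0_norm.
Qed.

Lemma cabs_corner_edge z0 (r : R) k : 0 < r ->
  cabs (corner z0 r k.+1 - corner z0 r k) <= 2 * r.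
Proof.
move=> r0; rewrite (_ : _ - _ = (corner z0 r k.+1 - z0) - (corner z0 r k - z0)).
  by rewrite (le_trans (cabsD _ _)) // cabsN !cabs_corner // mulr_natl.
by ring.
Qed.

Lemma trapz_scal n h (x : X) a b :
  trapz n (fun z => h z *: x) a b = trapz (X := (Cplx R)^o) n h a b *: x.
Proof.
elim: n a b => [|n IH] a b /=; last by rewrite !IH scalerDl.
by rewrite -scalerDl !scalerA.
Qed.

Lemma sderivBc f z l (x : X) : sderiv f z l -> sderiv (fun y => f y - x) z l.
Proof.
move=> fl p sp e e0; have [d d0 hd] := fl p sp e e0; exists d => // y /hd.
by rewrite opprB addrA subrK.
Qed.

Lemma diffquot_bounded f w l : sderiv f w l -> forall p, seminorm p ->
  exists2 d : R, 0 < d & exists M : R,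
    forall z, cabs (z - w) < d -> p ((z - w)^-1 *: (f z - f w)) <= M.
Proof.
move=> fl p sp; have [d d0 hd] := fl p sp 1 ltr01.
exists d => //; exists (p l + 1) => z /hd; rewrite mul1r snZ // cabsV => h.
(* At $z=w$ the quotient is $0$, since [0^-1 = 0]. *)
have [->|zw] := eqVneq z w.
  by rewrite subrr cabs0 invr0 mul0r addr_ge0 ?sn_ge0.
rewrite ler_pdivrMl ?cabs_gt0 ?subr_eq0 //.
rewrite (le_trans (sn_dist sp _ ((z - w) *: l))) // snZ // mulrDr mulr1.
by rewrite lerD2l.
Qed.

(** The difference quotient at $w$ is bounded, so its sums over the four triangles joining $w$ to
    the edges vanish by [tri_vertex]; the spokes through $w$ telescope away and leave the
    contour. *)
Lemma cauchy_square f z0 (r : R) w : 0 < r ->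
  (forall z, cabs (z - z0) <= r -> exists l, sderiv f z l) -> cabs (w - z0) < r / 2 ->
  vanishing (fun n => sq_trapz n (fun z => (z - w)^-1 *: f z) z0 r - sq_winding n z0 r w *: f w).
Proof.
move=> r0 fd wr; pose g z := (z - w)^-1 *: (f z - f w).
have wr' : cabs (w - z0) <= r by rewrite (le_trans (ltW wr)) // ler_pdivrMr // ler_peMr ?ltW // ltr1n.
have [lw hlw] := fd w wr'.
pose c k := corner z0 r k.
have telesc n : \sum_(0 <= k < 4) tri_trapz n g w (c k) (c k.+1) = \sum_(0 <= k < 4) trapz n g (c k) (c k.+1).
  have -> : \sum_(0 <= k < 4) tri_trapz n g w (c k) (c k.+1) =
     \sum_(0 <= k < 4) trapz n g (c k) (c k.+1) - \sum_(0 <= k < 4) (trapz n g w (c k.+1) - trapz n g w (c k)).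
    rewrite -sumrB; apply: eq_bigr => k _.
    by rewrite /tri_trapz (trapz_rev _ _ w (c k.+1)) opprB [RHS]addrCA [RHS]addrA.
  by rewrite telescope_sumr // /c corner4 subrr subr0.
apply: (@vanishing_ext _ _ (fun n => \sum_(0 <= k < 4) tri_trapz n g w (c k) (c k.+1))).
  move=> n; rewrite telesc /sq_winding /sq_trapz scaler_suml -sumrB; apply: eq_bigr => k _.
  rewrite -trapz_scal -trapzB; apply: trapz_ext => z _; exact: scalerBr.
apply: vanishing_sum => k; apply: tri_vertex; last exact: diffquot_bounded hlw.
move=> be ga be0 ga0 /andP[s0 s1]; set z := w + _ + _; set s := be + ga in s0 s1.
have zE : z - z0 = rc (1 - be - ga) * (w - z0) + rc be * (c k - z0) + rc ga * (c k.+1 - z0).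
  by rewrite /z !rcB rc1; ring.
have zr : cabs (z - z0) <= r.
  rewrite zE (le_trans (cabsD _ _)) // (le_trans (lerD (cabsD _ _) (lexx _))) //.
  rewrite !cabsM !cabs_rc !cabs_corner // !ger0_norm //; last by move: s1; rewrite /s; lra.
  have : (1 - be - ga) * cabs (w - z0) <= (1 - be - ga) * r.
    by rewrite ler_wpM2l //; move: s1; rewrite /s; lra.
  lra.
have zw : z - w != 0.
  (* The ray from $w$ through $z$ meets the edge at [q], which differs from $w$ because edges stay
     at distance at least $r/2$ from the centre. *)
  pose q := c k + rc (ga / s) * (c k.+1 - c k).
  have qseg : seg (c k) (c k.+1) q.
    exists (ga / s) => //; rewrite divr_ge0 ?(ltW s0) //= ler_pdivrMr // mul1r.
    by rewrite /s lerDr.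
  have -> : z - w = rc s * (q - w).
    have : rc s * rc (ga / s) = rc ga by rewrite -rcM mulrCA divff ?mulr1 // gt_eqF.
    rewrite /z /q => e.
    transitivity (rc s * (c k - w) + rc s * rc (ga / s) * (c k.+1 - c k)); last by ring.
    by rewrite e /s rcD; ring.
  rewrite -cabs_gt0 cabsM cabs_rc mulr_gt0 //; first by rewrite normr_gt0 gt_eqF.
  rewrite cabs_gt0 subr_eq0; apply/eqP => qw.
  by have := seg_corner_ge r0 qseg; rewrite qw leNgt wr.
have [l hl] := fd z zr; exists (- (1 / (z - w) ^+ 2) *: (f z - f w) + (z - w)^-1 *: l).
apply: sderiv_scale; last exact: sderivBc.
exact: (cderiv_inv (cderiv_translate w z)).
Qed.

End Square.

(** * Identity theorem and open mapping theorem *)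

Section Identity.
Context {R : realType} {X : tvsType (Cplx R)}.
Implicit Types (f g : Cplx R -> X) (a b c z w : Cplx R) (h : Cplx R -> Cplx R).

Lemma ImD z w : complex.Im (z + w) = complex.Im z + complex.Im w.
Proof. by case: z => ? ?; case: w. Qed.
Lemma Im_rcM (x : R) z : complex.Im (rc x * z) = x * complex.Im z.
Proof. by case: z => a b /=; rewrite mul0r addr0. Qed.

Lemma Im_edge (t : R) : 0 <= t <= 1 ->
  1 <= complex.Im ((iunit R - 1) * (1 + rc t * (iunit R - 1))^-1).
Proof.
move=> t01; rewrite edgeE.
rewrite (_ : complex.Im _ = ((1 - t) ^+ 2 + t ^+ 2)^-1).
  rewrite -[leLHS]invr1 lef_pV2 // ?posrE //; last nra.
  by have := sqr_ge0 (t - 2^-1); nra.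
have n0 : (1 - t) ^+ 2 + t ^+ 2 != 0.
  by apply: lt0r_neq0; have := sqr_ge0 (t - 2^-1); nra.
by rewrite /=; field.
Qed.

(** The imaginary part measures the angle seen from $z_0$. Along an edge its rate is
    $1/((1-t)^2+t^2)\ge 1$, and additivity under bisection carries the bound to every level. *)
Lemma trapz_Im n z0 (k : Cplx R) (t t' : R) : k != 0 -> 0 <= t -> t <= t' -> t' <= 1 ->
  t' - t <= complex.Im (trapz (X := (Cplx R)^o) n (fun z => (z - z0)^-1)
     (z0 + k * (1 + rc t * (iunit R - 1))) (z0 + k * (1 + rc t' * (iunit R - 1)))).
Proof.
move=> k0; elim: n t t' => [|n IH] t t' t0 tt t1 /=.
  have Dn0 (s : R) : 1 + rc s * (iunit R - 1) != 0.
    by rewrite -cabs_gt0 (lt_le_trans _ (cabs_edge_ge s)) // invr_gt0.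
  rewrite (_ : _ *: _ = rc ((t' - t) / 2) * ((iunit R - 1) * (1 + rc t * (iunit R - 1))^-1
     + (iunit R - 1) * (1 + rc t' * (iunit R - 1))^-1) :> Cplx R); last first.
    rewrite rcM rcB !(addrC z0) !addrK.
    rewrite /GRing.scale /=; field.
    by rewrite !Dn0 k0.
  rewrite Im_rcM ImD.
  have := Im_edge (t := t); have := Im_edge (t := t').
  rewrite t0 t1 (le_trans t0 tt) (le_trans tt t1) => /(_ isT) h1 /(_ isT) h2.
  by move: h1 h2 tt; nra.
have -> : mid (z0 + k * (1 + rc t * (iunit R - 1))) (z0 + k * (1 + rc t' * (iunit R - 1))) =
   z0 + k * (1 + rc ((t + t') / 2) * (iunit R - 1)).
  by rewrite /mid rcM rcD half_inv; field.
rewrite ImD.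
have := IH t ((t + t') / 2) t0 ltac:(lra) ltac:(lra).
have := IH ((t + t') / 2) t' ltac:(lra) ltac:(lra) t1.
lra.
Qed.

Lemma sq_winding_ge n z0 (r : R) : 0 < r -> 4 <= cabs (sq_winding n z0 r z0).
Proof.
move=> r0; rewrite (le_trans _ (cabs_im _)) // (le_trans _ (ler_norm _)) //.
have h k : 1 <= complex.Im (trapz (X := (Cplx R)^o) n (fun z => (z - z0)^-1) (corner z0 r k) (corner z0 r k.+1)).
  have k0 : rc r * iunit R ^+ k != 0.
    by rewrite -cabs_gt0 cabsM cabs_iunitX cabs_rc mulr1 normr_gt0 gt_eqF.
  have := trapz_Im n z0 k0 (lexx 0) ler01 (lexx 1).
  rewrite subr0 rc0 mul0r addr0 mulr1 rc1 mul1r (addrC 1) subrK -mulrA -exprSr.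
  by [].
rewrite /sq_winding /sq_trapz !big_nat_recr //= big_geq // add0r !ImD.
have := h 0%N; have := h 1%N; have := h 2%N; have := h 3%N; lra.
Qed.

Lemma sq_trapz_le n f z0 (r : R) (p : X -> R) (M : R) : seminorm p -> 0 < r -> 0 <= M ->
  (forall k z, (k < 4)%N -> seg (corner z0 r k) (corner z0 r k.+1) z -> p (f z) <= M) ->
  p (sq_trapz n f z0 r) <= 8 * r * M.
Proof.
move=> sp r0 M0 h; rewrite /sq_trapz (le_trans (sn_sum sp _ _ _)) //.
have h1 k : (k < 4)%N -> p (trapz n f (corner z0 r k) (corner z0 r k.+1)) <= 2 * r * M.
  move=> k4.
  apply: (@le_trans _ _ (cabs (corner z0 r k.+1 - corner z0 r k) * M)).
    by apply: trapz_le => // z zs; exact: h zs.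
  by rewrite ler_wpM2r // cabs_corner_edge.
rewrite !big_nat_recr //= big_geq // add0r.
have := h1 0%N isT; have := h1 1%N isT; have := h1 2%N isT; have := h1 3%N isT; lra.
Qed.

Definition inv_roots (l : seq (Cplx R)) (z : Cplx R) : Cplx R := \prod_(a <- l) (z - a)^-1.

(* Modulo a subspace containing all [f a], [a] in [l], the Cauchy sums of
   [f / prod_(a in l) (z - a)] only see the pole [w]: the partial fraction identity
   1/((z-w)(z-b)) = (1/(z-w) - 1/(z-b)) / (w-b) gives the induction on [l]. *)
Lemma divided_differences f z0 (r : R) (Y : X -> Prop) (l : seq (Cplx R)) : 0 < r ->
  (forall z, cabs (z - z0) <= r -> exists d, sderiv f z d) ->
  (forall x y, Y x -> Y y -> Y (x + y)) -> (forall (k : Cplx R) x, Y x -> Y (k *: x)) -> Y 0 ->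
  uniq l -> (forall a, a \in l -> cabs (a - z0) < r / 2 /\ Y (f a)) ->
  forall w, cabs (w - z0) < r / 2 -> w \notin l ->
  forall p, seminorm p -> forall rho : R, 0 < rho ->
  exists n0, forall n, (n0 <= n)%N -> exists y, Y y /\
    p (sq_trapz n (fun z => ((z - w)^-1 * inv_roots l z) *: f z) z0 r -
       (sq_winding n z0 r w * inv_roots l w) *: f w - y) <= rho.
Proof.
move=> r0 fd YD YZ Y0; elim: l => [|b l IH] /=.
  move=> _ _ w wr _ p sp rho rho0.
  have [n0 hn0] := cauchy_square r0 fd wr sp rho0.
  exists n0 => n /hn0 h; exists 0; split=> //; rewrite subr0 /inv_roots big_nil mulr1.
  rewrite (_ : (fun z => _) = (fun z => (z - w)^-1 *: f z)) //.
  by apply/funext => z; rewrite big_nil mulr1.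
move=> /andP[bl ul] hl w wr; rewrite inE negb_or => /andP[wb wl] p sp rho rho0.
have hl' a : a \in l -> cabs (a - z0) < r / 2 /\ Y (f a).
  by move=> al; apply: hl; rewrite inE al orbT.
have [br Yb] := hl b (mem_head _ _).
have wb0 : w - b != 0 by rewrite subr_eq0.
have cwb : 0 < cabs (w - b) by rewrite cabs_gt0.
pose rho' := rho * cabs (w - b) / 2.
have rho'0 : 0 < rho' by rewrite divr_gt0 // mulr_gt0.
have [n1 h1] := IH ul hl' w wr wl p sp rho' rho'0.
have [n2 h2] := IH ul hl' b br bl p sp rho' rho'0.
exists (maxn n1 n2) => n; rewrite geq_max => /andP[/h1 [y1 [Yy1 p1]] /h2 [y2 [Yy2 p2]]].
move: p1 p2; set S1 := sq_trapz n _ z0 r; set S2 := sq_trapz n _ z0 r.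
set Sw := sq_trapz n _ z0 r.
have SwE : Sw = (w - b)^-1 *: (S1 - S2).
  rewrite /Sw /S1 /S2 /sq_trapz -sumrB scaler_sumr; apply: eq_bigr => k _.
  rewrite -trapzB -trapzZ; apply: trapz_ext => z zs.
  rewrite -scalerBl scalerA; congr (_ *: _); rewrite /inv_roots big_cons.
  have zne a : cabs (a - z0) < r / 2 -> z - a != 0.
    move=> ar; rewrite subr_eq0; apply/eqP => za.
    by have := seg_corner_ge r0 zs; rewrite za leNgt ar.
  by field; rewrite wb0 !zne.
have -> : sq_winding n z0 r w * inv_roots (b :: l) w = (w - b)^-1 * (sq_winding n z0 r w * inv_roots l w).
  by rewrite /inv_roots big_cons; ring.
move=> p1 p2; pose cb := sq_winding n z0 r b * inv_roots l b.
exists ((w - b)^-1 *: (y1 + (-1) *: (y2 + cb *: f b))); split.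
  exact: (YZ _ _ (YD _ _ Yy1 (YZ _ _ (YD _ _ Yy2 (YZ _ _ Yb))))).
rewrite SwE -!scalerA -!scalerBr snZ // cabsV ler_pdivrMl // mulrC.
rewrite (_ : rho * cabs (w - b) = rho' + rho'); last by rewrite /rho'; clear; lra.
rewrite [X in p X](_ : _ = (S1 - (sq_winding n z0 r w * inv_roots l w) *: f w - y1) - (S2 - cb *: f b - y2)).
  by rewrite (le_trans (snB sp _ _)) // lerD.
rewrite scaleN1r !scalerA !opprD !opprK.
by rewrite [LHS](AC (2*1*(1*2)) ((1*3*4)*(2*6*5))).
Qed.

Lemma seg_bounded f a b (p : X -> R) : seminorm p ->
  (forall z, seg a b z -> exists l, sderiv f z l) ->
  exists M : R, forall z, seg a b z -> p (f z) <= M.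
Proof.
move=> sp fd; pose g (t : R) := p (f (a + rc t * (b - a))).
have gc : {within `[0, 1], continuous g}.
  apply: continuous_in_subspaceT => t; rewrite inE /= in_itv /= => t01.
  apply/cvgrPdist_le => e e0.
  have [l hl] := fd _ (ex_intro2 _ _ t t01 erefl).
  have [d d0 hd] := sderiv_cts hl sp e0.
  have ba : 0 < cabs (b - a) + 1 by rewrite ltr_wpDl // cabs_ge0.
  have := nbhsx_ballx t (d / (cabs (b - a) + 1)) (divr_gt0 d0 ba).
  apply: filterS => s; rewrite -ball_normE /= ltr_pdivlMr // => hs.
  apply: (@le_trans _ _ (p (f (a + rc s * (b - a)) - f (a + rc t * (b - a))))).
    rewrite ler_norml /g; apply/andP; split.
      by rewrite lerNl opprB lerBlDl; exact: sn_dist.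
    by rewrite lerBlDl (snBC sp); exact: sn_dist.
  apply: hd; rewrite (_ : _ - _ = rc (s - t) * (b - a)); last by rewrite rcB; ring.
  rewrite cabsM cabs_rc distrC (le_lt_trans _ hs) // ler_wpM2l // lerDl //.
have [c _ hc] := EVT_max ler01 gc; exists (g c) => z [t t01 ->].
by apply: hc; rewrite in_itv.
Qed.

Lemma distinct_points_near (A : Cplx R -> Prop) z1 :
  (forall e : R, 0 < e -> exists a, [/\ 0 < cabs (a - z1), cabs (a - z1) < e & A a]) ->
  forall (e : R) m, 0 < e -> exists l, [/\ uniq l, size l = m &
    forall a, a \in l -> cabs (a - z1) < e /\ A a].
Proof.
move=> hA e m e0.
(* The induction remembers a lower bound [d] on the distances to $z_1$: a point closer than [d] is
   new. *)
suff [l [d [d0 ul sl hl]]] : exists l (d : R), [/\ 0 < d, uniq l, size l = m &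
    forall a, a \in l -> [/\ d <= cabs (a - z1), cabs (a - z1) < e & A a]].
  by exists l; split => // a /hl[].
elim: m => [|m [l [d [d0 ul sl hl]]]]; first by exists [::], 1.
have [a [a0 a1 Aa]] := hA (Num.min d e) ltac:(by rewrite lt_min d0 e0).
move: a1; rewrite lt_min => /andP[ad ae].
exists (a :: l), (cabs (a - z1)); split => //=.
- rewrite ul andbT; apply/negP => /hl[+ _ _]; by rewrite leNgt ad.
- by rewrite sl.
- move=> b; rewrite inE => /orP[/eqP ->|/hl[db be Ab]]; first by split.
  by split=> //; rewrite (le_trans (ltW ad)).
Qed.

(* With [m] points of [Y] at distance less than [r / 16] of [z0], the previous lemma
   gives [f z0] up to an element of [Y] and an error of order [4 ^- m]. *)
Lemma local_identity f z0 z1 (r : R) (Y : X -> Prop) : 0 < r ->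
  (forall z, cabs (z - z0) <= r -> exists d, sderiv f z d) ->
  (forall x y, Y x -> Y y -> Y (x + y)) -> (forall (k : Cplx R) x, Y x -> Y (k *: x)) -> Y 0 ->
  (forall x, (forall p, seminorm p -> forall e, 0 < e -> exists y, Y y /\ p (x - y) <= e) -> Y x) ->
  cabs (z1 - z0) < r / 32 ->
  (forall e : R, 0 < e -> exists a, [/\ 0 < cabs (a - z1), cabs (a - z1) < e & Y (f a)]) ->
  Y (f z0).
Proof.
move=> r0 fd YD YZ Y0 Ycl z1r hA; apply: contrapT => nY; apply: nY; apply: Ycl => p sp e e0.
(* Discarding this case keeps $z_0$, where the Cauchy pole is placed, out of the list [l] of points
   sent into [Y]. *)
have [Yz0|nYz0] := pselect (Y (f z0)).
  by exists (f z0); split => //; rewrite subrr sn0 // ltW.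
have [M [M0 hM]] : exists M : R, 0 <= M /\ forall k z, (k < 4)%N ->
    seg (corner z0 r k) (corner z0 r k.+1) z -> p (f z) <= M.
  have h k : exists M : R, forall z, seg (corner z0 r k) (corner z0 r k.+1) z -> p (f z) <= M.
    by apply: seg_bounded => // z /(seg_corner_le r0); exact: fd.
  have /choice [N hN] := h.
  exists (\sum_(k < 4) `|N k|); split; first by apply: sumr_ge0.
  move=> k z k4 /hN h1; apply: (le_trans h1); apply: (le_trans (ler_norm _)).
  rewrite (bigD1 (Ordinal k4)) //= lerDl; exact: sumr_ge0.
have [m hm] := half_pow_small (1 + 16 * M) e0.
have [l [ul sl hl]] := distinct_points_near hA m (divr_gt0 r0 (ltr0Sn _ 31)).
have la a : a \in l -> cabs (a - z0) < r / 16.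
  move=> /hl[h _]; rewrite (_ : a - z0 = (a - z1) + (z1 - z0)); last by ring.
  by rewrite (le_lt_trans (cabsD _ _)) //; move: h z1r; lra.
have la2 a : a \in l -> cabs (a - z0) < r / 2.
  by move=> /la h; apply: (lt_trans h); move: r0; clear; lra.
have z0l : z0 \notin l by apply/negP => /hl[_].
(* On the contour the points of [l] are at distance at least $r/4$, so [inv_roots] is at most $q$;
   they are closer than $r/16$ to $z_0$, where [inv_roots] is thus at least $4^m q$. *)
pose q := (4 / r) ^+ m; have q0 : 0 < q by rewrite exprn_gt0 // divr_gt0.
have [n0 hn0] := @divided_differences f z0 r Y l r0 fd YD YZ Y0 ul
  (fun a al => conj (la2 a al) (hl a al).2)
  z0 ltac:(rewrite subrr cabs0 divr_gt0 //) z0l p sp q q0.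
have [y [Yy hy]] := hn0 n0 (leqnn _).
set S := sq_trapz _ _ _ _ in hy; set k := sq_winding _ _ _ _ * _ in hy.
have pS : p S <= 8 * r * (2 / r * q * M).
  apply: sq_trapz_le => //; first by rewrite mulr_ge0 // mulr_ge0 ?divr_ge0 ?(ltW r0) ?(ltW q0).
  move=> j z j4 zs; rewrite snZ // cabsM; apply: ler_pM; rewrite ?mulr_ge0 ?cabs_ge0 ?sn_ge0 //; last exact: hM zs.
  have zr := seg_corner_ge r0 zs.
  apply: ler_pM; rewrite ?cabs_ge0 // ?cabsV.
    by rewrite -invf_div lef_pV2 // posrE ?divr_gt0 // (lt_le_trans _ zr) ?divr_gt0.
  rewrite /q -sl /inv_roots; elim: (l) la {hl ul sl z0l hn0 S k hy} => [|b l' IH] la.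
    by rewrite big_nil cabs1 expr0.
  rewrite big_cons cabsM /= exprS; apply: ler_pM; rewrite ?cabs_ge0 //.
    have h := la b (mem_head _ _).
    have zb : r / 4 <= cabs (z - b).
      rewrite (_ : z - b = (z - z0) - (b - z0)); last by ring.
      by apply: le_trans (cabs_dist _ _); move: h zr r0; lra.
    by rewrite cabsV -invf_div lef_pV2 // posrE ?divr_gt0 // (lt_le_trans _ zb) ?divr_gt0.
  by apply: IH => a al; apply: la; rewrite inE al orbT.
have kge : 4 * (r / 16) ^- m <= cabs k.
  rewrite /k cabsM; apply: ler_pM; rewrite ?invr_ge0 ?exprn_ge0 ?divr_ge0 ?(ltW r0) //; first exact: sq_winding_ge.
  rewrite -exprVn -sl /inv_roots; elim: (l) la z0l {hl ul sl hn0 S k hy pS} => [|b l' IH] la z0l.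
    by rewrite big_nil cabs1 expr0.
  move: z0l; rewrite inE negb_or => /andP[z0b z0l].
  rewrite big_cons cabsM /= exprS; apply: ler_pM; rewrite ?exprn_ge0 ?invr_ge0 ?divr_ge0 ?(ltW r0) //.
    by rewrite cabsV lef_pV2 ?posrE ?divr_gt0 ?cabs_gt0 ?subr_eq0 // cabsBC ltW // la ?mem_head.
  by apply: IH => // a al; apply: la; rewrite inE al orbT.
have r16 : 0 < (r / 16) ^- m by rewrite invr_gt0 exprn_gt0 // divr_gt0.
have k0 : 0 < cabs k by rewrite (lt_le_trans _ kge) // mulr_gt0.
exists (- k^-1 *: y); split; first exact: YZ.
have -> : f z0 - - k^-1 *: y = k^-1 *: (k *: f z0 + y).
  by rewrite scaleNr opprK scalerDr scalerA mulVf ?scale1r // -cabs_gt0.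
rewrite snZ // cabsV ler_pdivrMl //.
have h1 : p (k *: f z0 + y) <= q + 16 * q * M.
  have -> : k *: f z0 + y = S - (S - k *: f z0 - y) by rewrite -addrA -opprD subKr.
  rewrite (le_trans (snB sp _ _)) // addrC lerD //; apply: le_trans pS _.
  by rewrite le_eqVlt; apply/orP; left; apply/eqP; field; rewrite gt_eqF.
apply: le_trans h1 _; apply: (@le_trans _ _ (4 * (r / 16) ^- m * e)); last by rewrite ler_wpM2r // ltW.
have -> : (r / 16) ^- m = q * 4 ^+ m.
  by rewrite /q -exprMn -exprVn; congr (_ ^+ _); field; rewrite gt_eqF.
rewrite exprVn ltr_pdivrMr ?exprn_gt0 // in hm.
have h24 : (2 : R) ^+ m <= 4 ^+ m by rewrite lerXn2r // ?nnegrE //; clear; lra.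
have -> : q + 16 * q * M = q * (1 + 16 * M) by ring.
rewrite -!mulrA [4 * _]mulrCA ler_wpM2l ?(ltW q0) // (le_trans (ltW hm)) //.
have : e * 2 ^+ m <= e * 4 ^+ m by rewrite ler_wpM2l // ltW.
have : 0 <= e * 4 ^+ m by rewrite mulr_ge0 ?exprn_ge0 ?(ltW e0).
by rewrite (mulrC (4 ^+ m)); clear; lra.
Qed.

End Identity.

Section Global.
Context {R : realType}.
Implicit Types (a b c z w : Cplx R) (O U : set (Cplx R)).

Lemma holomorphic_sderiv (X : tvsType (Cplx R)) (f : Cplx R -> X) O z :
  holomorphic_on f O -> O z -> exists l, sderiv f z l.
Proof.
move=> hf Oz; have [l hl] := hf z Oz; exists l => p sp e e0.
have := sn_cvg (dnbhs_filter _) sp hl e0.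
move=> /nbhs_cabsP[d d0 hd]; exists d => // w wd.
have [->|wz] := eqVneq w z; first by rewrite !subrr scale0r subr0 sn0 // cabs0 mulr0.
have wz0 : w - z != 0 by rewrite subr_eq0.
have := hd (w - z); rewrite subr0 => /(_ wd wz0).
rewrite [z + _]addrC subrK => h.
have -> : f w - f z - (w - z) *: l = (w - z) *: ((w - z)^-1 *: (f w - f z) - l).
  by rewrite scalerBr scalerA divff // scale1r.
by rewrite snZ // mulrC ler_wpM2r ?cabs_ge0 // ltW.
Qed.

Lemma seminorm_cabs : seminorm (X := (Cplx R)^o) (@cabs R).
Proof.
split; [exact: cabsD|exact: cabsM|move=> e e0].
by apply: filterS (near_cabs 0 e0) => w; rewrite subr0.
Qed.

Lemma sderiv_cderiv (f : Cplx R -> (Cplx R)^o) z l : sderiv f z l -> cderiv f z l.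
Proof. by move=> h e e0; exact: (h _ seminorm_cabs e e0). Qed.

Lemma seminorm_regular (p : (Cplx R)^o -> R) : seminorm p -> forall x, p x = cabs x * p 1.
Proof. by move=> sp x; rewrite -(snZ sp) /GRing.scale /= mulr1. Qed.

Lemma cderiv_sderiv (f : Cplx R -> (Cplx R)^o) z l : cderiv f z l -> sderiv f z l.
Proof.
move=> h p sp e e0; have p1 : 0 < p 1 + 1 by rewrite ltr_wpDl // sn_ge0.
have [d d0 hd] := h (e / (p 1 + 1)) (divr_gt0 e0 p1); exists d => // w /hd.
move=> hw; rewrite [leLHS](seminorm_regular sp); apply: (@le_trans _ _ (e / (p 1 + 1) * cabs (w - z) * p 1)).
  by apply: ler_wpM2r; [exact: sn_ge0|exact: hw].
rewrite mulrAC ler_wpM2r ?cabs_ge0 // mulrAC ler_pdivrMr // ler_wpM2l ?(ltW e0) //.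
by rewrite lerDl.
Qed.

(** [Y] stands for a closed subspace and [C] is the interior of its preimage under [f]. By
    [local_identity], recentred at all points near it, an accumulation point of the preimage in [O]
    belongs to [C]; so [C] is relatively open and closed in [O]. *)
Lemma identity_theorem (X : tvsType (Cplx R)) (f : Cplx R -> X) O (Y : X -> Prop) z1 :
  open O -> connected O -> holomorphic_on f O ->
  (forall x y, Y x -> Y y -> Y (x + y)) -> (forall (k : Cplx R) x, Y x -> Y (k *: x)) -> Y 0 ->
  (forall x, (forall p, seminorm p -> forall e, 0 < e -> exists y, Y y /\ p (x - y) <= e) -> Y x) ->
  O z1 ->
  (forall e : R, 0 < e -> exists a, [/\ 0 < cabs (a - z1), cabs (a - z1) < e & Y (f a)]) ->
  forall z, O z -> Y (f z).
Proof.
move=> oO cO hf YD YZ Y0 Ycl Oz1 hA.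
pose C : set (Cplx R) := [set z | exists2 e : R, 0 < e & forall w, cabs (w - z) < e -> Y (f w)].
have limC z : O z -> (forall e : R, 0 < e -> exists a, [/\ 0 < cabs (a - z), cabs (a - z) < e & Y (f a)]) -> C z.
  move=> Oz hz; have [e e0 he] := (open_cabsP O).1 oO z Oz.
  (* [local_identity] is used with radius $e/2$ and tolerates a distance $(e/2)/32$ between its two
     centres. *)
  exists (e / 64); first by rewrite divr_gt0.
  move=> w wz; have r0 : 0 < e / 2 by rewrite divr_gt0.
  apply: (@local_identity _ _ f w z (e / 2) Y) => //.
    move=> y yw; apply: (holomorphic_sderiv hf); apply: he.
    rewrite (_ : y - z = (y - w) + (w - z)); last by ring.
    by rewrite (le_lt_trans (cabsD _ _)) //; move: yw wz e0; lra.
  by rewrite cabsBC; move: wz; lra.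
have oC : open C.
  apply/open_cabsP => z [e e0 he]; exists (e / 2); first by rewrite divr_gt0.
  move=> w wz; exists (e / 2); first by rewrite divr_gt0.
  move=> y yw; apply: he; rewrite (_ : y - z = (y - w) + (w - z)); last by ring.
  by rewrite (le_lt_trans (cabsD _ _)) //; move: yw wz e0; lra.
have BO : O `&` C = O.
  apply: cO.
  - by exists z1; split => //; exact: limC.
  - by exists C.
  - exists (closure C); first exact: closed_closure.
    apply/seteqP; split=> z [Oz]; first by split => //; exact: subset_closure.
    move=> clz; split=> //; apply: limC => // e e0.
    have [b [[e' e'0 hb] bz]] : (C `&` [set b | cabs (b - z) < e]) !=set0.
      by apply: clz; exact: near_cabs.
    have [bz0|bz0] := eqVneq b z; last first.
      by exists b; split => //; [rewrite cabs_gt0 subr_eq0|apply: hb; rewrite subrr cabs0].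
    have m0 : 0 < Num.min e e' by rewrite lt_min e0.
    have hz : cabs (z + rc (Num.min e e' / 2) - z) = Num.min e e' / 2.
      by rewrite addrC addKr cabs_rc gtr0_norm // divr_gt0.
    have mle : Num.min e e' / 2 < Num.min e e' by move: m0; lra.
    exists (z + rc (Num.min e e' / 2)); rewrite hz; split.
    + by rewrite divr_gt0.
    + by rewrite (lt_le_trans mle) // ge_min lexx.
    + by apply: hb; rewrite bz0 hz (lt_le_trans mle) // ge_min lexx orbT.
by move=> z; rewrite -BO => -[_ [e e0]]; apply; rewrite subrr cabs0.
Qed.

(** If a value $w$ near $f(z_0)$ were omitted, Cauchy's formula would bound $1/(f-w)$ at $z_0$ by
    its size on a contour where $f-f(z_0)$ stays away from $0$. Such a contour exists by the
    identity theorem with [Y] reduced to $0$. *)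
Lemma open_mapping (f : Cplx R -> Cplx R) U z0 :
  open U -> connected U -> holomorphic_on (f : Cplx R -> (Cplx R)^o) U ->
  (~ exists c, forall z, U z -> f z = c) -> U z0 ->
  forall d : R, 0 < d -> exists2 e : R, 0 < e & forall w, cabs (w - f z0) < e ->
    exists z, [/\ cabs (z - z0) < d, U z & f z = w].
Proof.
move=> oU cU hf nc Uz0 d d0.
have fder z : U z -> exists k, cderiv f z k.
  by move=> /(holomorphic_sderiv hf)[l /sderiv_cderiv]; exists l.
have [e1 e10 he1] : exists2 e : R, 0 < e & forall a, cabs (a - z0) < e -> a != z0 -> f a != f z0.
  apply: contrapT => nex; apply: nc; exists (f z0) => z Uz; apply/eqP.
  rewrite -subr_eq0; apply/eqP.
  have h := @identity_theorem (Cplx R)^o (fun z => f z - f z0) U (fun x => x = 0) z0 oU cU.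
  refine (h _ _ _ erefl _ Uz0 _ z Uz) => {h}.
  - move=> y Uy; have [l hl] := hf y Uy; exists l; apply: cvg_trans hl.
    by apply: near_eq_cvg; apply: nearW => h /=; rewrite opprB addrA subrK.
  - by move=> x y -> ->; rewrite addr0.
  - by move=> k x ->; rewrite scaler0.
  - move=> x hx; apply/eqP; rewrite -cabs_eq0 eq_le cabs_ge0 andbT.
    apply/ler_addgt0Pr => e e0; rewrite add0r.
    by have [y [-> ]] := hx _ seminorm_cabs e e0; rewrite subr0.
  - move=> e e0; apply: contrapT => na; apply: nex; exists e => // a ae az.
    apply/eqP => fa; apply: na; exists a; split => //; first by rewrite cabs_gt0 subr_eq0.
    by rewrite fa subrr.
have [e2 e20 he2] := (open_cabsP U).1 oU z0 Uz0.
pose r := Num.min d (Num.min e1 e2) / 2.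
have m0 : 0 < Num.min d (Num.min e1 e2) by rewrite !lt_min d0 e10 e20.
have r0 : 0 < r by rewrite divr_gt0.
have rm : r < Num.min d (Num.min e1 e2) by move: m0; rewrite /r; lra.
move: (rm); rewrite !lt_min => /and3P[rd re1 re2].
have inU z : cabs (z - z0) <= r -> U z by move=> h; apply: he2; exact: le_lt_trans re2.
have idv z w : U z -> f z != w -> exists k, sderiv (fun y => (f y - w)^-1 : (Cplx R)^o) z k.
  move=> /fder[k hk] fw; exists (- (k / (f z - w) ^+ 2)).
  apply: cderiv_sderiv; apply: cderiv_inv; last by rewrite subr_eq0.
  move=> e e0; have [dd dd0 hd] := hk e e0; exists dd => // y /hd.
  by congr (cabs _ <= _); ring.
have [M [M0 hM]] : exists M : R, 0 < M /\ forall k z, (k < 4)%N ->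
    seg (corner z0 r k) (corner z0 r k.+1) z -> cabs ((f z - f z0)^-1) <= M.
  have h k : exists M : R, forall z, seg (corner z0 r k) (corner z0 r k.+1) z -> cabs ((f z - f z0)^-1) <= M.
    apply: (@seg_bounded _ (Cplx R)^o (fun z => (f z - f z0)^-1) _ _ _ seminorm_cabs) => z zs.
    have zr := seg_corner_le r0 zs.
    apply: idv; [exact: inU|apply: he1; first exact: le_lt_trans re1].
    by rewrite -subr_eq0 -cabs_gt0 (lt_le_trans _ (seg_corner_ge r0 zs)) // divr_gt0.
  have /choice [N hN] := h.
  exists (\sum_(k < 4) `|N k| + 1); split; first by rewrite ltr_wpDl // sumr_ge0.
  move=> k z k4 /hN h1; apply: (le_trans h1); apply: (le_trans (ler_norm _)).
  rewrite ler_wpDr // (bigD1 (Ordinal k4)) //= lerDl; exact: sumr_ge0.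
(* The contour sum is at most $32M$ and the Cauchy error $4M$; the winding factor being at least
   $4$, this gives $|f(z_0)-w|^{-1}\le 9M$, against more than $10M$ by the choice of $w$. *)
exists (10 * M)^-1; first by rewrite invr_gt0 mulr_gt0.
move=> w wf; apply: contrapT => nz.
have nfw z : cabs (z - z0) <= r -> f z != w.
  by move=> zr; apply/eqP => fz; apply: nz; exists z; split => //; [exact: le_lt_trans rd|exact: inU].
have M4 : 0 < 4 * M by rewrite mulr_gt0.
have M20 : 0 < r / 2 by rewrite divr_gt0.
have := @cauchy_square _ (Cplx R)^o (fun y => (f y - w)^-1) z0 r z0 r0
  (fun z zr => idv z w (inU z zr) (nfw z zr)).
rewrite subrr cabs0 => /(_ M20 _ seminorm_cabs (4 * M) M4) [n0 /(_ n0 (leqnn _))].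
set S := sq_trapz _ _ _ _; set k := sq_winding _ _ _ _ => hS.
have pS : cabs S <= 8 * r * (2 / r * (2 * M)).
  apply: (@sq_trapz_le _ (Cplx R)^o _ _ _ _ _ _ seminorm_cabs r0).
    by apply: mulr_ge0; [rewrite divr_ge0 ?(ltW r0)|rewrite mulr_ge0 ?(ltW M0)].
  move=> j z j4 zs; have zr := seg_corner_ge r0 zs; have zr' := seg_corner_le r0 zs.
  rewrite cabsM; apply: ler_pM; rewrite ?cabs_ge0 //.
    by rewrite cabsV -invf_div lef_pV2 // posrE ?divr_gt0 // (lt_le_trans _ zr) ?divr_gt0.
  have fz0 : 0 < cabs (f z - f z0).
    rewrite cabs_gt0 subr_eq0; apply: he1; first exact: le_lt_trans re1.
    by rewrite -subr_eq0 -cabs_gt0 (lt_le_trans _ zr).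
  have := hM j z j4 zs; rewrite !cabsV => h.
  have h1 : M^-1 <= cabs (f z - f z0) by rewrite -[leRHS]invrK lef_pV2 ?posrE ?invr_gt0.
  have h2 : M^-1 / 2 <= cabs (f z - w).
    rewrite (_ : f z - w = (f z - f z0) - (w - f z0)); last by ring.
    apply: le_trans (cabs_dist _ _); move: wf h1; rewrite invfM.
    have : 0 < M^-1 by rewrite invr_gt0.
    lra.
  by rewrite -[2 * M]invrK lef_pV2 ?posrE ?invr_gt0 ?mulr_gt0 // ?invfM ?[2^-1 * _]mulrC // (lt_le_trans _ h2) // divr_gt0 ?invr_gt0.
have k4 : 4 <= cabs k := sq_winding_ge n0 z0 r0.
have fw0 : 0 < cabs (f z0 - w).
  by rewrite cabs_gt0 subr_eq0; apply: nfw; rewrite subrr cabs0 ltW.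
have h1 : cabs (k * (f z0 - w)^-1) <= 36 * M.
  rewrite (_ : k * _ = S - (S - k *: ((f z0 - w)^-1 : (Cplx R)^o))); last by rewrite subKr.
  rewrite (le_trans (cabsD _ _)) // cabsN.
  have e : 8 * r * (2 / r * (2 * M)) = 32 * M by field; rewrite gt_eqF.
  by rewrite e in pS; move: pS hS; lra.
rewrite cabsM cabsV ler_pdivrMr // in h1.
move: wf; rewrite cabsBC -[X in _ < X]mul1r ltr_pdivlMr ?mulr_gt0 //.
move: h1 k4 M0; clear; lra.
Qed.

End Global.

(** * Roots of unity *)

Definition expi (R : realType) (t : R) : Cplx R := Complex (cos t) (sin t).

Section Expi.
Context {R : realType}.
Implicit Types (s t : R) (w z : Cplx R).

Lemma expiD s t : expi (s + t) = expi s * expi t.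
Proof.
by apply/eqP; rewrite eq_complex /= cosD sinD [X in _ && (_ == X)]addrC !eqxx.
Qed.
Lemma expi0 : expi 0 = 1 :> Cplx R.
Proof. by rewrite /expi cos0 sin0. Qed.
Lemma expiX t n : expi t ^+ n = expi (t * n%:R).
Proof.
elim: n => [|n IH]; first by rewrite expr0 mulr0 expi0.
by rewrite exprS IH -expiD -natr1 mulrDr mulr1 addrC.
Qed.
Lemma cabs_expi t : cabs (expi t) = 1.
Proof. by rewrite /cabs /= cos2Dsin2 sqrtr1. Qed.
Lemma expipi : expi pi = -1 :> Cplx R.
Proof. by apply/eqP; rewrite eq_complex /= cospi sinpi oppr0 !eqxx. Qed.

(** The argument is taken non-negative so that [truncn] acts as a floor on its multiples in
    [block_eigen]. *)
Lemma expi_arg z : cabs z = 1 -> exists2 t : R, 0 <= t & z = expi t.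
Proof.
case: z => a b; rewrite /cabs /= => h.
have ab : a ^+ 2 + b ^+ 2 = 1.
  by rewrite -[LHS]sqr_sqrtr ?h ?expr1n // addr_ge0 // sqr_ge0.
have a1 : -1 <= a <= 1 by have := sqr_ge0 b; nra.
have sb : Num.sqrt (1 - a ^+ 2) = `|b| by rewrite -ab addrC addKr sqrtr_sqr.
have [b0|b0] := leP 0 b.
  exists (acos a); first exact: acos_ge0.
  by rewrite /expi acosK ?in_itv // sin_acos // sb ger0_norm.
exists (pi *+ 2 - acos a).
  by have := acos_lepi a1; have := @pi_ge0 R; rewrite mulr2n; lra.
by rewrite /expi cosB sinB cos2pi sin2pi !mul1r !mul0r addr0 sub0r acosK ?in_itv // sin_acos // sb ltr0_norm // opprK.
Qed.

Lemma expi_cts t (e : R) : 0 < e ->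
  exists2 d : R, 0 < d & forall s, `|s - t| < d -> cabs (expi s - expi t) < e.
Proof.
move=> e0; have e2 : 0 < e / 2 by rewrite divr_gt0.
have /cvgrPdist_lt/(_ _ e2) hc := @continuous_cos R t.
have /cvgrPdist_lt/(_ _ e2) hs := @continuous_sin R t.
have [d d0 hd] := filterI hc hs; exists d => // s st.
have [h1 h2] : `|cos t - cos s| < e / 2 /\ `|sin t - sin s| < e / 2.
  by apply: hd; rewrite /= distrC.
rewrite (le_lt_trans (cabs_re_im _)) //= distrC [`|sin s - _|]distrC.
by rewrite (splitr e) ltrD.
Qed.

Lemma expi_neq s : 0 < s < pi -> expi s != 1 :> Cplx R.
Proof.
move=> h; apply/eqP => -[_ h0]; have := sin_gt0_pi h; by rewrite h0 ltxx.
Qed.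

Lemma expi_half_turn n : (0 < n)%N -> expi (pi / n%:R) ^+ n = -1 :> Cplx R.
Proof.
move=> n0; rewrite expiX divfK ?expipi //; by rewrite pnatr_eq0 -lt0n.
Qed.

Lemma geometric_sum_le w K : cabs w = 1 -> w != 1 ->
  cabs (\sum_(0 <= j < K) w ^+ j) <= 2 / cabs (1 - w).
Proof.
move=> w1 wn; have h0 : 0 < cabs (1 - w) by rewrite cabs_gt0 subr_eq0 eq_sym.
rewrite ler_pdivlMr // -cabsM mulrC.
have -> : (1 - w) * \sum_(0 <= j < K) w ^+ j = 1 - w ^+ K.
  by rewrite big_mkord -[RHS]opprB subrX1 -mulNr opprB.
by rewrite (le_trans (cabsD _ _)) // cabsN cabs1 cabsX w1 expr1n.
Qed.

Lemma cos_gap (d : nat) : (0 < d)%N -> 0 < 1 - cos (pi / d%:R) :> R.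
Proof.
move=> d0; rewrite subr_gt0 -[ltRHS]cos0 ltr_cos.
- by rewrite divr_gt0 ?pi_gt0 // ltr0n.
- by rewrite in_itv /= lexx pi_ge0.
- rewrite in_itv /= divr_ge0 ?pi_ge0 //= ler_pdivrMr ?ltr0n // ler_peMr ?pi_ge0 //.
  by rewrite ler1n.
Qed.

(** Up to conjugation, $\omega^{n+m}$ with $\omega=e^{i\pi/n}$ has argument $\pi x$, where $nx$ is
    the distance from $m$ modulo $2n$ to $n$. Outside the window $x\ge 1/d$, and comparing real
    parts suffices. *)
Lemma expi_window (n d m : nat) : (0 < n)%N -> (0 < d)%N ->
  (n <= d * ((n - m %% n.*2) + (m %% n.*2 - n)))%N ->
  1 - cos (pi / d%:R) <= cabs (1 - expi (pi / n%:R : R) ^+ (n + m)).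
Proof.
move=> n0 d0 hw; have nR : (0 : R) < n%:R by rewrite ltr0n.
set q := (m %% n.*2)%N in hw.
have q2 : (q < n.*2)%N by rewrite ltn_mod; lia.
have -> : expi (pi / n%:R) ^+ (n + m) = expi (pi / n%:R) ^+ (n + q) :> Cplx R.
  rewrite (divn_eq m n.*2) -/q !exprD mulnC exprM -mul2n mulnC exprM.
  by rewrite expi_half_turn // sqrrN !expr1n mul1r.
rewrite (le_trans _ (cabs_re _)) // (le_trans _ (ler_norm _)) //.
rewrite expiX /=.
pose x : R := ((n - q) + (q - n))%N%:R / n%:R.
have -> : cos (pi / n%:R * (n + q)%:R) = cos (pi * x) :> R.
  have [qn|nq] := leqP q n.
    have -> : pi * x = pi *+ 2 - pi / n%:R * (n + q)%:R :> R.
      rewrite /x (_ : ((n - q) + (q - n) = n - q)%N); last by lia.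
      by rewrite natrB // natrD; field; rewrite gt_eqF.
    by rewrite cosB cos2pi sin2pi mul1r mul0r addr0.
  rewrite -(cosD2pi (pi * x)); congr cos.
  rewrite /x (_ : ((n - q) + (q - n) = q - n)%N); last by lia.
  by rewrite natrB ?(ltnW nq) // natrD; field; rewrite gt_eqF.
have dR : (0 : R) < d%:R by rewrite ltr0n.
have x1 : x <= 1 by rewrite ler_pdivrMr // mul1r ler_nat; lia.
have xd : d%:R^-1 <= x.
  by rewrite ler_pdivlMr // ler_pdivrMl // -natrM ler_nat.
have x0 : 0 <= x by rewrite divr_ge0 // ltW.
rewrite lerD2l lerN2 leNgt ltr_cos.
- by rewrite -leNgt ler_wpM2l ?pi_ge0.
- by rewrite in_itv /= mulr_ge0 ?pi_ge0 //= ler_piMr ?pi_ge0.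
- rewrite in_itv /= divr_ge0 ?pi_ge0 ?(ltW dR) //= ler_pdivrMr // ler_peMr ?pi_ge0 //.
  by rewrite ler1n.
Qed.

End Expi.

(** * Periodic building blocks *)

(* [m] is at distance at least [n / d] of [n] modulo [2 n] (one of the two truncated
   differences vanishes, so that their sum is the distance). *)
Definition far_window (d n m : nat) : Prop :=
  (n <= d * ((n - m %% n.*2) + (m %% n.*2 - n)))%N.

(* [u] is a [2 n]-periodic vector of [T i] whose orbit is close to [tau] at time [n] and
   small except in a window around [n], while the other operators keep it small. *)
Definition block_at (R : realType) (N : nat) (X : tvsType (Cplx R))
  (T : 'I_N -> {linear X -> X}) (i : 'I_N) (p : X -> R) (eps : R) (d n : nat)
  (tau u : X) : Prop :=
  [/\ iter n.*2 (T i) u = u, p (iter n (T i) u - tau) <= eps,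
      (forall m, far_window d n m -> p (iter m (T i) u) <= eps),
      (forall j m, j != i -> p (iter m (T j) u) <= eps)
    & (forall j k, j != i -> vanishing (fun m => iter m (T j) (iter k (T i) u)))].

(** All large [n] are required, and only after [p], [eps] and [d]: blocks for two vectors can then
    share a half-period and be added, and a stage is free to choose a common multiple. *)
Definition block (R : realType) (N : nat) (X : tvsType (Cplx R))
  (T : 'I_N -> {linear X -> X}) (i : 'I_N) (tau : X) : Prop :=
  forall p, seminorm p -> forall eps : R, 0 < eps -> forall d, (0 < d)%N ->
  exists n0, forall n, (n0 <= n)%N -> exists u, block_at T i p eps d n tau u.

Section Iterates.
Context {R : realType} {X : tvsType (Cplx R)} (f : {linear X -> X}).

Lemma iterfD n x y : iter n f (x + y) = iter n f x + iter n f y.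
Proof. by elim: n => //= n ->; rewrite linearD. Qed.
Lemma iterfZ n (k : Cplx R) x : iter n f (k *: x) = k *: iter n f x.
Proof. by elim: n => //= n ->; rewrite linearZ. Qed.
Lemma iterf0 n : iter n f 0 = 0.
Proof. by elim: n => //= n ->; rewrite linear0. Qed.
Lemma iterfN n x : iter n f (- x) = - iter n f x.
Proof. by rewrite -scaleN1r iterfZ scaleN1r. Qed.
Lemma iterfB n x y : iter n f (x - y) = iter n f x - iter n f y.
Proof. by rewrite iterfD iterfN. Qed.
Lemma iterf_sum n (I : Type) (r : seq I) (P : pred I) (F : I -> X) :
  iter n f (\sum_(i <- r | P i) F i) = \sum_(i <- r | P i) iter n f (F i).
Proof.
by apply: (big_morph (iter n f)) => [x y|]; [exact: iterfD|exact: iterf0].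
Qed.
Lemma iterf_eigen n (k : Cplx R) x : f x = k *: x -> iter n f x = k ^+ n *: x.
Proof.
move=> fx; elim: n => [|n IH]; first by rewrite scale1r.
by rewrite iterS IH linearZ /= fx scalerA -exprSr.
Qed.
Lemma iterf_period n k x : iter n f x = x -> iter (k * n) f x = x.
Proof. by move=> h; elim: k => // k IH; rewrite mulSn iterD IH. Qed.

Lemma sn_iter p n : seminorm p -> continuous f -> seminorm (fun x => p (iter n f x)).
Proof.
move=> sp fc; elim: n => [//|n IH].
have -> : (fun x => p (iter n.+1 f x)) = (fun x => p (iter n f x)) \o f.
  by apply/funext => x; rewrite /= -iterSr.
by apply: sn_comp => // [x y|c x]; [exact: linearD|exact: linearZ].
Qed.

End Iterates.

Section Averages.
Context {R : realType} {X : tvsType (Cplx R)}.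

Lemma pow_small (rho C e : R) : 0 <= rho -> rho < 1 -> 0 < e ->
  exists m0, forall m, (m0 <= m)%N -> rho ^+ m * C <= e.
Proof.
move=> r0 r1 e0; have h : `|rho| < 1 by rewrite ger0_norm.
have /cvgrPdist_le/(_ _ e0) [m0 _ hm] := @cvg_geometric R C rho h.
exists m0 => m /hm; rewrite /= sub0r normrN => h2.
by rewrite mulrC (le_trans (ler_norm _)).
Qed.

(** Replacing every [F j] by the common vector [x] costs [e]; what is left is a geometric sum,
    bounded independently of [K] and then divided by [K]. *)
Lemma average_le (p : X -> R) (K : nat) (F : nat -> X) (x : X) (w c : Cplx R) (e : R) :
  seminorm p -> (0 < K)%N -> cabs w = 1 -> w != 1 -> cabs c = 1 ->
  (forall j, (j < K)%N -> p (F j - x) <= e) ->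
  p (rc K%:R^-1 *: \sum_(0 <= j < K) (c * w ^+ j) *: F j) <=
    e + p x * (2 / cabs (1 - w)) / K%:R.
Proof.
move=> sp K0 w1 wn c1 hF; have KR : (0 : R) < K%:R by rewrite ltr0n.
rewrite snZ // cabs_rc ger0_norm ?invr_ge0 ?(ltW KR) // ler_pdivrMl //.
have -> : \sum_(0 <= j < K) (c * w ^+ j) *: F j =
   \sum_(0 <= j < K) (c * w ^+ j) *: (F j - x) + (c * \sum_(0 <= j < K) w ^+ j) *: x.
  rewrite mulr_sumr scaler_suml -big_split /=; apply: eq_bigr => j _.
  by rewrite -scalerDr subrK.
rewrite (le_trans (snD sp _ _)) // mulrDr lerD //.
  rewrite (le_trans (sn_sum sp _ _ _)) //.
  have -> : K%:R * e = \sum_(0 <= j < K) e by rewrite big_mkord sumr_const card_ord mulr_natl.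
  rewrite big_nat [leRHS]big_nat; apply: ler_sum => j /andP[_ jK].
  by rewrite snZ // cabsM cabsX w1 c1 expr1n !mul1r hF.
rewrite snZ // cabsM c1 mul1r mulrC mulrCA divff ?gt_eqF // mulr1.
by rewrite ler_wpM2l ?sn_ge0 // geometric_sum_le.
Qed.

Lemma average_le_max (p : X -> R) (K : nat) (F : nat -> X) (c : nat -> Cplx R) (e : R) :
  seminorm p -> (0 < K)%N -> (forall j, cabs (c j) = 1) ->
  (forall j, (j < K)%N -> p (F j) <= e) ->
  p (rc K%:R^-1 *: \sum_(0 <= j < K) c j *: F j) <= e.
Proof.
move=> sp K0 c1 hF; have KR : (0 : R) < K%:R by rewrite ltr0n.
rewrite snZ // cabs_rc ger0_norm ?invr_ge0 ?(ltW KR) // ler_pdivrMl //.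
rewrite (le_trans (sn_sum sp _ _ _)) //.
have -> : K%:R * e = \sum_(0 <= j < K) e by rewrite big_mkord sumr_const card_ord mulr_natl.
rewrite big_nat [leRHS]big_nat; apply: ler_sum => j /andP[_ jK].
by rewrite snZ // c1 mul1r hF.
Qed.

Lemma sderiv_near (f : Cplx R -> X) z l p : sderiv f z l -> seminorm p -> forall e, 0 < e ->
  \forall w \near z, p (f w - f z) <= e.
Proof.
by move=> fl sp e e0; have [d d0 hd] := sderiv_cts fl sp e0; apply/nbhs_cabsP; exists d.
Qed.

End Averages.

(** * Vectors admitting building blocks form a closed subspace *)

Section BlockClosure.
Context {R : realType} {N : nat} {X : tvsType (Cplx R)}.
Variables (T : 'I_N -> {linear X -> X}) (i : 'I_N).

Lemma vanishingZ (k : Cplx R) (u : nat -> X) : vanishing u -> vanishing (fun n => k *: u n).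
Proof.
move=> hu p sp rho rho0; have k1 : 0 < cabs k + 1 by rewrite ltr_wpDl // cabs_ge0.
have [n0 h0] := hu p sp (rho / (cabs k + 1)) (divr_gt0 rho0 k1).
exists n0 => n /h0; rewrite ler_pdivlMr // => h; rewrite snZ //.
by have := sn_ge0 sp (u n); lra.
Qed.

Lemma block_at_le p eps eps' d n tau u : eps <= eps' ->
  block_at T i p eps d n tau u -> block_at T i p eps' d n tau u.
Proof.
move=> ee [h1 h2 h3 h4 h5]; split=> //; first exact: le_trans ee.
  by move=> m hm; apply: le_trans ee; exact: h3.
by move=> j m ji; apply: le_trans ee; exact: h4.
Qed.

Lemma block0 : block T i 0.
Proof.
move=> p sp eps eps0 d d0; exists 0%N => n _; exists 0; have p0 : p 0 <= eps by rewrite sn0 // ltW.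
split; [by rewrite iterf0|by rewrite iterf0 subr0|by move=> m _; rewrite iterf0|
  by move=> j m _; rewrite iterf0|].
by move=> j k _ q sq rho rho0; exists 0%N => m _; rewrite !iterf0 sn0 // ltW.
Qed.

Lemma blockD x y : block T i x -> block T i y -> block T i (x + y).
Proof.
move=> hx hy p sp eps eps0 d d0; have e2 : 0 < eps / 2 by rewrite divr_gt0.
have [n1 h1] := hx p sp _ e2 d d0; have [n2 h2] := hy p sp _ e2 d d0.
exists (maxn n1 n2) => n; rewrite geq_max => /andP[/h1 [u [u1 u2 u3 u4 u5]] /h2 [v [v1 v2 v3 v4 v5]]].
exists (u + v); split.
- by rewrite iterfD u1 v1.
- rewrite iterfD opprD addrACA (le_trans (snD sp _ _)) //.
  by rewrite (splitr eps) lerD.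
- move=> m hm; rewrite iterfD (le_trans (snD sp _ _)) // (splitr eps) lerD ?u3 ?v3 //.
- move=> j m hm; rewrite iterfD (le_trans (snD sp _ _)) // (splitr eps) lerD ?u4 ?v4 //.
- move=> j k ji; apply: vanishing_ext (vanishingD (u5 j k ji) (v5 j k ji)) => m.
  by rewrite !iterfD.
Qed.

Lemma blockZ (k : Cplx R) x : block T i x -> block T i (k *: x).
Proof.
move=> hx p sp eps eps0 d d0; have k1 : 0 < cabs k + 1 by rewrite ltr_wpDl // cabs_ge0.
have e2 : 0 < eps / (cabs k + 1) by rewrite divr_gt0.
have kle y : p y <= eps / (cabs k + 1) -> p (k *: y) <= eps.
  by rewrite ler_pdivlMr // snZ // => h; have := sn_ge0 sp y; lra.
have [n1 h1] := hx p sp _ e2 d d0.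
exists n1 => n /h1 [u [u1 u2 u3 u4 u5]]; exists (k *: u); split.
- by rewrite iterfZ u1.
- by rewrite iterfZ -scalerBr; exact: kle.
- by move=> m hm; rewrite iterfZ; apply: kle; exact: u3.
- by move=> j m hm; rewrite iterfZ; apply: kle; exact: u4.
- move=> j k' ji; apply: vanishing_ext (vanishingZ k (u5 j k' ji)) => m.
  by rewrite !iterfZ.
Qed.

(** [tau] enters [block_at] through a single inequality, so a block for a nearby vector serves as
    well. *)
Lemma block_closed x :
  (forall p, seminorm p -> forall e, 0 < e -> exists y, block T i y /\ p (x - y) <= e) ->
  block T i x.
Proof.
move=> hx p sp eps eps0 d d0; have e2 : 0 < eps / 2 by rewrite divr_gt0.
have [y [hy xy]] := hx p sp _ e2; have [n1 h1] := hy p sp _ e2 d d0.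
exists n1 => n /h1 [u hu]; exists u.
have [v1 v2 v3 v4 v5] : block_at T i p eps d n y u.
  by apply: block_at_le hu; rewrite ler_pdivrMr // ler_peMr ?(ltW eps0) // ler1n.
split => //; have [_ u2 _ _ _] := hu.
rewrite (le_trans (sn_tri sp y _ _)) // (splitr eps) lerD // (snBC sp) //.
Qed.

End BlockClosure.

(** * Building blocks from eigenvectors *)

Section Block.
Context {R : realType} {N : nat} {X : tvsType (Cplx R)}.
Variables (T : 'I_N -> {linear X -> X}) (O U : set (Cplx R)) (E : Cplx R -> X).
Variable phi : 'I_N -> Cplx R -> Cplx R.
Hypothesis Tcts : forall i, continuous (T i).
Hypothesis oO : open O.
Hypothesis hE : holomorphic_on E O.
Hypothesis oU : open U.
Hypothesis cU : connected U.
Hypothesis OU : O `<=` U.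
Hypothesis hphi : forall i, holomorphic_on (phi i : Cplx R -> (Cplx R)^o) U.
Hypothesis nphi : forall i, ~ exists c : Cplx R, forall z, U z -> phi i z = c.
Hypothesis eig : forall i z, O z -> T i (E z) = phi i z *: E z.

Lemma iterT_eigen i m z : O z -> iter m (T i) (E z) = phi i z ^+ m *: E z.
Proof. by move=> Oz; apply: iterf_eigen; exact: eig. Qed.

Lemma phi_near i z e : O z -> 0 < e -> \forall w \near z, cabs (phi i w - phi i z) <= e.
Proof.
move=> Oz e0; have [l hl] := holomorphic_sderiv (@hphi i) (OU Oz).
exact: (sderiv_near hl seminorm_cabs e0).
Qed.

(* [u] is the average of [K] eigenvectors of [T i] close to [E z0], for consecutive
   [2 n]-th roots of unity, with alternating signs. [K] does not depend on [n]: outside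
   the window, [T i ^ m u] is governed by a geometric sum of ratio away from [1]. *)
Lemma block_eigen i z0 : O z0 -> cabs (phi i z0) = 1 ->
  (forall j, j != i -> cabs (phi j z0) < 1) -> block T i (E z0).
Proof.
move=> Oz0 li lj p sp eps eps0 d d0.
have [lE hlE] := holomorphic_sderiv hE Oz0.
pose rho j := (1 + cabs (phi j z0)) / 2.
have rho0 j : 0 <= rho j by rewrite divr_ge0 // addr_ge0 // cabs_ge0.
have rho1 j : j != i -> rho j < 1 by move=> /lj; rewrite /rho; lra.
have e2 : 0 < eps / 2 by rewrite divr_gt0.
(* From time [m0] on, the decay of $T_j$ suffices by itself. The finitely many earlier times are
   left to the alternating signs of the average, since $T_j^mE(z)$ hardly varies with $z$ there;
   [m0] depends neither on [K] nor on [n]. *)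
have [m0 hm0] : exists m0, forall m, (m0 <= m)%N -> forall j, j != i ->
    rho j ^+ m * (p (E z0) + 1) <= eps.
  have h j : exists m0, j != i -> forall m, (m0 <= m)%N -> rho j ^+ m * (p (E z0) + 1) <= eps.
    have [->|ji] := eqVneq j i; first by exists 0%N.
    by have [m1 hm1] := pow_small (p (E z0) + 1) (rho0 j) (rho1 j ji) eps0; exists m1.
  have /choice [M hM] := h; exists (\max_j M j) => m hm j ji; apply: hM => //.
  by apply: leq_trans hm; exact: (leq_bigmax j).
have nearE : \forall z \near z0, [/\ O z, p (E z - E z0) <= eps / 2,
    p (E z - E z0) <= 1, (forall j, j != i -> cabs (phi j z) <= rho j) &
    (forall (j : 'I_N) (m : 'I_m0), p (iter m (T j) (E z) - iter m (T j) (E z0)) <= eps / 2)].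
  have n1 : \forall z \near z0, O z by exact: open_nbhs_nbhs.
  have n2 := sderiv_near hlE sp e2.
  have n3 := sderiv_near hlE sp ltr01.
  have n4 : \forall z \near z0, forall j, j != i -> cabs (phi j z) <= rho j.
    apply: (@filter_forall _ _ (fun j z => j != i -> cabs (phi j z) <= rho j) _ (nbhs_filter z0)) => j; have [->|ji] := eqVneq j i; first exact: nearW.
    have r0 : 0 < (1 - cabs (phi j z0)) / 2 by have := lj j ji; lra.
    have := phi_near j Oz0 r0; apply: filterS => z hz _.
    rewrite (_ : phi j z = (phi j z - phi j z0) + phi j z0); last by rewrite subrK.
    by rewrite (le_trans (cabsD _ _)) // /rho; move: hz; lra.
  have n5 : \forall z \near z0, forall (j : 'I_N) (m : 'I_m0),
      p (iter m (T j) (E z) - iter m (T j) (E z0)) <= eps / 2.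
    apply: (@filter_forall _ _ (fun (j : 'I_N) z => forall m : 'I_m0,
      p (iter m (T j) (E z) - iter m (T j) (E z0)) <= eps / 2) _ (nbhs_filter z0)) => j.
    apply: (@filter_forall _ _ (fun (m : 'I_m0) z =>
      p (iter m (T j) (E z) - iter m (T j) (E z0)) <= eps / 2) _ (nbhs_filter z0)) => m.
    have := sderiv_near hlE (sn_iter m sp (@Tcts j)) e2.
    by apply: filterS => z; rewrite iterfB.
  apply: (@filterS _ _ (nbhs_filter z0) _ _ _ (filterI n1 (filterI n2 (filterI n3 (filterI n4 n5))))).
  by move=> z [? [? [? [? ?]]]].
have [de de0 hde] := (nbhs_cabsP _ _).1 nearE.
have [eta eta0 heta] := open_mapping oU cU (@hphi i) (@nphi i) (OU Oz0) de0.
have [t0 t00 ht0] := expi_arg li.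
have [th th0 hth] := expi_cts t0 eta0.
have kap := @cos_gap R d d0.
set kappa := 1 - cos (pi / d%:R) in kap.
(* What the factor $1/K$ has to beat: the geometric sums of $T_i$ outside the window, and the
   alternating sums of the other operators before [m0]. *)
pose B := p (E z0) * (2 / kappa) + \sum_(j < N) \sum_(m < m0) p (iter m (T j) (E z0)).
have pE0 := sn_ge0 sp (E z0).
have B0 : 0 <= B.
  apply: addr_ge0; first by rewrite mulr_ge0 // divr_ge0 // ltW.
  by apply: sumr_ge0 => j _; apply: sumr_ge0 => m _; exact: sn_ge0.
pose K := (Num.truncn (B / (eps / 2))).+1.
have K0 : (0 < K)%N by [].
have KR : (0 : R) < K%:R by rewrite ltr0n.
have BK : B / K%:R <= eps / 2.
  by rewrite ler_pdivrMr // mulrC -ler_pdivrMr // ltW // truncnS_gt.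
(* For such [n], the [K] roots following the one just below $\phi_i(z_0)$ all lie within angle [th]
   of it. *)
pose n0 := (Num.truncn (pi * K.+1%:R / th)).+1.
exists n0 => n hn.
have n_gt0 : (0 < n)%N by apply: leq_trans hn.
have nR : (0 : R) < n%:R by rewrite ltr0n.
have small : pi / n%:R * K.+1%:R < th.
  rewrite mulrAC ltr_pdivrMr // [th * _]mulrC -ltr_pdivrMr //.
  by rewrite (lt_le_trans (truncnS_gt _)) // ler_nat.
pose om : Cplx R := expi (pi / n%:R).
pose j0 := Num.truncn (t0 * n%:R / pi).
have pi0 := @pi_gt0 R.
have close j : (j < K)%N -> `|pi / n%:R * (j0 + j)%:R - t0| < th.
  move=> jK; apply: le_lt_trans small.
  have /andP[h1 h2] : (j0%:R <= t0 * n%:R / pi < j0.+1%:R).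
    by apply: truncn_itv; rewrite divr_ge0 ?mulr_ge0 ?(ltW nR) ?(ltW pi0).
  have t0E : t0 = pi / n%:R * (t0 * n%:R / pi).
    have : forall t x y : R, x != 0 -> y != 0 -> t = x / y * (t * y / x).
      by move=> t x y x0 y0; field; rewrite x0 y0.
    by apply; rewrite gt_eqF.
  rewrite [X in `|_ - X|]t0E -mulrBr normrM ger0_norm ?divr_ge0 ?(ltW nR) ?(ltW pi0) //.
  apply: ler_wpM2l; first by rewrite divr_ge0 ?(ltW nR) ?(ltW pi0).
  have : (j%:R : R) <= K%:R by rewrite ler_nat ltnW.
  have : (0 : R) <= j%:R by [].
  rewrite -natr1 in h2; rewrite natrD -natr1 ler_norml.
  by move: h1 h2; clear; lra.
have zex j : exists z, (j < K)%N -> cabs (z - z0) < de /\ phi i z = om ^+ (j0 + j).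
  have [jK|_] := boolP (j < K)%N; last by exists z0.
  have := close j jK; move=> /hth; rewrite -ht0 => /heta [z [zd Uz fz]].
  by exists z => _; split => //; rewrite fz /om expiX.
have /choice [zz hzz] := zex.
have zzP j : (j < K)%N -> [/\ O (zz j), p (E (zz j) - E z0) <= eps / 2,
    p (E (zz j) - E z0) <= 1, (forall j', j' != i -> cabs (phi j' (zz j)) <= rho j') &
    (forall (j' : 'I_N) (m : 'I_m0), p (iter m (T j') (E (zz j)) - iter m (T j') (E z0)) <= eps / 2)].
  by move=> jK; apply: hde; have [] := hzz j jK.
have omn : om ^+ n = -1 by exact: expi_half_turn.
have cabs_om k : cabs (om ^+ k) = 1 by rewrite cabsX cabs_expi expr1n.
(* The sign $(-1)^{j_0+j}$ is kept as a power of $\omega^n$: applying $T_i^m$ merely changes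
   $\omega^n$ into $\omega^{n+m}$, so at time $n$ all coefficients become $1$. *)
pose u := rc K%:R^-1 *: \sum_(0 <= j < K) (om ^+ n) ^+ (j0 + j) *: E (zz j).
have iteru (j' : 'I_N) m : iter m (T j') u =
   rc K%:R^-1 *: \sum_(0 <= j < K) ((om ^+ n) ^+ j0 * (om ^+ n) ^+ j) *: iter m (T j') (E (zz j)).
  rewrite /u iterfZ iterf_sum; congr (_ *: _); apply: eq_bigr => j _.
  by rewrite iterfZ exprD.
have iterui m : iter m (T i) u =
   rc K%:R^-1 *: \sum_(0 <= j < K) ((om ^+ (n + m)) ^+ j0 * (om ^+ (n + m)) ^+ j) *: E (zz j).
  rewrite iteru; congr (_ *: _); rewrite big_nat [RHS]big_nat; apply: eq_bigr => j /andP[_ jK].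
  have [_ fz] := hzz j jK; have [Oz _ _ _ _] := zzP j jK.
  rewrite iterT_eigen // fz scalerA -!exprD -!exprM -exprD; congr (_ ^+ _ *: _).
  by clear; ring.
exists u; split.
- rewrite iterui /u; congr (_ *: _); apply: eq_bigr => j _; congr (_ *: _).
  by rewrite exprD -[(n.*2)%N]muln2 exprM omn sqrrN expr1n mulr1 -exprD.
- have -> : iter n (T i) u - E z0 =
     rc K%:R^-1 *: \sum_(0 <= j < K) (1 : Cplx R) *: (E (zz j) - E z0).
    under eq_bigr do rewrite scalerBr.
    rewrite sumrB scalerBr iterui; congr (_ - _).
      congr (_ *: _); apply: eq_bigr => j _.
      by rewrite exprD omn mulrNN mulr1 !expr1n mulr1.
    rewrite -scaler_suml scalerA big_mkord sumr_const card_ord.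
    by rewrite rcV -mulr_natl mulr1 natr_rc mulVf ?scale1r // -natr_rc pnatr_eq0.
  apply: le_trans (_ : _ <= eps / 2) _; last by rewrite ler_pdivrMr // ler_peMr ?(ltW eps0) // ler1n.
  apply: (average_le_max sp K0) => [j|j jK]; first exact: cabs1.
  by have [] := zzP j jK.
- move=> m hw; have := @expi_window R n d m n_gt0 d0 hw; rewrite -/om -/kappa => hk.
  have hc : 0 < cabs (1 - om ^+ (n + m)) by exact: lt_le_trans hk.
  rewrite iterui; apply: le_trans (average_le (x := E z0) (e := eps / 2) sp K0 _ _ _ _) _.
  + exact: cabs_om.
  + by move: hc; rewrite cabs_gt0 subr_eq0 eq_sym.
  + by rewrite -exprM cabs_om.
  + by move=> j jK; have [] := zzP j jK.
  rewrite [leRHS](splitr eps) lerD2l; apply: le_trans BK.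
  rewrite ler_pM2r ?invr_gt0 //; apply: (@le_trans _ _ (p (E z0) * (2 / kappa))).
    rewrite ler_wpM2l // ler_pM2l // lef_pV2 ?posrE //.
  rewrite /B lerDl; apply: sumr_ge0 => j _; apply: sumr_ge0 => k _; exact: sn_ge0.
- move=> j m ji; rewrite iteru; have [mm0|m0m] := ltnP m m0.
    apply: le_trans (average_le (x := iter m (T j) (E z0)) (e := eps / 2) sp K0 _ _ _ _) _.
    + by rewrite cabs_om.
    + by rewrite omn -subr_eq0 -opprD oppr_eq0 (_ : 1 + 1 = 2%:R) // natr_rc -rc0 (inj_eq (@rc_inj R)).
    + by rewrite -exprM cabs_om.
    + by move=> k kK; have [_ _ _ _ h] := zzP k kK; exact: (h j (Ordinal mm0)).
    rewrite omn opprK (_ : 1 + 1 = 2%:R) // natr_rc cabs_rc ger0_norm // divff // mulr1.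
    rewrite [leRHS](splitr eps) lerD2l; apply: le_trans BK.
    rewrite ler_pM2r ?invr_gt0 //; apply: ler_wpDl.
      by rewrite mulr_ge0 // divr_ge0 // ltW.
    rewrite (bigD1 j) //= ler_wpDr //.
      by apply: sumr_ge0 => k _; apply: sumr_ge0 => l _; exact: sn_ge0.
    rewrite (bigD1 (Ordinal mm0)) //= lerDl.
    by apply: sumr_ge0 => k _; exact: sn_ge0.
  under eq_bigr do rewrite -exprD.
  apply: (average_le_max sp K0) => [k|k kK]; first by rewrite -exprM cabs_om.
  have [Oz _ h1 h2 _] := zzP k kK.
  rewrite iterT_eigen // snZ // cabsX; apply: le_trans (hm0 m m0m j ji).
  apply: ler_pM; rewrite ?exprn_ge0 ?cabs_ge0 ?sn_ge0 //.
    by rewrite lerXn2r ?nnegrE ?cabs_ge0 // h2.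
  by rewrite (le_trans (sn_dist sp _ (E z0))) // lerD2l.
- move=> j n' ji p' sp' e' e'0.
  pose C := \sum_(k < K) p' (E (zz k)).
  have [m1 hm1] := pow_small C (rho0 j) (rho1 j ji) e'0.
  exists m1 => m hm; rewrite iterui iterfZ iterf_sum.
  under eq_bigr do rewrite iterfZ -exprD.
  apply: (average_le_max sp' K0) => [k|k kK]; first by rewrite -exprM cabs_om.
  have [Oz _ _ h2 _] := zzP k kK.
  rewrite iterT_eigen // snZ // cabsX; apply: le_trans (hm1 m hm).
  apply: ler_pM; rewrite ?exprn_ge0 ?cabs_ge0 ?sn_ge0 //.
    by rewrite lerXn2r ?nnegrE ?cabs_ge0 // h2.
  rewrite /C (bigD1 (Ordinal kK)) //= lerDl; apply: sumr_ge0 => l _; exact: sn_ge0.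
Qed.

(** Provides the accumulation at $z_0$ required by the identity theorem: the value $\phi_i(z_0)$ is
    rotated by a small angle [s], and an angle in $(0,\pi)$ forces a different preimage. *)
Lemma unimodular_points_near i z0 (e : R) : O z0 -> cabs (phi i z0) = 1 ->
  (forall j, j != i -> cabs (phi j z0) < 1) -> 0 < e ->
  exists a, [/\ 0 < cabs (a - z0), cabs (a - z0) < e, O a, cabs (phi i a) = 1 &
    forall j, j != i -> cabs (phi j a) < 1].
Proof.
move=> Oz0 l1 lj e0.
have nearG : \forall z \near z0, [/\ O z, cabs (z - z0) < e &
    forall j, j != i -> cabs (phi j z) < 1].
  have n1 : \forall z \near z0, O z by exact: open_nbhs_nbhs.
  have n2 := near_cabs z0 e0.
  have n3 : \forall z \near z0, forall j, j != i -> cabs (phi j z) < 1.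
    apply: (@filter_forall _ _ (fun j z => j != i -> cabs (phi j z) < 1) _ (nbhs_filter z0)) => j.
    have [->|ji] := eqVneq j i; first exact: nearW.
    have r0 : 0 < (1 - cabs (phi j z0)) / 2 by have := lj j ji; lra.
    have := phi_near j Oz0 r0; apply: filterS => z hz _.
    rewrite (_ : phi j z = (phi j z - phi j z0) + phi j z0); last by rewrite subrK.
    rewrite (le_lt_trans (cabsD _ _)) //; have := lj j ji; move: hz; lra.
  apply: (@filterS _ _ (nbhs_filter z0) _ _ _ (filterI n1 (filterI n2 n3))).
  by move=> z [? [? ?]].
have [d d0 hd] := (nbhs_cabsP _ _).1 nearG.
have [eta eta0 heta] := open_mapping oU cU (@hphi i) (@nphi i) (OU Oz0) d0.
have [t0 t00 ht0] := expi_arg l1.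
have [th th0 hth] := expi_cts t0 eta0.
pose s := Num.min th pi / 2.
have m0 : 0 < Num.min th pi by rewrite lt_min th0 pi_gt0.
have s0 : 0 < s by rewrite divr_gt0.
have sm : s < Num.min th pi by move: m0; rewrite /s; lra.
move: sm; rewrite lt_min => /andP[sth spi].
have [z [zd Uz fz]] : exists z, [/\ cabs (z - z0) < d, U z & phi i z = expi (t0 + s)].
  by apply: heta; rewrite ht0; apply: hth; rewrite addrC addKr gtr0_norm.
have [Oz ze zj] := hd z zd; exists z; split => //; last by rewrite fz cabs_expi.
rewrite cabs_gt0 subr_eq0; apply/eqP => zz0.
have /eqP : expi s != 1 :> Cplx R by apply: expi_neq; rewrite s0.
apply; apply: (@mulfI _ (expi t0)).
  by rewrite -cabs_gt0 cabs_expi.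
by rewrite mulr1 -expiD -fz zz0.
Qed.

Lemma block_all i z0 : connected O -> closed_lin_span (E @` O) = setT ->
  O z0 -> cabs (phi i z0) = 1 -> (forall j, j != i -> cabs (phi j z0) < 1) ->
  forall x, block T i x.
Proof.
move=> cO spanE Oz0 l1 lj.
have blockE z : O z -> block T i (E z).
  apply: (@identity_theorem _ _ E O (block T i) z0 oO cO hE (@blockD _ _ _ T i) (@blockZ _ _ _ T i) (@block0 _ _ _ T i)).
  - exact: block_closed.
  - exact: Oz0.
  - move=> e e0; have [a [a0 ae Oa a1 aj]] := unimodular_points_near Oz0 l1 lj e0.
    by exists a; split => //; exact: block_eigen.
move=> x; apply: block_closed => p sp e e0.
have : closed_lin_span (E @` O) x by rewrite spanE.
move=> /(_ _ (sn_near sp x e0)) [y [[n [c [v [hv ->]]]] hy]].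
exists (\sum_(k < n) c k *: v k); split; last by rewrite (snBC sp) ltW.
apply: big_ind => [|a b|k _]; [exact: block0|exact: blockD|].
by apply: blockZ; have [z Oz <-] := hv k; exact: blockE.
Qed.

End Block.

(** * Separability *)

Section Separability.
Context {R : realType} {X : tvsType (Cplx R)}.
Variables (O : set (Cplx R)) (E : Cplx R -> X).
Hypothesis hE : holomorphic_on E O.

Lemma rat_dense (a : R) (e : R) : 0 < e -> exists q : rat, `|ratr q - a| < e.
Proof.
move=> e0; have [q hq] := @rat_in_itvoo R (a - e) (a + e) ltac:(lra).
by exists q; move: hq; rewrite in_itv /= ltr_norml => /andP[h1 h2]; lra.
Qed.

Definition rat_cplx (q : rat * rat) : Cplx R := Complex (ratr q.1) (ratr q.2).

Lemma rat_cplx_dense z (e : R) : 0 < e -> exists q, cabs (rat_cplx q - z) < e.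
Proof.
move=> e0; have e2 : 0 < e / 2 by rewrite divr_gt0.
case: z => a b; have [q1 h1] := rat_dense a e2.
have [q2 h2] := rat_dense b e2.
exists (q1, q2); rewrite (le_lt_trans (cabs_re_im _)) //= (splitr e) ltrD //.
Qed.

(** [E] is evaluated at arbitrary rational points, in [O] or not; only a countable index set with
    dense range matters. *)
Definition rat_comb (s : seq ((rat * rat) * (rat * rat))) : X :=
  \sum_(t <- s) rat_cplx t.1 *: E (rat_cplx t.2).

Lemma rat_comb_dense : closed_lin_span (E @` O) = setT ->
  forall x p, seminorm p -> forall e, 0 < e -> exists s, p (x - rat_comb s) <= e.
Proof.
move=> spanE x p sp.
have one (c : Cplx R) z e : O z -> 0 < e -> exists s, p (c *: E z - rat_comb s) <= e.
  move=> Oz e0; have e2 : 0 < e / 2 by rewrite divr_gt0.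
  have [l hl] := holomorphic_sderiv hE Oz.
  have c1 : 0 < cabs c + 1 by rewrite ltr_wpDl // cabs_ge0.
  have e3 : 0 < e / 2 / (cabs c + 1) by rewrite divr_gt0.
  have [d d0 hd] := sderiv_cts hl sp e3.
  have [q hq] := rat_cplx_dense z d0.
  have p1 : 0 < p (E (rat_cplx q)) + 1 by rewrite ltr_wpDl // sn_ge0.
  have [r hr] := rat_cplx_dense c (divr_gt0 e2 p1).
  exists [:: (r, q)]; rewrite /rat_comb big_seq1 /=.
  rewrite (le_trans (sn_tri sp (c *: E (rat_cplx q)) _ _)) // (splitr e) lerD //.
    rewrite -scalerBr snZ // (snBC sp).
    have := hd _ hq; rewrite ler_pdivlMr // => h.
    by have := sn_ge0 sp (E (rat_cplx q) - E z); lra.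
  rewrite -scalerBl snZ // cabsBC; move: hr; rewrite ltr_pdivlMr // => h.
  by have := cabs_ge0 (rat_cplx r - c); lra.
move=> e e0; have e2 : 0 < e / 2 by rewrite divr_gt0.
have : closed_lin_span (E @` O) x by rewrite spanE.
move=> /(_ _ (sn_near sp x e2)) [y [[n [c [v [hv ->]]]] hy]].
have [s hs] : exists s, p (\sum_(k < n) c k *: v k - rat_comb s) <= e / 2.
  have : 0 < e / 2 by [].
  move: (e / 2) => {hy} e'; elim: n e' c v hv => [|n IH] e' c v hv e'0.
    by exists [::]; rewrite /rat_comb big_nil big_ord0 subrr sn0 // ltW.
  have e'2 : 0 < e' / 2 by rewrite divr_gt0.
  have [s hs] : exists s, p (\sum_(k < n) c (widen_ord (leqnSn n) k) *: v (widen_ord (leqnSn n) k) - rat_comb s) <= e' / 2.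
    exact: (IH _ (fun k => c (widen_ord (leqnSn n) k)) (fun k => v (widen_ord (leqnSn n) k))).
  have [z Oz zv] := hv ord_max; have [t ht] := one (c ord_max) z _ Oz e'2.
  exists (s ++ t); rewrite big_ord_recr /= /rat_comb big_cat /= opprD addrACA.
  by rewrite (le_trans (snD sp _ _)) // (splitr e') lerD // -zv.
exists s; rewrite (le_trans (sn_tri sp (\sum_(k < n) c k *: v k) _ _)) //.
by rewrite (splitr e) lerD // (snBC sp) ltW.
Qed.

End Separability.

(** * Lower density *)

Definition count_below (P : nat -> bool) (n : nat) : nat := (\sum_(0 <= k < n) P k)%N.

Section Counting.
Local Open Scope nat_scope.

Lemma count_below_period (P : nat -> bool) m n : (forall k, P (k + m) = P k) ->
  count_below P (m + n) = count_below P m + count_below P n.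
Proof.
move=> hP; rewrite /count_below (@big_cat_nat _ _ _ m) ?leq_addr //=; congr (_ + _).
rewrite -{1}[m]add0n big_addn addKn; by apply: eq_bigr => k _; rewrite hP.
Qed.

Lemma count_below_interval a b n : count_below (fun k => a <= k < b) n = minn n b - minn n a.
Proof.
elim: n => [|n IH]; first by rewrite /count_below big_geq ?min0n.
rewrite /count_below big_nat_recr //= -/(count_below _ n) IH; lia.
Qed.

Lemma count_below_le (P Q : nat -> bool) n : (forall k, k < n -> P k -> Q k) -> count_below P n <= count_below Q n.
Proof.
move=> h; rewrite /count_below big_nat [X in _ <= X]big_nat; apply: leq_sum => k /andP[_ kn].
by case: (P k) (h k kn) => // ->.
Qed.

(** A period $2de$ meets the window in fewer than $2e$ times. None of them comes before $h-e\ge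
    h/2$, so with the factor $4$ the bound holds for every [n] without additive error, and can be
    summed over infinitely many stages. *)
Lemma count_below_near_window d e n : 2 <= d -> 0 < e ->
  count_below (fun m => ~~ (d * e <= d * ((d * e - m %% (d * e).*2) + (m %% (d * e).*2 - d * e)))) n * d <= 4 * n.
Proof.
move=> d2 e0; set h := d * e; set P := fun m => _.
have h0 : 0 < h by rewrite muln_gt0 e0; lia.
have he : 2 * e <= h by rewrite /h leq_mul2r d2 orbT.
have PS k : P (k + h.*2) = P k by rewrite /P modnDr.
have Pint k : k < h.*2 -> P k -> h - e < k < h + e.
  move=> kh; rewrite /P modn_small // -ltnNge /h ltn_mul2l => /andP[_]; rewrite -/h; lia.
have small m : m <= h.*2 -> count_below P m * d <= 4 * m.
  move=> mh; have [lo|hi] := leqP m (h - e).+1.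
    suff -> : count_below P m = 0 by rewrite mul0n.
    apply/eqP; rewrite -leqn0; have -> : 0 = count_below (fun k => (h - e).+1 <= k < h + e) m.
      by rewrite count_below_interval; lia.
    by apply: count_below_le => k km /Pint; apply; lia.
  have h1 : count_below P m <= 2 * e.
    have : count_below P m <= count_below (fun k => (h - e).+1 <= k < h + e) m.
      by apply: count_below_le => k km /Pint; apply; lia.
    rewrite count_below_interval; lia.
  apply: (@leq_trans (2 * e * d)); first by rewrite leq_mul2r h1 orbT.
  rewrite -mulnA (mulnC e) -/h; lia.
elim/ltn_ind: n => n IH.
have [nh|hn] := leqP n h.*2; first exact: small.
rewrite -(subnKC (ltnW hn)) count_below_period // mulnDl mulnDr.
apply: leq_add; first exact: small.
by apply: IH; lia.
Qed.

Lemma count_below_odd_multiples h n : 0 < h ->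
  n <= (count_below (fun m => m %% h.*2 == h) n).+1 * h.*2.
Proof.
move=> h0; set P := fun m => _.
have PS k : P (k + h.*2) = P k by rewrite /P modnDr.
elim/ltn_ind: n => n IH.
have [nh|hn] := leqP n h.*2; first by apply: leq_trans nh _; rewrite leq_pmull.
rewrite -(subnKC (ltnW hn)) count_below_period //.
have : 1 <= count_below P h.*2.
  rewrite /count_below (@big_cat_nat _ _ _ h) //=; last by lia.
  rewrite [X in _ <= _ + X]big_ltn; last by lia.
  have -> : P h by rewrite /P modn_small ?eqxx //; lia.
  by rewrite addnCA.
have := IH (n - h.*2); move: (count_below P (n - h.*2)) => x /(_ ltac:(lia)); nia.
Qed.

End Counting.

Section LowerDensity.
Context {R : realType}.

Lemma count_upto_below (A : set nat) n : count_upto A n = count_below (fun k => `[< A k >]) n.+1.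
Proof.
rewrite /count_upto /count_below big_mkord -sum1_card.
rewrite big_mkcond /=; apply: eq_bigr => k _.
by rewrite unfold_in /in_set /= asboolb; case: `[< A k >].
Qed.

Lemma lower_density_gt0 (A : set nat) (c : R) n0 : 0 < c ->
  (forall n, (n0 <= n)%N -> c * n%:R <= (count_below (fun k => `[< A k >]) n)%:R) ->
  (0 < lower_density R A)%E.
Proof.
move=> c0 h; apply: (@lt_le_trans _ _ c%:E); first by rewrite lte_fin.
rewrite /lower_density limn_einf_lim (cvg_lim _ (@cvg_einfs_sup _ _)) //.
apply: le_trans (ereal_sup_ubound _); last by exists n0.
apply: le_ereal_inf_tmp => _ [k /= nk <-].
rewrite lee_fin ler_pdivlMr // count_upto_below h //.
exact: leq_trans nk _.
Qed.

Lemma geometric_half_sum l L : \sum_(l.+1 <= k < L) (2^-1 : R) ^+ k <= 2^-1 ^+ l.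
Proof.
have [Ll|lL] := leqP L l.+1; first by rewrite big_geq // exprn_ge0.
have : \sum_(l.+1 <= k < L) (2^-1 : R) ^+ k = 2^-1 ^+ l - 2^-1 ^+ L.-1.
  rewrite -(subnKC lL); elim: (L - l.+2)%N => [|m IH].
    by rewrite addn0 big_nat1 /= exprS; lra.
  rewrite addnS big_nat_recr /=; last by lia.
  rewrite IH [(l.+2 + m)%N]addSn /= [2^-1 ^+ (_ + m).+1]exprS; lra.
by move=> ->; rewrite gerBl exprn_ge0.
Qed.

(* At an odd multiple of [h l], the stage [l] is aimed at; the other condition
   discards the times at which some later stage is not small. *)
Definition hit_times (h d : nat -> nat) (l : nat) : set nat :=
  [set m | (m %% (h l).*2 == h l)%N /\ forall k, (l < k)%N -> far_window (d k) (h k) m].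

(** The odd multiples of $h_l$ have density $1/(2h_l)$, while the later windows remove at most
    $\sum_{k>l}4/d_k\le 1/(16h_l)$. The constant $1/(4h_l)$ leaves room for boundary effects once
    $n\ge 8h_l$. *)
Lemma hit_times_density (h d : nat -> nat) l (B : set nat) :
  (forall k, (0 < h k)%N) -> (forall k, exists2 e, (0 < e)%N & h k = (d k * e)%N) ->
  (forall k, (l < k)%N -> (64 * 2 ^ k * h l <= d k)%N) ->
  hit_times h d l `<=` B -> (0 < lower_density R B)%E.
Proof.
move=> h0 hd dl HB; have hl0 := h0 l.
pose far k m := (h k <= d k * ((h k - m %% (h k).*2) + (m %% (h k).*2 - h k)))%N.
have hR : (0 : R) < (h l)%:R by rewrite ltr0n.
have c0 : (0 : R) < (4 * (h l)%:R)^-1 by rewrite invr_gt0 mulr_gt0.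
apply: (@lower_density_gt0 _ _ (8 * h l) c0) => n hn.
(* From stage [L] on, $h_k\ge 2n$ and $d_k\ge 2$, so no window has opened before time [n]: only
   finitely many stages count. *)
pose L := (n + l).+1.
have d2 k : (l < k)%N -> (2 <= d k)%N.
  move=> lk; apply: leq_trans (dl k lk); have : (0 < 2 ^ k)%N by rewrite expn_gt0.
  by move: (2 ^ k)%N => x; clear -hl0; nia.
have farL k m : (L <= k)%N -> (m < n)%N -> far k m.
  move=> Lk mn; rewrite /far; have lk : (l < k)%N by clear -Lk; rewrite /L in Lk; lia.
  have [e e0 he] := hd k.
  have nh : (n.*2 <= h k)%N.
    rewrite he; apply: (@leq_trans (d k)); last by rewrite leq_pmulr.
    apply: leq_trans (dl k lk); have : (k < 2 ^ k)%N by exact: ltn_expl.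
    move: (2 ^ k)%N => x; rewrite /L in Lk; clear -Lk hl0; nia.
  rewrite modn_small; last by clear -mn nh; lia.
  have := d2 k lk; clear -mn nh; nia.
have sub : (count_below (fun m => m %% (h l).*2 == h l) n <=
    count_below (fun k => `[< B k >]) n + \sum_(l.+1 <= k < L) count_below (fun m => ~~ far k m) n)%N.
  rewrite /count_below exchange_big /= -big_split /= big_nat [X in (_ <= X)%N]big_nat.
  apply: leq_sum => m /andP[_ mn].
  case: eqP => // hm; case: (boolP `[< B m >]) => //= nB; rewrite add0n lt0n.
  apply/eqP => h1; move/negP: nB; apply; apply/asboolP; apply: HB; split; first exact/eqP.
  move=> k lk; have [kL|Lk] := ltnP k L; last exact: farL.
  rewrite /far_window; apply: contraT => nf; exfalso; move: h1.
  by rewrite (bigD1_seq k) ?mem_index_iota ?iota_uniq ?lk //= -/(far k m) /far nf.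
have bound k : (l < k)%N -> (count_below (fun m => ~~ far k m) n)%:R <= n%:R / (16 * (h l)%:R) * 2^-1 ^+ k :> R.
  move=> lk; have [e e0 he] := hd k.
  have dk : (0 : R) < (d k)%:R by rewrite ltr0n; apply: leq_trans (d2 k lk).
  have h1 : (count_below (fun m => ~~ far k m) n * d k <= 4 * n)%N.
    by rewrite /far he; apply: count_below_near_window e0; exact: d2.
  have h2 : (count_below (fun m => ~~ far k m) n)%:R <= 4 * n%:R / (d k)%:R :> R.
    by rewrite ler_pdivlMr // -!natrM ler_nat.
  apply: le_trans h2 _; rewrite exprVn.
  have -> : n%:R / (16 * (h l)%:R) / 2 ^+ k = 4 * n%:R / (64 * 2 ^+ k * (h l)%:R) :> R.
    by field; rewrite expf_neq0 //= gt_eqF.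
  rewrite ler_wpM2l ?mulr_ge0 // lef_pV2 ?posrE //; last by rewrite !mulr_gt0 // exprn_gt0.
  by rewrite -natrX -!natrM ler_nat dl.
have sumb : (\sum_(l.+1 <= k < L) count_below (fun m => ~~ far k m) n)%:R <= n%:R / (16 * (h l)%:R) :> R.
  rewrite natr_sum; apply: (@le_trans _ _ (\sum_(l.+1 <= k < L) n%:R / (16 * (h l)%:R) * 2^-1 ^+ k)).
    by rewrite big_nat [leRHS]big_nat; apply: ler_sum => k /andP[lk _]; exact: bound.
  rewrite -mulr_sumr ler_piMr ?divr_ge0 ?mulr_ge0 ?(ltW hR) //.
  by apply: le_trans (geometric_half_sum _ _) _; rewrite exprn_ile1 // invf_le1 // ler1n.
have nlow := count_below_odd_multiples n hl0.
have nlow' : n%:R <= ((count_below (fun m => m %% (h l).*2 == h l)%N n)%:R + 1) * (2 * (h l)%:R) :> R.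
  by rewrite natr1 -natrM -natrM ler_nat mul2n.
have sub' : (count_below (fun m => m %% (h l).*2 == h l)%N n)%:R <=
   (count_below (fun k => `[< B k >]) n)%:R + n%:R / (16 * (h l)%:R) :> R.
  by apply: le_trans (_ : _ <= _%:R) _; [rewrite ler_nat; exact: sub|rewrite natrD lerD2l].
rewrite -ler_pdivrMr ?mulr_gt0 // in nlow'.
have hn' : 8 <= n%:R / (h l)%:R :> R by rewrite ler_pdivlMr // -natrM ler_nat.
set b := (count_below (fun k => `[< B k >]) n)%:R in sub' *.
have e1 : (4 * (h l)%:R)^-1 * n%:R = n%:R / (h l)%:R / 4 :> R by rewrite invfM; ring.
have e2 : n%:R / (16 * (h l)%:R) = n%:R / (h l)%:R / 16 :> R by rewrite invfM; ring.
have e3 : n%:R / (2 * (h l)%:R) = n%:R / (h l)%:R / 2 :> R by rewrite invfM; ring.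
by move: sub' nlow' hn'; rewrite e1 e2 e3; clear; lra.
Qed.

End LowerDensity.

(** * Fréchet spaces *)

Section FrechetSpaces.
Context {R : realType} {X : tvsType (Cplx R)}.

(** Gauges inside the sections at $0$ of a countable base of entourages; partial sums make them
    increasing. *)
Lemma fundamental_seminorms : frechet X -> exists q : nat -> X -> R,
  [/\ forall k, seminorm (q k), forall j k, (j <= k)%N -> forall x, q j x <= q k x &
      forall x V, nbhs x V -> exists k, forall y, q k (y - x) < 1 -> V y].
Proof.
move=> [_ [B [Bent Bbase]] _].
have /choice [r hr] : forall n, exists r : X -> R, seminorm r /\ forall y, r y < 1 -> B n (0, y).
  move=> n; have [r sr hr] := nbhs_seminorm (nbhs_entourage 0 (Bent n)).
  by exists r; split => // y /hr /xsectionP.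
exists (fun k x => \sum_(n < k.+1) r n x); split.
- by move=> k; apply: sn_bigsum => n; have [] := hr n.
- move=> j k jk x; rewrite -!(big_mkord xpredT (fun n => r n x)).
  rewrite (@big_cat_nat _ _ _ j.+1 0 k.+1) //= lerDl.
  by apply: sumr_ge0 => n _; apply: sn_ge0; have [] := hr n.
- move=> x V nV; have [p sp pV] := nbhs_seminormP nV.
  have [_ _ /(_ 1 ltr01) /nbhsP[A Aent hA]] := sp.
  have [n BA] := Bbase A Aent; exists n => y hy; apply: pV; apply: hA.
  apply/xsectionP; apply: BA; have [_] := hr n; apply.
  apply: le_lt_trans hy; rewrite big_ord_recr /= lerDr.
  by apply: sumr_ge0 => m _; apply: sn_ge0; have [] := hr m.
Qed.

(* The uniformity of a [tvsType] need not be translation invariant, so smallness of the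
   increments in all seminorms does not make a sequence Cauchy; instead, increments are
   controlled by entourages chosen here once and for all. *)
Lemma chain_cvg : frechet X -> exists V : nat -> set (X * X),
  (forall k, entourage (V k)) /\
  forall x_ : nat -> X, (forall k, V k (x_ k, x_ k.+1)) -> exists l : X, x_ @ \oo --> l.
Proof.
move=> [_ [B [Bent Bbase]] complete].
have [V [_ hV]] := @dependent_choice_nat (set (X * X))
  (fun k A => entourage A /\ A `<=` B k) (fun k A A' => (A' \; A')%relation `<=` A) (B 0%N)
  (conj (Bent 0%N) (fun _ h => h)) (ltac:(
    move=> k A [entA _]; exists (split_ent A `&` B k.+1); split;
    [split; [apply: filterI; [exact: entourage_split_ent|exact: Bent]|by move=> ? []]|
     move=> [a b] [c [hac _] [hcb _]]; exact: (entourage_split c entA hac hcb)])).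
exists V; split=> [k|x_ hx]; first by have [[]] := hV k.
(* As [V k.+1] composed with itself lies in [V k], a whole chain of later steps is absorbed by one
   entourage. *)
have chain n : forall k, V k (x_ k.+1, x_ (k.+1 + n)%N).
  elim: n => [|n IH] k; first by rewrite addn0; apply: entourage_refl; have [[]] := hV k.
  have [_ hVk] := hV k; apply: hVk; exists (x_ k.+2); first exact: hx.
  by have := IH k.+1; rewrite addSnnS.
apply: complete => A entA.
have entA' := entourage_split_ent entA.
have [k BA] := Bbase _ (entourage_invI entA').
have near k' : (k < k')%N -> (split_ent A (x_ k', x_ k.+1) /\ split_ent A (x_ k.+1, x_ k')).
  move=> kk; have [[_ VB] _] := hV k.
  have := chain (k' - k.+1)%N k; rewrite subnKC // => /VB /BA [h1 h2].
  by split.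
exists ([set x_ k' | k' in [set k' | (k < k')%N]], [set x_ k' | k' in [set k' | (k < k')%N]]).
  by split; exists k.+1 => // m /= km; exists m.
move=> [_ _] /= [[a ka <-] [b kb <-]].
exact: (entourage_split (x_ k.+1) entA (near a ka).1 (near b kb).2).
Qed.

(** If no box fitted, picking a bad point in each would give a sequence outside [W] converging
    pointwise to [w]. *)
Lemma ptws_box (I : choiceType) (q : nat -> X -> R) (W : set {ptws I -> X}) (w : I -> X) :
  (forall k, seminorm (q k)) -> (forall j k, (j <= k)%N -> forall x, q j x <= q k x) ->
  (forall x V, nbhs x V -> exists k, forall y, q k (y - x) < 1 -> V y) ->
  open W -> W w -> exists k, forall y : I -> X, (forall i, q k (y i - w i) < 1) -> W y.
Proof.
move=> sq qm qb oW Ww; apply: contrapT => nex.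
have /choice [f hf] : forall k, exists y : I -> X, (forall i, q k (y i - w i) < 1) /\ ~ W y.
  move=> k; apply: contrapT => ny; apply: nex; exists k => y hy.
  by apply: contrapT => nW; apply: ny; exists y.
have fw : (f : nat -> {ptws I -> X}) @ \oo --> (w : {ptws I -> X}).
  rewrite cvg_sup => i.
  rewrite cvg_image; last by rewrite eqEsubset; split=> v // _; exists (fun _ => v).
  have fi : (fun k => f k i) @ \oo --> w i.
    move=> V /qb [k hk]; exists k => // m /= km; apply: hk.
    by have [+ _] := hf m; move=> /(_ i); apply: le_lt_trans; exact: qm.
  move=> V /fi hV; exists ((fun g : I -> X => g i) @^-1` V); first exact: hV.
  by rewrite eqEsubset; split => [j [? + <-//]|j Vj]; exists (fun _ => j).
have [n _ hn] := fw W (open_nbhs_nbhs (conj oW Ww)).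
by have [_ ] := hf n; apply; exact: hn n (leqnn n).
Qed.

End FrechetSpaces.

(** * Inductive construction *)

Definition admissible (R : realType) (N : nat) (X : tvsType (Cplx R))
  (T : 'I_N -> {linear X -> X}) (w : 'I_N -> X) (M : nat) : Prop :=
  [/\ (0 < M)%N, forall i, iter M (T i) (w i) = w i &
      forall i j, j != i -> vanishing (fun m => iter m (T j) (w i))].

(** Besides the properties of the new increment, [h] must be so late that from then on the old
    vectors are small under the other operators. The entourage concerns the sum over [i], as it is
    this sum that has to converge. *)
Definition stage_step (R : realType) (N : nat) (X : tvsType (Cplx R))
  (T : 'I_N -> {linear X -> X}) (q : X -> R) (eps : R) (V : set (X * X))
  (y : 'I_N -> X) (d : nat) (w w' : 'I_N -> X) (h : nat) : Prop :=
  [/\ (exists2 e, (0 < e)%N & h = (d * e)%N),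
      forall i, iter h.*2 (T i) (w' i - w i) = w' i - w i,
      forall i, q (iter h (T i) (w' i - w i) - (y i - w i)) <= eps,
      forall i m, far_window d h m -> q (iter m (T i) (w' i - w i)) <= eps &
      [/\ forall i j m, j != i -> q (iter m (T j) (w' i - w i)) <= eps,
          forall i j m, j != i -> (h <= m)%N -> q (iter m (T j) (w i)) <= eps &
          V (\sum_i w i, \sum_i w' i)]].

Section Stage.
Context {R : realType} {N : nat} {X : tvsType (Cplx R)}.
Variable T : 'I_N -> {linear X -> X}.
Hypothesis blockT : forall i x, block T i x.

Lemma stage_exists (q : X -> R) (eps : R) (V : set (X * X)) (y : 'I_N -> X)
    (d M : nat) (w : 'I_N -> X) :
  seminorm q -> 0 < eps -> entourage V -> (0 < d)%N -> (M %| d)%N -> admissible T w M ->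
  exists w' h, admissible T w' h.*2 /\ stage_step T q eps V y d w w' h.
Proof.
move=> sq eps0 entV d0 Md [M0 wper wvan].
have [r sr hr] := nbhs_seminormP (nbhs_entourage (\sum_i w i) entV).
have NR : (0 : R) < N.+1%:R by rewrite ltr0n.
(* [N] increments of [r]-size at most $1/(N+1)$ add up to less than $1$, as the entourage
   demands. *)
pose eps' := Num.min eps N.+1%:R^-1.
have eps'0 : 0 < eps' by rewrite lt_min eps0 invr_gt0.
have eps'1 : eps' <= eps by rewrite ge_min lexx.
have eps'2 : eps' <= N.+1%:R^-1 by rewrite ge_min lexx orbT.
pose s x := q x + r x.
have ss : seminorm s by exact: snDsn.
have qs x : q x <= s x by rewrite lerDl sn_ge0.
have rs x : r x <= s x by rewrite lerDr sn_ge0.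
have /choice [n1 hn1] := fun i => blockT i (y i - w i) ss eps'0 d0.
have /choice [n2 hn2] : forall ij : 'I_N * 'I_N, exists n, ij.2 != ij.1 ->
    forall m, (n <= m)%N -> q (iter m (T ij.2) (w ij.1)) <= eps.
  move=> [i j] /=; have [->|ji] := eqVneq j i; first by exists 0%N.
  by have [n hn] := wvan i j ji q sq eps eps0; exists n.
pose e := (\max_i n1 i + \max_ij n2 ij).+1; pose h := (d * e)%N.
have eh : (e <= h)%N by rewrite leq_pmull.
have n1h i : (n1 i <= h)%N.
  by apply: leq_trans eh; rewrite ltnW // ltnS (leq_trans (leq_bigmax i)) // leq_addr.
have n2h ij : (n2 ij <= h)%N.
  by apply: leq_trans eh; rewrite ltnW // ltnS (leq_trans (leq_bigmax ij)) // leq_addl.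
have h0 : (0 < h)%N by rewrite muln_gt0 d0.
have /choice [u hu] := fun i => hn1 i h (n1h i).
have uw i : w i + u i - w i = u i by rewrite addrC addKr.
exists (fun i => w i + u i), h; split.
  split=> [|i|i j ji]; first by rewrite double_gt0.
    have [u1 _ _ _ _] := hu i; rewrite iterfD u1; congr (_ + _).
    have /dvdnP[k ->] : (M %| h.*2)%N by rewrite -muln2 -mulnA dvdn_mulr.
    exact: iterf_period.
  have [_ _ _ _ u5] := hu i.
  by apply: vanishing_ext (vanishingD (wvan i j ji) (u5 j 0%N ji)) => m; rewrite iterfD.
split.
- by exists e.
- by move=> i; rewrite uw; have [u1 _ _ _ _] := hu i.
- move=> i; rewrite uw; have [_ u2 _ _ _] := hu i.
  by rewrite (le_trans (qs _)) // (le_trans u2).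
- move=> i m hm; rewrite uw; have [_ _ u3 _ _] := hu i.
  by rewrite (le_trans (qs _)) // (le_trans (u3 m hm)).
- split.
  + move=> i j m ji; rewrite uw; have [_ _ _ u4 _] := hu i.
    by rewrite (le_trans (qs _)) // (le_trans (u4 j m ji)).
  + by move=> i j m ji hm; apply: (hn2 (i, j)) => //; exact: leq_trans hm.
  + apply/xsectionP; apply: hr; rewrite big_split /= [X in X - _]addrC addrK.
    apply: (@le_lt_trans _ _ (\sum_(i < N) N.+1%:R^-1)).
      rewrite (le_trans (sn_sum sr _ _ _)) //; apply: ler_sum => i _.
      rewrite (le_trans (rs _)) // (le_trans _ eps'2) //.
      (* Time $0$ lies outside the window, so the increment itself is small. *)
      have [_ _ u3 _ _] := hu i; have := u3 0%N; apply.
      by rewrite /far_window mod0n subn0 sub0n addn0 leq_pmull.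
    by rewrite sumr_const card_ord -[_ *+ N]mulr_natl ltr_pdivrMr // mul1r ltr_nat.
Qed.

End Stage.

(** * Orbits of the limit vector *)

Section Orbits.
Context {R : realType} {N : nat} {X : tvsType (Cplx R)}.
Variable T : 'I_N -> {linear X -> X}.
Hypothesis Tcts : forall i, continuous (T i).
Variables (q : nat -> X -> R) (V : nat -> set (X * X)) (y : nat -> 'I_N -> X) (eps0 : R).
Hypothesis sq : forall k, seminorm (q k).
Hypothesis qm : forall j k, (j <= k)%N -> forall x, q j x <= q k x.
Hypothesis eps00 : 0 < eps0.
Variables (w : nat -> 'I_N -> X) (M h : nat -> nat) (x : X).
Let d k := (64 * 2 ^ k * M k)%N.
Let eps k : R := eps0 * 2^-1 ^+ k.
Hypothesis adm : forall k, admissible T (w k) (M k).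
Hypothesis Mh : forall k, M k.+1 = (h k).*2.
Hypothesis step : forall k, stage_step T (q k) (eps k) (V k) (y k) (d k) (w k) (w k.+1) (h k).
Hypothesis limx : (fun k => \sum_i w k i) @ \oo --> x.

Let M0 k : (0 < M k)%N. Proof. by have [] := adm k. Qed.
Let h0 k : (0 < h k)%N. Proof. by have := M0 k.+1; rewrite Mh double_gt0. Qed.
Let d0 k : (0 < d k)%N. Proof. by rewrite /d !muln_gt0 M0 expn_gt0. Qed.
Let eps_gt0 k : 0 < eps k. Proof. by rewrite mulr_gt0 // exprn_gt0. Qed.

Let Dw k i := w k.+1 i - w k i.

Lemma increments l L i : (l <= L)%N -> w L i = w l i + \sum_(l <= k < L) Dw k i.
Proof. by move=> lL; rewrite telescope_sumr // addrC subrK. Qed.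

Lemma tail_eps l L : \sum_(l.+1 <= k < L) eps k <= eps l.
Proof. by rewrite -mulr_sumr ler_wpM2l ?(ltW eps00) // geometric_half_sum. Qed.

Lemma stage_gap l k : (l < k)%N -> (64 * 2 ^ k * h l <= d k)%N.
Proof.
move=> lk; rewrite /d leq_mul2l; apply/orP; right.
have MS j : (M j <= M j.+1)%N.
  rewrite Mh; have [[e e0 he] _ _ _ _] := step j; rewrite he /d.
  by rewrite -addnn (leq_trans _ (leq_addr _ _)) // mulnAC leq_pmull // !muln_gt0 expn_gt0.
apply: (@leq_trans (M l.+1)); first by rewrite Mh -addnn leq_addr.
rewrite -(subnKC lk); elim: (k - l.+1)%N => [|m IH]; first by rewrite addn0.
by rewrite addnS (leq_trans IH).
Qed.

(** This yields density of the set of vectors: each of the [N] components moves by at most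
    $\sum_k\varepsilon_k\le 2\varepsilon_0$, and one more $\varepsilon_0$ pays for the limit. *)
Lemma limit_near_start : q 0 (x - \sum_i w 0%N i) <= (N%:R * 2 + 1) * eps0.
Proof.
have [L hL] : exists L, q 0 (\sum_i w L i - x) < eps0.
  by have [L _ hL] := sn_cvg _ (sq 0) limx eps00; exists L; exact: hL L (leqnn L).
rewrite (le_trans (sn_tri (sq 0) (\sum_i w L i) _ _)) // [leRHS]mulrDl addrC mul1r lerD //.
  have -> : \sum_i w L i - \sum_i w 0%N i = \sum_(i < N) \sum_(0 <= k < L) Dw k i.
    by rewrite -sumrB; apply: eq_bigr => i _; rewrite (increments i (leq0n L)) addrC addKr.
  rewrite (le_trans (sn_sum (sq 0) _ _ _)) //.
  have -> : N%:R * 2 * eps0 = \sum_(i < N) (2 * eps0).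
    by rewrite sumr_const card_ord -[RHS]mulr_natl mulrA.
  apply: ler_sum => i _; rewrite (le_trans (sn_sum (sq 0) _ _ _)) //.
  apply: (@le_trans _ _ (\sum_(0 <= k < L) eps k)).
    apply: ler_sum => k _; rewrite (le_trans (qm (leq0n k) _)) //.
    have [_ _ _ h3 _] := step k; apply: (h3 i 0%N).
    by rewrite /far_window mod0n subn0 sub0n addn0 leq_pmull.
  case: L {hL} => [|L]; first by rewrite big_geq // mulr_ge0 ?(ltW eps00).
  rewrite big_ltn // (le_trans (lerD (lexx _) (tail_eps 0 _))) //.
  by rewrite /eps expr0 mulr1 mulr_natl.
by rewrite (snBC (sq 0)) ltW.
Qed.

(** Each component costs three errors. For $j\ne i$ they are the old vector, the increment of stage
    [l] and the tail; for $j=i$ the old vector is fixed by $T_i^m$ and already deducted from the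
    target. The extra error is the passage to the limit. *)
Lemma orbit_estimate l m i : hit_times h d l m ->
  q l (iter m (T i) x - y l i) <= (N%:R * 3 + 1) * eps l.
Proof.
move=> [/eqP mh far]; set e := eps l.
have e0 : 0 < e := eps_gt0 l.
(* [L] may depend on [m], because the estimates for the partial sums do not depend on [L]. *)
have [L lL hL] : exists2 L, (l < L)%N & q l (iter m (T i) (\sum_j w L j - x)) <= e.
  have [L0 _ hL0] := sn_cvg _ (sn_iter m (sq l) (@Tcts i)) limx e0.
  exists (maxn L0 l.+1); first by rewrite leq_maxr.
  by apply: ltW; apply: hL0; rewrite /= leq_maxl.
have [[a a0 ha] s1 s2 s3 [s4 s5 _]] := step l.
have hm : (h l <= m)%N by rewrite (leq_trans _ (leq_mod m (h l).*2)) // mh.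
have mE : m = (m %/ (h l).*2 * (h l).*2 + h l)%N by rewrite {1}(divn_eq m (h l).*2) mh.
have Mm : (M l %| m)%N.
  have Mhl : (M l %| h l)%N by rewrite ha /d -mulnA dvdn_mull // dvdn_mulr.
  by rewrite mE dvdn_add // dvdn_mull // -muln2 dvdn_mulr.
have wi : iter m (T i) (w l i) = w l i.
  by have /dvdnP[k ->] := Mm; have [_ per _] := adm l; exact: iterf_period.
have Di : iter m (T i) (Dw l i) = iter (h l) (T i) (Dw l i).
  by rewrite mE addnC iterD iterf_period // s1.
have tail j : q l (\sum_(l.+1 <= k < L) iter m (T i) (Dw k j)) <= e.
  rewrite (le_trans (sn_sum (sq l) _ _ _)) // (le_trans _ (tail_eps l L)) //.
  rewrite big_nat [leRHS]big_nat; apply: ler_sum => k /andP[lk _].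
  rewrite (le_trans (qm (ltnW lk) _)) //.
  have [_ _ _ t3 [t4 _ _]] := step k.
  have [<-|ij] := eqVneq i j; first exact: (t3 i m (far k lk)).
  exact: t4.
have iterL j : iter m (T i) (w L j) = iter m (T i) (w l j) + iter m (T i) (Dw l j) +
    \sum_(l.+1 <= k < L) iter m (T i) (Dw k j).
  rewrite (increments j (ltnW lL)) big_ltn // iterfD iterfD iterf_sum addrA //.
rewrite (le_trans (sn_tri (sq l) (iter m (T i) (\sum_j w L j)) _ _)) //.
rewrite mulrDl mul1r addrC lerD //; last by rewrite (snBC (sq l)) -iterfB.
have -> : iter m (T i) (\sum_j w L j) - y l i =
   \sum_(j < N) (iter m (T i) (w L j) - (if j == i then y l i else 0)).
  by rewrite iterf_sum sumrB -big_mkcond /= big_pred1_eq.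
rewrite (le_trans (sn_sum (sq l) _ _ _)) //.
have -> : N%:R * 3 * e = \sum_(j < N) (3 * e).
  by rewrite sumr_const card_ord -[RHS]mulr_natl mulrA.
apply: ler_sum => j _; rewrite iterL; have tj := tail j.
have [->|ji] := eqVneq j i.
  rewrite wi Di [X in q l X](_ : _ = (iter (h l) (T i) (Dw l i) - (y l i - w l i)) +
     \sum_(l.+1 <= k < L) iter m (T i) (Dw k i)); last first.
    by rewrite opprB [LHS](AC (3*1) (2*(1*4)*3)).
  have := snD (sq l) (iter (h l) (T i) (Dw l i) - (y l i - w l i))
     (\sum_(l.+1 <= k < L) iter m (T i) (Dw k i)).
  by have := s2 i; have := tail i; rewrite -/e -/(Dw l i); lra.
rewrite subr0 eq_sym in ji *.
have := snD (sq l) (iter m (T i) (w l j) + iter m (T i) (Dw l j))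
     (\sum_(l.+1 <= k < L) iter m (T i) (Dw k j)).
have := snD (sq l) (iter m (T i) (w l j)) (iter m (T i) (Dw l j)).
have := s4 j i m ji; have := s5 j i m ji hm.
by rewrite -/e -/(Dw l j); lra.
Qed.

Lemma hits_density l (B : set nat) : hit_times h d l `<=` B -> (0 < lower_density R B)%E.
Proof.
apply: hit_times_density => //; last by move=> k; exact: stage_gap.
by move=> k; have [[e e0 he] _ _ _ _] := step k; exists e.
Qed.

End Orbits.

(** * Enumeration of the targets and conclusion *)

Section Assembly.
Context {R : realType} {N : nat} {X : tvsType (Cplx R)}.
Variable T : 'I_N -> {linear X -> X}.

(* The exponent of [2] in [l.+1] takes each value infinitely often. *)
Definition recurrent_targets (C : countType) (D : C -> X) (l : nat) (i : 'I_N) : X :=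
  if unpickle (logn 2 l.+1) is Some g then D ((g : {ffun 'I_N -> C}) i) else 0.

Lemma recurrent_targets_often (C : countType) (D : C -> X) (g : 'I_N -> C) k :
  exists2 l, (k <= l)%N & forall i, recurrent_targets D l i = D (g i).
Proof.
(* $l+1=2^a(2k+1)$ has $2$-adic valuation $a$, the code of [g], and $l\ge k$. *)
pose a := pickle [ffun i => g i]; pose l := (2 ^ a * k.*2.+1).-1.
have l1 : l.+1 = (2 ^ a * k.*2.+1)%N by rewrite prednK // muln_gt0 expn_gt0.
exists l.
  have : (0 < 2 ^ a)%N by rewrite expn_gt0.
  by move: l1; move: (2 ^ a)%N => b; nia.
move=> i; rewrite /recurrent_targets l1 lognM ?expn_gt0 // pfactorK //.
by rewrite lognE /= dvdn2 /= odd_double /= addn0 pickleK ffunE.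
Qed.

Lemma stages_exist (q : nat -> X -> R) (eps : nat -> R) (V : nat -> set (X * X))
    (y : nat -> 'I_N -> X) (w0 : 'I_N -> X) (M0 : nat) :
  (forall i x, block T i x) -> (forall k, seminorm (q k)) -> (forall k, 0 < eps k) ->
  (forall k, entourage (V k)) -> admissible T w0 M0 ->
  exists (w : nat -> 'I_N -> X) (M h : nat -> nat),
   [/\ w 0%N = w0, forall k, admissible T (w k) (M k), forall k, M k.+1 = (h k).*2 &
    forall k, stage_step T (q k) (eps k) (V k) (y k) (64 * 2 ^ k * M k) (w k) (w k.+1) (h k)].
Proof.
move=> blockT sq eps0 entV adm0.
pose Q k (a b : ('I_N -> X) * nat) := exists2 h, b.2 = h.*2 &
  stage_step T (q k) (eps k) (V k) (y k) (64 * 2 ^ k * a.2) a.1 b.1 h.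
have next k a : admissible T a.1 a.2 -> exists b, admissible T b.1 b.2 /\ Q k a b.
  case: a => w M /= adm; have [M_gt0 _ _] := adm.
  have d0 : (0 < 64 * 2 ^ k * M)%N by rewrite !muln_gt0 expn_gt0.
  have [w' [h [adm' st]]] :=
    stage_exists blockT (y k) (sq k) (eps0 k) (entV k) d0 (dvdn_mull _ (dvdnn M)) adm.
  by exists (w', h.*2); split => //; exists h.
have [F [F0 hF]] := dependent_choice_nat (P := fun _ a => admissible T a.1 a.2)
  (a0 := (w0, M0)) adm0 next.
exists (fun k => (F k).1), (fun k => (F k).2), (fun k => (F k.+1).2./2); split.
- by rewrite F0.
- by move=> k; have [] := hF k.
- by move=> k; have [_ [h -> _]] := hF k; rewrite doubleK.
- by move=> k; have [_ [h -> st]] := hF k; rewrite doubleK.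
Qed.

Lemma dense_of_blocks (C : countType) (D : C -> X) : (0 < N)%N ->
  frechet X -> (forall i, continuous (T i)) -> (forall i x, block T i x) ->
  (forall x p, seminorm p -> forall e : R, 0 < e -> exists c, p (x - D c) <= e) ->
  densely_d_freq_hypercyclic R (fun i => (T i : X -> X)).
Proof.
move=> N0 fX Tc blockT denseD G [x0 Gx0] oG.
have [p [sp pm pb]] := fundamental_seminorms fX.
have [V [entV Vcvg]] := chain_cvg fX.
have [k0 hk0] := pb x0 G (open_nbhs_nbhs (conj oG Gx0)).
(* Shifting the index lets the weakest seminorm [q 0] already detect membership in [G]. *)
pose q k := p (k + k0)%N.
have sq k : seminorm (q k) by exact: sp.
have qm j k : (j <= k)%N -> forall x, q j x <= q k x by move=> jk; apply: pm; rewrite leq_add2r.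
have qb x W : nbhs x W -> exists k, forall y, q k (y - x) < 1 -> W y.
  move=> /pb [k hk]; exists k => y hy; apply: hk; apply: le_lt_trans hy.
  by apply: pm; rewrite leq_addr.
have NR : (0 : R) < N%:R * 2 + 1 by rewrite ltr_wpDl // mulr_ge0.
(* The limit then stays within $1/4$ of the starting sum, itself within $1/4$ of [x0]. *)
pose eps0 : R := (4 * (N%:R * 2 + 1))^-1.
have eps00 : 0 < eps0 by rewrite invr_gt0 mulr_gt0.
pose i0 : 'I_N := Ordinal N0.
have e4 : 0 < 4^-1 :> R by rewrite invr_gt0.
have [n hn] := blockT i0 x0 (q 0%N) (sq 0%N) _ e4 1%N isT.
have [u [u1 u2 _ _ u5]] := hn n.+1 (leqnSn n).
(* The block [u] approximates [x0] only at time [n.+1], so the construction starts from that point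
   of its orbit; this is where [block_at] needs convergence to $0$ for shifted vectors. The
   successor makes the period positive. *)
pose w0 i := if i == i0 then iter n.+1 (T i0) u else 0.
have adm0 : admissible T w0 n.+1.*2.
  split=> [//|i|i j ji]; rewrite /w0; case: eqP => [ii0|_]; rewrite ?iterf0 //.
  - by rewrite ii0 -iterD addnC iterD u1.
  - by apply: u5; rewrite -ii0.
  - by move=> r sr rho rho0; exists 0%N => m _; rewrite iterf0 sn0 // ltW.
pose y := @recurrent_targets C D.
have epsk k : 0 < eps0 * 2^-1 ^+ k by rewrite mulr_gt0 // exprn_gt0.
have [w [M [h [w00 adm Mh step]]]] := stages_exist y blockT sq epsk entV adm0.
have [x hx] : exists x : X, (fun k => \sum_i w k i) @ \oo --> x.
  by apply: Vcvg => k; have [_ _ _ _ [_ _]] := step k.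
exists x; split.
  apply: hk0; apply: (@le_lt_trans _ _ (q 0%N (x - x0))); first by apply: pm; rewrite leq_addl.
  have sw : \sum_i w 0%N i = iter n.+1 (T i0) u.
    by rewrite w00 /w0 -big_mkcond /= big_pred1_eq.
  have := limit_near_start sq qm eps00 adm step hx; rewrite sw.
  have -> : (N%:R * 2 + 1) * eps0 = 4^-1.
    by rewrite /eps0 invfM mulrCA divff ?mulr1 // gt_eqF.
  by have := sn_tri (sq 0%N) (iter n.+1 (T i0) u) x x0; move: u2; clear; lra.
move=> W oW [v Wv].
have [k1 hk1] := ptws_box sq qm qb oW Wv.
have e2 : 0 < 2^-1 :> R by rewrite invr_gt0.
have /choice [g hg] := fun i => denseD (v i) (q k1) (sq k1) _ e2.
have [k2 hk2] := half_pow_small ((N%:R * 3 + 1) * eps0) e2.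
(* $l\ge k_1$ makes [q l] dominate [q k1], and $l\ge k_2$ brings the orbit error below $1/2$; the
   other $1/2$ is the distance from the target to [v]. *)
have [l] := recurrent_targets_often D g (maxn k1 k2); rewrite geq_max => /andP[k1l k2l] yl.
apply: (hits_density adm Mh step (l := l)) => m hm /=.
apply: hk1 => i; have := orbit_estimate Tc sq qm eps00 adm step hx i hm.
rewrite /y yl => h1.
have h2 : (N%:R * 3 + 1) * (eps0 * 2^-1 ^+ l) < 2^-1.
  apply: le_lt_trans hk2; rewrite mulrA ler_wpM2l ?mulr_ge0 ?addr_ge0 ?mulr_ge0 ?(ltW eps00) //.
  by apply: ler_wiXn2l => //; rewrite invf_le1 // ler1n.
have h3 : q k1 (iter m (T i) x - D (g i)) <= (N%:R * 3 + 1) * (eps0 * 2^-1 ^+ l).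
  by apply: le_trans h1; apply: qm.
have h4 := hg i; rewrite (snBC (sq k1)) in h4.
have := sn_tri (sq k1) (D (g i)) (iter m (T i) x) (v i).
by move: h2 h3 h4; clear; lra.
Qed.

End Assembly.

Theorem theorem8p2 (R : realType) (N : nat) (X : tvsType (Cplx R))
  (T : 'I_N -> {linear X -> X})
  (O U : set (Cplx R)) (E : Cplx R -> X) (phi : 'I_N -> Cplx R -> Cplx R) :
  (2 <= N)%N ->
  frechet X ->
  (forall i, continuous (T i)) ->
  open O -> connected O ->
  holomorphic_on E O ->
  open U -> connected U -> O `<=` U ->
  (forall i, holomorphic_on (phi i : Cplx R -> (Cplx R)^o) U) ->
  (forall i, ~ exists c : Cplx R, forall z, U z -> phi i z = c) ->
  closed_lin_span (E @` O) = setT ->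
  (forall i z, O z -> T i (E z) = phi i z *: E z) ->
  (forall i, exists z, [/\ O z, `|phi i z| = 1
                         & forall j, j != i -> `|phi j z| < 1]) ->
  densely_d_freq_hypercyclic R (fun i => (T i : X -> X)).
Proof.
move=> N2 fX Tc oO cO hE oU cU OU hphi nphi spanE eig zi.
apply: (dense_of_blocks (D := rat_comb E)) => //.
- exact: ltnW.
- move=> i x; have [z [Oz z1 zj]] := zi i.
  apply: (block_all Tc oO hE oU cU OU hphi nphi eig cO spanE Oz (norm_eq1 z1)).
  by move=> j /zj /norm_lt1.
- by move=> x p sp e e0; exact: (rat_comb_dense hE spanE).
Qed.
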